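(* Let $G$ be a second countable compact abelian group, let $A$ be a $C^*$-algebra, and let $\alpha\colon G\to\mathrm{Aut}(A)$ be a continuous action. If $\dim_{\mathrm{Rok}}(\alpha)<\infty$, then $\alpha$ is hereditarily saturated, that is, $\widetilde{\Gamma}(\alpha)=\widehat{G}$.
   Context: Strong Connes spectrum. For $\tau\in\widehat{G}$ let $A_\tau=\{a\in A\colon\alpha_g(a)=\tau(g)a\text{ for all }g\in G\}$. The strong Arveson spectrum is $\widetilde{\mathrm{Sp}}(\alpha)=\{\tau\in\widehat{G}\colon\overline{A_\tau^*AA_\tau}=A\}$, where $\overline{A_\tau^*AA_\tau}$ is the closed linear span of such products. With $\mathrm{Her}_\alpha(A)$ the set of all $\alpha$-invariant hereditary subalgebras of $A$, the strong Connes spectrum is $\widetilde{\Gamma}(\alpha)=\bigcap_{B\in\mathrm{Her}_\alpha(A)}\widetilde{\mathrm{Sp}}(\alpha|_B)$. Rokhlin dimension. For a $C^*$-algebra $A$, set $A_\infty=\ell^\infty(\mathbb{N},A)/c_0(\mathbb{N},A)$ with quotient map $\eta_A$; $A$ embeds via constant sequences. For a $C^*$-subalgebra $D\subseteq A$, $F(D,A)=(A_\infty\cap D')/\mathrm{Ann}(D,A_\infty)$, where $\mathrm{Ann}(D,A_\infty)$ is the annihilator of $D$ in $A_\infty$, with quotient map $\kappa_{D,A}$. For a continuous action $\alpha$ of a compact group $G$ and $D$ $\alpha$-invariant, $A_{\infty,\alpha}$ is the image under $\eta_A$ of the bounded sequences $(a_n)$ with $g\mapsto(\alpha_g(a_n))_n$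 norm continuous, and $F_\alpha(D,A)=\kappa_{D,A}(A_{\infty,\alpha}\cap D')$ with induced action $F(\alpha)$. A completely positive contractive (cpc) map $\varphi$ has order zero if $\varphi(c_1)\varphi(c_2)=0$ whenever $c_1,c_2\ge0$, $c_1c_2=0$. $\dim_{\mathrm{Rok}}(\alpha)$ is the least $d\ge 0$ such that for every $\sigma$-unital $\alpha$-invariant subalgebra $D\subseteq A$ there are equivariant cpc order zero maps $\varphi_0,\dots,\varphi_d\colon (C(G),\mathtt{Lt})\to (F_\alpha(D,A),F(\alpha))$ with $\sum_{j}\varphi_j(1)=1$, where $\mathtt{Lt}$ is left translation; it is $\infty$ if no such $d$ exists. *)

(* Defs.v *)
From HB Require Import structures.
From mathcomp Require Import all_boot all_order all_algebra ring_quotient.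
From mathcomp Require Import complex.
From mathcomp Require Import boolp classical_sets functions reals ereal.
From mathcomp Require Import topology normedtype sequences.

Set Implicit Arguments.
Unset Strict Implicit.
Unset Printing Implicit Defensive.

Import Order.TTheory GRing.Theory Num.Theory.
Import numFieldNormedType.Exports.

Local Open Scope classical_set_scope.
Local Open Scope complex_scope.
Local Open Scope ring_scope.

Reserved Notation "x ** y" (at level 40, left associativity).

HB.mixin Record isStarAlgebra (R : realType) A of GRing.Lmodule R[i] A := {
  smul : A -> A -> A;
  star : A -> A;
  smulA : associative smul;
  smulDl : left_distributive smul +%R;
  smulDr : right_distributive smul +%R;
  scale_smull : forall (c : R[i]) (x y : A), smul (c *: x) y = c *: smul x y;
  scale_smulr : forall (c : R[i]) (x y : A), smul x (c *: y) = c *: smul x y;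
  starK : involutive star;
  starD : {morph star : x y / x + y};
  starZ : forall (c : R[i]) (x : A), star (c *: x) = Num.conj c *: star x;
  starM : forall x y : A, star (smul x y) = smul (star y) (star x)
}.

(* Not necessarily unital complex *-algebras. *)
#[short(type="starAlgType")]
HB.structure Definition StarAlgebra (R : realType) :=
  {A of isStarAlgebra R A & GRing.Lmodule R[i] A}.

Notation "x ** y" := (smul x y) : ring_scope.

HB.mixin Record isCStarAlgebra (R : realType) A
    of StarAlgebra R A & CompleteNormedModule R[i] A := {
  norm_smul : forall x y : A, `|x ** y| <= `|x| * `|y|;
  norm_star_smul : forall x : A, `|star x ** x| = `|x| ^+ 2
}.

#[short(type="cstarAlgType")]
HB.structure Definition CStarAlgebra (R : realType) :=
  {A of isCStarAlgebra R A & StarAlgebra R A & CompleteNormedModule R[i] A}.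

(* The norm of a normed module over R[i] takes its values in R[i]. *)
Definition rnorm (R : realType) (V : normedModType R[i]) (x : V) : R :=
  complex.Re `|x|.

Section StarAlgebraTheory.
Context {R : realType} {A : starAlgType R}.
Implicit Types x y z : A.

Lemma smul0r x : 0 ** x = 0.
Proof. by rewrite -(scale0r 0) scale_smull !scale0r. Qed.

Lemma smulr0 x : x ** 0 = 0.
Proof. by rewrite -(scale0r 0) scale_smulr !scale0r. Qed.

Lemma smulNr x y : (- x) ** y = - (x ** y).
Proof. by rewrite -scaleN1r scale_smull scaleN1r. Qed.

Lemma smulrN x y : x ** (- y) = - (x ** y).
Proof. by rewrite -scaleN1r scale_smulr scaleN1r. Qed.

Lemma smulBl x y z : (x - y) ** z = x ** z - y ** z.
Proof. by rewrite smulDl smulNr. Qed.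

Lemma smulBr x y z : z ** (x - y) = z ** x - z ** y.
Proof. by rewrite smulDr smulrN. Qed.

Lemma star0 : star (0 : A) = 0.
Proof. by rewrite -(scale0r 0) starZ rmorph0 !scale0r. Qed.

Lemma starN x : star (- x) = - star x.
Proof. by rewrite -scaleN1r starZ rmorphN rmorph1 scaleN1r. Qed.

Lemma starB x y : star (x - y) = star x - star y.
Proof. by rewrite starD starN. Qed.

Definition is_star_subalg (S : set A) : Prop :=
  [/\ S 0, forall x y, S x -> S y -> S (x + y),
      forall (c : R[i]) x, S x -> S (c *: x),
      forall x y, S x -> S y -> S (x ** y)
    & forall x, S x -> S (star x)].

Definition is_star_ideal (I : set A) : Prop :=
  [/\ I 0, forall x y, I x -> I y -> I (x + y),
      forall (c : R[i]) x, I x -> I (c *: x),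
      forall x y, I y -> I (x ** y) /\ I (y ** x)
    & forall x, I x -> I (star x)].

(* In a C*-algebra these are exactly the self-adjoint elements with nonnegative
   spectrum.  The same description is used in M_n(A), whose product and adjoint
   are written out in [mx_positive]. *)
Definition positive x : Prop := exists y, x = star y ** y.

Definition mx_positive n (X : 'M[A]_n) : Prop :=
  exists Y : 'M[A]_n, X = \matrix_(i, j) \sum_k star (Y k i) ** Y k j.

(* The algebras need not be known to be unital: an equation e = 1 is stated by
   saying that e is a unit element. *)
Definition is_unit_elt (e : A) : Prop := forall x, e ** x = x /\ x ** e = x.

End StarAlgebraTheory.

Section ComplexStar.
Variable R : realType.
Let C := (R[i]^o : Type).

HB.instance Definition _ := @isStarAlgebra.Build R R[i]^o
  *%R Num.conj (@mulrA _) (@mulrDl _) (@mulrDr _)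
  (fun c x y => esym (mulrA c x y)) (fun c x y => mulrCA x c y)
  (@conjCK _) (rmorphD Num.conj) (rmorphM Num.conj)
  (fun x y => etrans (rmorphM Num.conj x y) (mulrC _ _)).

End ComplexStar.

Section FunStar.
Variables (R : realType) (T : Type) (A : starAlgType R).
Implicit Types f g h : T -> A.

Let fmul f g : T -> A := fun t => f t ** g t.
Let fstar f : T -> A := fun t => star (f t).

Let fmulA : associative fmul.
Proof. by move=> f g h; apply/funext => t; exact: smulA. Qed.
Let fmulDl : left_distributive fmul +%R.
Proof. by move=> f g h; apply/funext => t; exact: smulDl. Qed.
Let fmulDr : right_distributive fmul +%R.
Proof. by move=> f g h; apply/funext => t; exact: smulDr. Qed.
Let fmulZl (c : R[i]) f g : fmul (c *: f) g = c *: fmul f g.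
Proof. by apply/funext => t; exact: scale_smull. Qed.
Let fmulZr (c : R[i]) f g : fmul f (c *: g) = c *: fmul f g.
Proof. by apply/funext => t; exact: scale_smulr. Qed.
Let fstarK : involutive fstar.
Proof. by move=> f; apply/funext => t; exact: starK. Qed.
Let fstarD : {morph fstar : f g / f + g}.
Proof. by move=> f g; apply/funext => t; exact: starD. Qed.
Let fstarZ (c : R[i]) f : fstar (c *: f) = Num.conj c *: fstar f.
Proof. by apply/funext => t; exact: starZ. Qed.
Let fstarM f g : fstar (fmul f g) = fmul (fstar g) (fstar f).
Proof. by apply/funext => t; exact: starM. Qed.

HB.instance Definition _ := @isStarAlgebra.Build R (T -> A) fmul fstar
  fmulA fmulDl fmulDr fmulZl fmulZr fstarK fstarD fstarZ fstarM.

End FunStar.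

Record starSubalg (R : realType) (A : starAlgType R) := StarSubalg {
  subalg_set : set A;
  subalgP : is_star_subalg subalg_set
}.

Definition subalg (R : realType) (A : starAlgType R) (S : starSubalg A) : Type :=
  {x : A | x \in subalg_set S}.

Section SubalgStar.
Variables (R : realType) (A : starAlgType R) (S : starSubalg A).
Local Notation inS := (subalg_set S).

HB.instance Definition _ := SubType.copy (subalg S) {x : A | x \in subalg_set S}.
HB.instance Definition _ := Choice.copy (subalg S) {x : A | x \in subalg_set S}.

Definition Subalg (x : A) (Sx : inS x) : subalg S := exist _ x (mem_set Sx).

Lemma subalg_mem (x : subalg S) : inS (val x).
Proof. exact: (set_mem (valP x)). Qed.

Let S0 : inS 0. Proof. by case: (subalgP S). Qed.
Let SD x y : inS x -> inS y -> inS (x + y).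
Proof. by case: (subalgP S) => _ + _ _ _; exact. Qed.
Let SZ (c : R[i]) x : inS x -> inS (c *: x).
Proof. by case: (subalgP S) => _ _ + _ _; exact. Qed.
Let SM x y : inS x -> inS y -> inS (x ** y).
Proof. by case: (subalgP S) => _ _ _ + _; exact. Qed.
Let Sstar x : inS x -> inS (star x).
Proof. by case: (subalgP S) => _ _ _ _; exact. Qed.
Let SN x : inS x -> inS (- x).
Proof. by rewrite -scaleN1r; exact: SZ. Qed.

Let zero := Subalg S0.
Let add (x y : subalg S) := Subalg (SD (subalg_mem x) (subalg_mem y)).
Let opp (x : subalg S) := Subalg (SN (subalg_mem x)).
Let scale (c : R[i]) (x : subalg S) := Subalg (SZ c (subalg_mem x)).
Let mul (x y : subalg S) := Subalg (SM (subalg_mem x) (subalg_mem y)).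
Let sstar (x : subalg S) := Subalg (Sstar (subalg_mem x)).

Let addA : associative add.
Proof. by move=> x y z; apply/val_inj/addrA. Qed.
Let addC : commutative add.
Proof. by move=> x y; apply/val_inj/addrC. Qed.
Let add0 : left_id zero add.
Proof. by move=> x; apply/val_inj/add0r. Qed.
Let addN : left_inverse zero opp add.
Proof. by move=> x; apply/val_inj/addNr. Qed.

HB.instance Definition _ := GRing.isZmodule.Build (subalg S) addA addC add0 addN.

Let scaleA a b x : scale a (scale b x) = scale (a * b) x.
Proof. exact/val_inj/scalerA. Qed.
Let scale1 : left_id 1 scale.
Proof. by move=> x; apply/val_inj/scale1r. Qed.
Let scaleDr : right_distributive scale +%R.
Proof. by move=> c x y; apply/val_inj/scalerDr. Qed.
Let scaleDl x : {morph scale^~ x : a b / a + b}.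
Proof. by move=> a b; apply/val_inj/scalerDl. Qed.

HB.instance Definition _ := GRing.Zmodule_isLmodule.Build R[i] (subalg S)
  scaleA scale1 scaleDr scaleDl.

Let mulA : associative mul.
Proof. by move=> x y z; apply/val_inj/smulA. Qed.
Let mulDl : left_distributive mul +%R.
Proof. by move=> x y z; apply/val_inj/smulDl. Qed.
Let mulDr : right_distributive mul +%R.
Proof. by move=> x y z; apply/val_inj/smulDr. Qed.
Let mulZl (c : R[i]) x y : mul (c *: x) y = c *: mul x y.
Proof. exact/val_inj/scale_smull. Qed.
Let mulZr (c : R[i]) x y : mul x (c *: y) = c *: mul x y.
Proof. exact/val_inj/scale_smulr. Qed.
Let sstarK : involutive sstar.
Proof. by move=> x; apply/val_inj/starK. Qed.
Let sstarD : {morph sstar : x y / x + y}.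
Proof. by move=> x y; apply/val_inj/starD. Qed.
Let sstarZ (c : R[i]) x : sstar (c *: x) = Num.conj c *: sstar x.
Proof. exact/val_inj/starZ. Qed.
Let sstarM x y : sstar (mul x y) = mul (sstar y) (sstar x).
Proof. exact/val_inj/starM. Qed.

HB.instance Definition _ := @isStarAlgebra.Build R (subalg S) mul sstar
  mulA mulDl mulDr mulZl mulZr sstarK sstarD sstarZ sstarM.

Lemma val_subalgD : {morph (val : subalg S -> A) : x y / x + y}.
Proof. by []. Qed.
Lemma val_subalgM : {morph (val : subalg S -> A) : x y / x ** y}.
Proof. by []. Qed.
Lemma val_subalg_star : {morph (val : subalg S -> A) : x / star x}.
Proof. by []. Qed.
Lemma val_subalgZ (c : R[i]) : {morph (val : subalg S -> A) : x / c *: x}.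
Proof. by []. Qed.

End SubalgStar.

Record starIdeal (R : realType) (A : starAlgType R) := StarIdeal {
  ideal_set : set A;
  idealP : is_star_ideal ideal_set
}.

Section QuotientStar.
Variables (R : realType) (A : starAlgType R) (I : starIdeal A).
Implicit Types x y z : A.
Local Notation inI := (ideal_set I).

Let I0 : inI 0. Proof. by case: (idealP I). Qed.
Let ID x y : inI x -> inI y -> inI (x + y).
Proof. by case: (idealP I) => _ + _ _ _; exact. Qed.
Let IZ (c : R[i]) x : inI x -> inI (c *: x).
Proof. by case: (idealP I) => _ _ + _ _; exact. Qed.
Let IMl x y : inI y -> inI (x ** y).
Proof. by move=> Iy; case: (idealP I) => _ _ _ /(_ x _ Iy)[]. Qed.
Let IMr x y : inI x -> inI (x ** y).
Proof. by move=> Ix; case: (idealP I) => _ _ _ /(_ y _ Ix)[]. Qed.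
Let Istar x : inI x -> inI (star x).
Proof. by case: (idealP I) => _ _ _ _; exact. Qed.

Definition ideal_pred : {pred A} := fun x => x \in ideal_set I.

Let ideal_pred_zmod : zmod_closed ideal_pred.
Proof.
split=> [|x y /set_mem Ix /set_mem Iy]; apply/mem_set => //.
by apply: ID => //; rewrite -scaleN1r; exact: IZ.
Qed.

HB.instance Definition _ := GRing.isZmodClosed.Build A ideal_pred ideal_pred_zmod.

Definition quot_alg : Type := Quotient.quot ideal_pred.
HB.instance Definition _ := GRing.Zmodule.copy quot_alg (Quotient.quot ideal_pred).

Definition quot_proj x : quot_alg := \pi_(Quotient.quot ideal_pred)%qT x.
Definition quot_repr (u : quot_alg) : A := repr (u : Quotient.quot ideal_pred).

Lemma quot_reprK : cancel quot_repr quot_proj.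
Proof. exact: reprK. Qed.

Lemma quot_projP x y : quot_proj x = quot_proj y <-> inI (x - y).
Proof.
split=> [/eqP|Ixy].
  by rewrite /quot_proj -Quotient.idealrBE => /set_mem.
by apply/eqP; rewrite /quot_proj -Quotient.idealrBE; exact/mem_set.
Qed.

Lemma quot_projD : {morph quot_proj : x y / x + y}.
Proof. by move=> x y; exact: (Quotient.pi_add ideal_pred x y). Qed.

Lemma quot_proj0 : quot_proj 0 = 0.
Proof. by apply: (@addrI _ (quot_proj 0)); rewrite -quot_projD !addr0. Qed.

Let scale (c : R[i]) (u : quot_alg) := quot_proj (c *: quot_repr u).
Let mul (u v : quot_alg) := quot_proj (quot_repr u ** quot_repr v).
Let qstar (u : quot_alg) := quot_proj (star (quot_repr u)).

Let reprI x : inI (quot_repr (quot_proj x) - x).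
Proof. by apply/quot_projP; rewrite quot_reprK. Qed.

Let scaleE c x : scale c (quot_proj x) = quot_proj (c *: x).
Proof. by apply/quot_projP; rewrite -scalerBr; exact/IZ/reprI. Qed.
Let mulE x y : mul (quot_proj x) (quot_proj y) = quot_proj (x ** y).
Proof.
apply/quot_projP; set x' := quot_repr _; set y' := quot_repr _.
rewrite -(subrK (x' ** y) (x' ** y')) -addrA -smulBr -smulBl.
by apply: ID; [apply: IMl|apply: IMr]; exact: reprI.
Qed.
Let qstarE x : qstar (quot_proj x) = quot_proj (star x).
Proof. by apply/quot_projP; rewrite -starB; exact/Istar/reprI. Qed.

Let quotW (P : quot_alg -> Prop) : (forall x, P (quot_proj x)) -> forall u, P u.
Proof. by move=> H u; rewrite -(quot_reprK u). Qed.

Let scaleA a b u : scale a (scale b u) = scale (a * b) u.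
Proof. by elim/quotW: u => x; rewrite !scaleE scalerA. Qed.
Let scale1 : left_id 1 scale.
Proof. by elim/quotW => x; rewrite scaleE scale1r. Qed.
Let scaleDr : right_distributive scale +%R.
Proof.
move=> c; elim/quotW => x; elim/quotW => y.
by rewrite -quot_projD !scaleE -quot_projD scalerDr.
Qed.
Let scaleDl u : {morph scale^~ u : a b / a + b}.
Proof. by elim/quotW: u => x a b; rewrite !scaleE -quot_projD scalerDl. Qed.

HB.instance Definition _ := GRing.Zmodule_isLmodule.Build R[i] quot_alg
  scaleA scale1 scaleDr scaleDl.

Lemma quot_projZ (c : R[i]) x : quot_proj (c *: x) = c *: quot_proj x.
Proof. by rewrite -scaleE. Qed.

Let mulA : associative mul.
Proof.
by elim/quotW => x; elim/quotW => y; elim/quotW => z; rewrite !mulE smulA.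
Qed.
Let mulDl : left_distributive mul +%R.
Proof.
elim/quotW => x; elim/quotW => y; elim/quotW => z.
by rewrite -quot_projD !mulE -quot_projD smulDl.
Qed.
Let mulDr : right_distributive mul +%R.
Proof.
elim/quotW => x; elim/quotW => y; elim/quotW => z.
by rewrite -quot_projD !mulE -quot_projD smulDr.
Qed.
Let mulZl (c : R[i]) u v : mul (c *: u) v = c *: mul u v.
Proof.
elim/quotW: u => x; elim/quotW: v => y.
by rewrite -quot_projZ !mulE -quot_projZ scale_smull.
Qed.
Let mulZr (c : R[i]) u v : mul u (c *: v) = c *: mul u v.
Proof.
elim/quotW: u => x; elim/quotW: v => y.
by rewrite -quot_projZ !mulE -quot_projZ scale_smulr.
Qed.
Let qstarK : involutive qstar.
Proof. by elim/quotW => x; rewrite !qstarE starK. Qed.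
Let qstarD : {morph qstar : u v / u + v}.
Proof.
elim/quotW => x; elim/quotW => y.
by rewrite -quot_projD !qstarE -quot_projD starD.
Qed.
Let qstarZ (c : R[i]) u : qstar (c *: u) = Num.conj c *: qstar u.
Proof. by elim/quotW: u => x; rewrite -quot_projZ !qstarE -quot_projZ starZ. Qed.
Let qstarM u v : qstar (mul u v) = mul (qstar v) (qstar u).
Proof.
by elim/quotW: u => x; elim/quotW: v => y; rewrite !(mulE, qstarE) starM.
Qed.

HB.instance Definition _ := @isStarAlgebra.Build R quot_alg mul qstar
  mulA mulDl mulDr mulZl mulZr qstarK qstarD qstarZ qstarM.

Lemma quot_projM : {morph quot_proj : x y / x ** y}.
Proof. by move=> x y; rewrite -mulE. Qed.

Lemma quot_proj_star : {morph quot_proj : x / star x}.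
Proof. by move=> x; rewrite -qstarE. Qed.

Definition quot_norm (nu : A -> R) (u : quot_alg) : R :=
  inf [set nu x | x in [set x | quot_proj x = u]].

End QuotientStar.

Section RealNorm.
Context {R : realType} {V : normedModType R[i]}.
Implicit Types x y : V.

Lemma rnormE x : (rnorm x)%:C = `|x|.
Proof. by rewrite /rnorm RRe_real // normr_real. Qed.

Lemma rnorm_ge0 x : 0 <= rnorm x.
Proof. by rewrite -lecR rnormE normr_ge0. Qed.

Lemma rnorm0 : rnorm (0 : V) = 0.
Proof. by rewrite /rnorm normr0. Qed.

Lemma rnormN x : rnorm (- x) = rnorm x.
Proof. by rewrite /rnorm normrN. Qed.

Lemma rnormD x y : rnorm (x + y) <= rnorm x + rnorm y.
Proof. by rewrite -lecR rmorphD /= !rnormE ler_normD. Qed.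

Lemma rnormZ (c : R[i]) x : rnorm (c *: x) = rnorm (c : R[i]^o) * rnorm x.
Proof.
apply: (@complexI R); rewrite rmorphM /= !rnormE normrZ.
by congr (_ * _).
Qed.

Definition sup_norm (T : Type) (f : T -> V) : R := sup (range (fun t => rnorm (f t))).

Definition fbounded (T : Type) (f : T -> V) : Prop :=
  exists M : R, forall t, rnorm (f t) <= M.

End RealNorm.

Section CStarNorm.
Context {R : realType} {A : cstarAlgType R}.

Lemma rnormM (x y : A) : rnorm (x ** y) <= rnorm x * rnorm y.
Proof. by rewrite -lecR rmorphM /= !rnormE norm_smul. Qed.

Lemma rnorm_star_smul (x : A) : rnorm (star x ** x) = rnorm x ^+ 2.
Proof. by apply: (@complexI R); rewrite rmorphXn /= !rnormE norm_star_smul. Qed.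

Lemma rnorm_star (x : A) : rnorm (star x) = rnorm x.
Proof.
have H (y : A) : rnorm y <= rnorm (star y).
  have [->|y0] := eqVneq (rnorm y) 0; first exact: rnorm_ge0.
  have : rnorm y * rnorm y <= rnorm (star y) * rnorm y.
    by rewrite -expr2 -rnorm_star_smul rnormM.
  by rewrite ler_pM2r // lt_def y0 rnorm_ge0.
by apply/eqP; rewrite eq_le H -{2}(starK x) H.
Qed.

End CStarNorm.

Section SequenceAlgebra.
Context {R : realType} (A : cstarAlgType R).

Definition linf_set : set (nat -> A) := [set a | fbounded a].

Lemma linf_star_subalg : is_star_subalg linf_set.
Proof.
split.
- by exists 0 => n; rewrite rnorm0.
- move=> a b [M aM] [N bN]; exists (M + N) => n.
  by rewrite (le_trans (rnormD _ _))// lerD.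
- move=> c a [M aM]; exists (rnorm (c : R[i]^o) * M) => n.
  by rewrite rnormZ ler_wpM2l ?rnorm_ge0.
- move=> a b [M aM] [N bN]; exists (M * N) => n.
  by rewrite (le_trans (rnormM _ _))// ler_pM ?rnorm_ge0.
- by move=> a [M aM]; exists M => n; rewrite rnorm_star.
Qed.

Definition linf : Type := subalg (StarSubalg linf_star_subalg).
HB.instance Definition _ := StarAlgebra.copy linf (subalg (StarSubalg linf_star_subalg)).

Definition linf_seq (a : linf) : nat -> A := val a.

(* [subalg] and [quot_alg] only carry the *-algebra structure; norms on them are
   given by separate functions. *)
Definition linf_norm (a : linf) : R := sup_norm (linf_seq a).

Lemma linf_bounded (a : linf) : fbounded (linf_seq a).
Proof. exact: (subalg_mem a). Qed.

Lemma linf_norm_ub (a : linf) n : rnorm (linf_seq a n) <= linf_norm a.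
Proof.
apply: sup_upper_bound; last by exists n.
split; first by exists (rnorm (linf_seq a 0)), 0%N.
by have [M aM] := linf_bounded a; exists M => _ [k _ <-].
Qed.

Lemma linf_norm_le (a : linf) (M : R) :
  (forall n, rnorm (linf_seq a n) <= M) -> linf_norm a <= M.
Proof.
move=> aM; apply: ge_sup; first by exists (rnorm (linf_seq a 0)), 0%N.
by move=> _ [n _ <-].
Qed.

Lemma linf_norm_ge0 (a : linf) : 0 <= linf_norm a.
Proof. exact: le_trans (rnorm_ge0 _) (linf_norm_ub a 0). Qed.

Lemma linf_normD (a b : linf) : linf_norm (a + b) <= linf_norm a + linf_norm b.
Proof.
apply: linf_norm_le => n; apply: le_trans (rnormD _ _) _.
by rewrite lerD ?linf_norm_ub.
Qed.

Lemma linf_normM (a b : linf) : linf_norm (a ** b) <= linf_norm a * linf_norm b.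
Proof.
apply: linf_norm_le => n; apply: le_trans (rnormM _ _) _.
by rewrite ler_pM ?rnorm_ge0 ?linf_norm_ub.
Qed.

Lemma linf_normZ (c : R[i]) (a : linf) :
  linf_norm (c *: a) <= rnorm (c : R[i]^o) * linf_norm a.
Proof.
apply: linf_norm_le => n; rewrite -[linf_seq _ _]/(c *: linf_seq a n) rnormZ.
by rewrite ler_wpM2l ?rnorm_ge0 ?linf_norm_ub.
Qed.

Lemma linf_norm_star (a : linf) : linf_norm (star a) <= linf_norm a.
Proof.
apply: linf_norm_le => n; rewrite -[linf_seq _ _]/(star (linf_seq a n)).
by rewrite rnorm_star linf_norm_ub.
Qed.

Definition c0_set : set linf :=
  [set a | (fun n => rnorm (linf_seq a n)) @ \oo --> (0 : R)].

Lemma c0_dominated (a : linf) (u : nat -> R) :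
  (forall n, rnorm (linf_seq a n) <= u n) -> u @ \oo --> (0 : R) -> c0_set a.
Proof.
move=> au u0; apply: (@squeeze_cvgr _ _ _ _ (fun=> 0) u) => //.
  by apply: nearW => n; rewrite rnorm_ge0 au.
exact: cvg_cst.
Qed.

Lemma c0_star_ideal : is_star_ideal c0_set.
Proof.
split.
- by apply: (@c0_dominated _ (fun=> 0)) => [n|]; [rewrite rnorm0|exact: cvg_cst].
- move=> a b a0 b0.
  apply: (@c0_dominated _ (fun n => rnorm (linf_seq a n) + rnorm (linf_seq b n))).
    by move=> n; exact: rnormD.
  by rewrite -(addr0 0); exact: cvgD.
- move=> c a a0.
  apply: (@c0_dominated _ (fun n => rnorm (c : R[i]^o) * rnorm (linf_seq a n))).
    by move=> n; rewrite -[linf_seq _ _]/(c *: linf_seq a n) rnormZ.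
  by rewrite -(mulr0 (rnorm (c : R[i]^o))); exact: cvgMr.
- move=> a b b0; split.
    apply: (@c0_dominated _ (fun n => linf_norm a * rnorm (linf_seq b n))) => [n|].
      by apply: le_trans (rnormM _ _) _; rewrite ler_wpM2r ?rnorm_ge0 ?linf_norm_ub.
    by rewrite -(mulr0 (linf_norm a)); exact: cvgMr.
  apply: (@c0_dominated _ (fun n => rnorm (linf_seq b n) * linf_norm a)) => [n|].
    by apply: le_trans (rnormM _ _) _; rewrite ler_wpM2l ?rnorm_ge0 ?linf_norm_ub.
  by rewrite -(mul0r (linf_norm a)); exact: cvgMl.
- move=> a a0; apply: (c0_dominated _ a0) => n.
  by rewrite -[linf_seq _ _]/(star (linf_seq a n)) rnorm_star.
Qed.

Definition c0 : starIdeal linf := StarIdeal c0_star_ideal.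

Definition Ainf : Type := quot_alg c0.
HB.instance Definition _ := StarAlgebra.copy Ainf (quot_alg c0).

Definition eta (a : linf) : Ainf := quot_proj c0 a.

Definition Ainf_norm (x : Ainf) : R := quot_norm linf_norm x.

Lemma cst_linf_subproof (a : A) : linf_set (fun=> a).
Proof. by exists (rnorm a). Qed.

Definition cst_linf (a : A) : linf := Subalg (S := StarSubalg linf_star_subalg)
  (cst_linf_subproof a).

Definition Ainf_cst (a : A) : Ainf := eta (cst_linf a).

Lemma Ainf_cst_star (a : A) : Ainf_cst (star a) = star (Ainf_cst a).
Proof. by rewrite /Ainf_cst /eta -quot_proj_star; congr quot_proj; exact: val_inj. Qed.

End SequenceAlgebra.

Section CentralSequences.
Context {R : realType} {A : cstarAlgType R}.

Definition is_cstar_subalg (B : set A) : Prop := is_star_subalg B /\ closed B.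

Record cstarSubalg := CStarSubalg {
  csubalg_set : set A;
  csubalgP : is_cstar_subalg csubalg_set
}.

Variable D : cstarSubalg.
Local Notation inD := (csubalg_set D).

Definition commutant_set : set (Ainf A) :=
  [set x | forall d, inD d -> x ** Ainf_cst d = Ainf_cst d ** x].

Definition annihilator : set (Ainf A) :=
  [set x | forall d, inD d -> x ** Ainf_cst d = 0 /\ Ainf_cst d ** x = 0].

Let D_star d : inD d -> inD (star d).
Proof. by have [[_ _ _ _ +] _] := csubalgP D; exact. Qed.

Lemma commutant_star_subalg : is_star_subalg commutant_set.
Proof.
split.
- by move=> d _; rewrite smul0r smulr0.
- by move=> x y xD yD d dD; rewrite smulDl smulDr xD // yD.
- by move=> c x xD d dD; rewrite scale_smull scale_smulr xD.
- by move=> x y xD yD d dD; rewrite -smulA yD // !smulA xD.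
- move=> x xD d dD; have /(congr1 star) := xD _ (D_star dD).
  by rewrite !starM Ainf_cst_star !starK.
Qed.

Definition commutant : starSubalg (Ainf A) := StarSubalg commutant_star_subalg.

Definition ann_set : set (subalg commutant) := [set x | annihilator (val x)].

Lemma ann_star_ideal : is_star_ideal ann_set.
Proof.
split.
- by move=> d _; rewrite smul0r smulr0.
- move=> x y xD yD d dD; have [x1 x2] := xD _ dD; have [y1 y2] := yD _ dD.
  by rewrite val_subalgD smulDl smulDr x1 x2 y1 y2 addr0.
- move=> c x xD d dD; have [x1 x2] := xD _ dD.
  by rewrite val_subalgZ scale_smull scale_smulr x1 x2 scaler0.
- move=> x y yD; have xD : commutant_set (val x) := subalg_mem x.
  split=> d dD; have [y1 y2] := yD _ dD; have xd := xD _ dD;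
    rewrite val_subalgM; split.
  + by rewrite -smulA y1 smulr0.
  + by rewrite smulA -xd -smulA y2 smulr0.
  + by rewrite -smulA xd smulA y1 smul0r.
  + by rewrite smulA y2 smul0r.
- move=> x xD d dD; have [/(congr1 star) + /(congr1 star)] := xD _ (D_star dD).
  by rewrite !starM !Ainf_cst_star !starK star0 val_subalg_star.
Qed.

Definition ann : starIdeal (subalg commutant) := StarIdeal ann_star_ideal.

Definition Fcentral : Type := quot_alg ann.
HB.instance Definition _ := StarAlgebra.copy Fcentral (quot_alg ann).

Definition kappa (x : subalg commutant) : Fcentral := quot_proj ann x.

Definition Fcentral_norm (u : Fcentral) : R :=
  quot_norm (fun x : subalg commutant => Ainf_norm (val x)) u.

End CentralSequences.
Arguments cstarSubalg {R} A.

(* The abelian group G is written additively; act_linear, actM, act_star, act0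
   and actD make alpha a homomorphism from G to the *-automorphisms of A. *)
Record cstar_action (R : realType) (G : topologicalZmodType)
    (A : cstarAlgType R) := CStarAction {
  act :> G -> A -> A;
  act_linear : forall g (c : R[i]) x y,
    act g (c *: x + y) = c *: act g x + act g y;
  actM : forall g x y, act g (x ** y) = act g x ** act g y;
  act_star : forall g x, act g (star x) = star (act g x);
  act0 : forall x, act 0 x = x;
  actD : forall g h x, act (g + h) x = act g (act h x);
  act_continuous : forall x, continuous (fun g => act g x)
}.

Section InducedAction.
Context {R : realType} {G : topologicalZmodType} {A : cstarAlgType R}.
Variable alpha : cstar_action G A.

Definition linf_orbit (a : linf A) (F : G -> linf A) : Prop :=
  forall g n, linf_seq (F g) n = alpha g (linf_seq a n).

(* The orbit map of a takes its values in linf and is norm continuous. *)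
Definition linf_alpha : set (linf A) :=
  [set a | exists2 F : G -> linf A, linf_orbit a F &
    forall g0 (e : R), 0 < e ->
      \forall g \near g0, linf_norm (F g - F g0) < e].

Definition Ainf_alpha : set (Ainf A) := [set eta a | a in linf_alpha].

Lemma actZ g (c : R[i]) x : alpha g (c *: x) = c *: alpha g x.
Proof.
have a00 : alpha g 0 = 0.
  have := act_linear alpha g 1 0 0.
  by rewrite !scale1r addr0 => /eqP; rewrite -subr_eq0 opprD addrA subrr sub0r oppr_eq0 => /eqP.
by have := act_linear alpha g c x 0; rewrite a00 !addr0.
Qed.

Lemma actDr g x y : alpha g (x + y) = alpha g x + alpha g y.
Proof. by have := act_linear alpha g 1 x y; rewrite !scale1r. Qed.

Lemma linf_alpha_star_subalg : is_star_subalg linf_alpha.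
Proof.
split.
- exists (fun=> 0).
    move=> g n; rewrite -[LHS]/(0 : A) -[linf_seq 0 n]/(0 : A).
    by rewrite -(scale0r (0 : A)) actZ !scale0r.
  move=> g0 e e0; apply: nearW => g; rewrite subrr.
  apply: le_lt_trans e0; apply: linf_norm_le => n.
  by rewrite -[linf_seq _ _]/(0 : A) rnorm0.
- move=> a b [Fa aF ca] [Fb bF cb]; exists (fun g => Fa g + Fb g).
    move=> g n; rewrite -[LHS]/(linf_seq (Fa g) n + linf_seq (Fb g) n) aF bF.
    by rewrite -actDr.
  move=> g0 e e0; have e2 : 0 < e / 2 by rewrite divr_gt0.
  apply: filterS2 (ca g0 _ e2) (cb g0 _ e2) => g ha hb.
  rewrite opprD addrACA (le_lt_trans (linf_normD _ _))//.
  by rewrite [ltRHS](splitr e) ltrD.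
- move=> c a [Fa aF ca]; exists (fun g => c *: Fa g).
    by move=> g n; rewrite -[LHS]/(c *: linf_seq (Fa g) n) aF -actZ.
  move=> g0 e e0; set M := rnorm (c : R[i]^o).
  have M0 : 0 < M + 1 by rewrite ltr_wpDl ?rnorm_ge0.
  have eM : 0 < e / (M + 1) by rewrite divr_gt0.
  apply: filterS (ca g0 _ eM) => g; rewrite ltr_pdivlMr // => ha.
  rewrite -scalerBr; apply: le_lt_trans (linf_normZ _ _) _.
  apply: le_lt_trans ha; rewrite mulrC ler_wpM2l ?linf_norm_ge0 //.
  by rewrite lerDl.
- move=> a b [Fa aF ca] [Fb bF cb]; exists (fun g => Fa g ** Fb g).
    move=> g n; rewrite -[LHS]/(linf_seq (Fa g) n ** linf_seq (Fb g) n) aF bF.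
    by rewrite -actM.
  move=> g0 e e0.
  set M := linf_norm (Fa g0); set N := linf_norm (Fb g0).
  have M1 : 0 < M + 1 by rewrite ltr_wpDl ?linf_norm_ge0.
  have N1 : 0 < N + 1 by rewrite ltr_wpDl ?linf_norm_ge0.
  have ea : 0 < e / 2 / (N + 1) by rewrite !divr_gt0.
  have eb : 0 < e / 2 / (M + 1) by rewrite !divr_gt0.
  apply: filterS3 (ca g0 _ ea) (cb g0 _ eb) (cb g0 1 ltr01) => g.
  rewrite (ltr_pdivlMr _ _ N1) (ltr_pdivlMr _ _ M1) => ha hb hb1.
  have -> : Fa g ** Fb g - Fa g0 ** Fb g0 =
      (Fa g - Fa g0) ** Fb g + Fa g0 ** (Fb g - Fb g0).
    by rewrite smulBl smulBr addrA subrK.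
  rewrite (le_lt_trans (linf_normD _ _))// [ltRHS](splitr e) ltrD //.
    apply: le_lt_trans ha; apply: le_trans (linf_normM _ _) _.
    rewrite ler_wpM2l ?linf_norm_ge0 //.
    rewrite -[Fb g](subrK (Fb g0)) (le_trans (linf_normD _ _))// addrC.
    by rewrite lerD2l ltW.
  apply: le_lt_trans hb; apply: le_trans (linf_normM _ _) _.
  by rewrite mulrC ler_wpM2l ?linf_norm_ge0 // lerDl.
- move=> a [Fa aF ca]; exists (fun g => star (Fa g)).
    by move=> g n; rewrite -[LHS]/(star (linf_seq (Fa g) n)) aF -act_star.
  move=> g0 e e0; apply: filterS (ca g0 _ e0) => g ha.
  by rewrite -starB (le_lt_trans (linf_norm_star _)).
Qed.

Definition invariant_set (B : set A) : Prop := forall g b, B b -> B (alpha g b).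

Variable D : cstarSubalg A.

Definition Falpha_set : set (Fcentral D) :=
  [set kappa x | x in [set x : subalg (commutant D) | Ainf_alpha (val x)]].

Lemma Falpha_star_subalg : is_star_subalg Falpha_set.
Proof.
have [l0 lD lZ lM lS] := linf_alpha_star_subalg.
split.
- exists 0; last exact: quot_proj0.
  by exists 0; [exact: l0|exact: quot_proj0].
- move=> _ _ [x [a la ax] <-] [y [b lb yb] <-]; exists (x + y); last exact: quot_projD.
  by exists (a + b); [exact: lD|rewrite /eta quot_projD; congr (_ + _)].
- move=> c _ [x [a la ax] <-]; exists (c *: x); last exact: quot_projZ.
  by exists (c *: a); [exact: lZ|rewrite /eta quot_projZ; congr (_ *: _)].
- move=> _ _ [x [a la ax] <-] [y [b lb yb] <-]; exists (x ** y); last exact: quot_projM.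
  by exists (a ** b); [exact: lM|rewrite /eta quot_projM; congr (_ ** _)].
- move=> _ [x [a la ax] <-]; exists (star x); last exact: quot_proj_star.
  by exists (star a); [exact: lS|rewrite /eta quot_proj_star; congr star].
Qed.

Definition Falpha : Type := subalg (StarSubalg Falpha_star_subalg).
HB.instance Definition _ :=
  StarAlgebra.copy Falpha (subalg (StarSubalg Falpha_star_subalg)).

Definition Falpha_val (u : Falpha) : Fcentral D := val u.

Definition Falpha_norm (u : Falpha) : R := Fcentral_norm (Falpha_val u).

(* [Falpha_rep a u] means that the bounded sequence a represents u. *)
Definition Falpha_rep (a : linf A) (u : Falpha) : Prop :=
  exists2 x : subalg (commutant D), eta a = val x & kappa x = Falpha_val u.

(* The graph of F(alpha)_g, which maps the class of (a_n) in linf_alpha to the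
   class of (alpha_g a_n). *)
Definition Falpha_act (g : G) (u v : Falpha) : Prop :=
  exists a b : linf A, [/\ linf_alpha a, Falpha_rep a u, Falpha_rep b v
    & forall n, linf_seq b n = alpha g (linf_seq a n)].

End InducedAction.

Section ContinuousFunctions.
Context {R : realType} (G : topologicalZmodType).

Definition cont_set : set (G -> R[i]^o) := [set f | continuous f].

Lemma cont_star_subalg : is_star_subalg cont_set.
Proof.
split.
- by move=> g; exact: cvg_cst.
- by move=> f h cf ch g; apply: cvgD; [exact: cf|exact: ch].
- by move=> c f cf g; apply: cvgZr; exact: cf.
- by move=> f h cf ch g; apply: cvgM; [exact: cf|exact: ch].
- move=> f cf g; apply/cvgrPdist_lt => e e0.
  have /cvgrPdist_lt/(_ e e0) := cf g; apply: filterS => t.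
  rewrite -[star f g]/(Num.conj (f g)) -[star f t]/(Num.conj (f t)).
  by rewrite -rmorphB norm_conjC.
Qed.

Definition contG : Type := subalg (StarSubalg cont_star_subalg).
HB.instance Definition _ :=
  StarAlgebra.copy contG (subalg (StarSubalg cont_star_subalg)).

Definition contG_fun (f : contG) : G -> R[i]^o := val f.

Definition contG_norm (f : contG) : R := sup_norm (contG_fun f).

Lemma contG_one_subproof : cont_set (fun=> 1).
Proof. by move=> g; exact: cvg_cst. Qed.

Definition contG_one : contG :=
  Subalg (S := StarSubalg cont_star_subalg) contG_one_subproof.

Lemma Lt_subproof (g : G) (f : contG) : cont_set (fun h => contG_fun f (h - g)).
Proof.
move=> h; apply: (@continuous_comp _ _ _ (fun h => h - g) (contG_fun f)).
  apply: (@continuous_comp _ _ _ (fun h => (h, - g)) (fun x : G * G => x.1 + x.2)).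
    by apply: cvg_pair => /=; [exact: cvg_id|exact: cvg_cst].
  exact: add_continuous.
exact: (subalg_mem f).
Qed.

Definition Lt (g : G) (f : contG) : contG :=
  Subalg (S := StarSubalg cont_star_subalg) (@Lt_subproof g f).

End ContinuousFunctions.
Arguments contG R G : clear implicits.
Arguments contG_one {R G}.

Section CPC.
Context {R : realType} {B C : starAlgType R}.
Variables (nB : B -> R) (nC : C -> R) (phi : B -> C).

Definition completely_positive : Prop :=
  forall n (X : 'M[B]_n), mx_positive X -> mx_positive (map_mx phi X).

Definition order_zero : Prop :=
  forall c1 c2, positive c1 -> positive c2 -> c1 ** c2 = 0 ->
    phi c1 ** phi c2 = 0.

Definition cpc_order_zero : Prop :=
  [/\ completely_positive, forall x, nC (phi x) <= nB x & order_zero].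

End CPC.

Section RokhlinDimension.
Context {R : realType} {G : topologicalZmodType} {A : cstarAlgType R}.
Variable alpha : cstar_action G A.

Definition approximate_unit (B : set A) (e : nat -> A) : Prop :=
  [/\ forall n, B (e n) /\ rnorm (e n) <= 1,
      forall n, positive (e n), forall n, positive (e n.+1 - e n)
    & forall b, B b -> (fun n => e n ** b) @ \oo --> b /\
                       (fun n => b ** e n) @ \oo --> b].

Definition sigma_unital (B : set A) : Prop := exists e, approximate_unit B e.

Definition rokhlin_le (d : nat) : Prop :=
  forall D : cstarSubalg A,
    sigma_unital (csubalg_set D) -> invariant_set alpha (csubalg_set D) ->
  exists phi : 'I_d.+1 -> {linear contG R G -> Falpha alpha D},
    [/\ forall j, cpc_order_zero (@contG_norm R G) (@Falpha_norm R G A alpha D)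
                    (phi j),
        forall j g f, Falpha_act g (phi j f) (phi j (Lt g f))
      & is_unit_elt (\sum_j phi j contG_one)].

(* The least d in the set if there is one, and +oo if the set is empty. *)
Definition rokhlin_dim : \bar R :=
  ereal_inf [set d%:R%:E | d in [set d | rokhlin_le d]].

End RokhlinDimension.

Section StrongConnesSpectrum.
Context {R : realType} {G : topologicalZmodType} {A : cstarAlgType R}.
Variable alpha : cstar_action G A.

Definition dual_group : set (G -> R[i]^o) :=
  [set tau : G -> R[i]^o | [/\ continuous tau, forall g h, tau (g + h) = tau g * tau h
               & forall g, `|tau g| = 1]].

Definition lin_span (V : lmodType R[i]) (S : set V) : set V :=
  [set v | exists n (c : 'I_n -> R[i]) (x : 'I_n -> V),
     (forall i, S (x i)) /\ v = \sum_i c i *: x i].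

(* The eigenspace B_tau of the restriction of alpha to an invariant B. *)
Definition spectral_subspace (B : set A) (tau : G -> R[i]^o) : set A :=
  [set b | B b /\ forall g, alpha g b = (tau g : R[i]) *: b].

Definition strong_arveson_spectrum (B : set A) : set (G -> R[i]^o) :=
  [set tau : G -> R[i]^o | dual_group tau /\
    closure (lin_span [set z | exists x b y,
      [/\ spectral_subspace B tau x, B b, spectral_subspace B tau y
        & z = star x ** b ** y]]) = B].

Definition hereditary (B : set A) : Prop :=
  is_cstar_subalg B /\
  forall a b, positive a -> B b -> positive (b - a) -> B a.

Definition Her_alpha : set (set A) :=
  [set B | hereditary B /\ invariant_set alpha B].

Definition strong_connes_spectrum : set (G -> R[i]^o) :=
  \bigcap_(B in Her_alpha) strong_arveson_spectrum B.

Definition hereditarily_saturated : Prop := strong_connes_spectrum = dual_group.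

End StrongConnesSpectrum.
Arguments dual_group R G : clear implicits.

(* Main.v *)
(** For an invariant hereditary subalgebra B, let I be the closed span of
    B_tau^* B_tau, an ideal of the fixed point algebra of B.  Since I B I lies in
    the closed span J of B_tau^* B B_tau, it suffices that every positive h in
    the fixed point algebra lies in I, and that every b in B is a limit of
    products u b u with u in the C*-algebra generated by such an h; for the
    latter h is chosen as an average over G of finitely many translates of b^* b.

    To see that h lies in I, apply the Rokhlin property to the hereditary
    subalgebra D generated by h.  Let (a_n) represent phi_j(conj tau) and (k_n)
    represent phi_j(1).  Equivariance makes h a_n h close to an element of B_tau,
    and order zero gives phi_j(conj tau)^* phi_j(conj tau) = phi_j(1)^* phi_j(1).
    Hence (h k_n h)^* (h k_n h) is close to I, so that h k_n h is close to I as
    well, and summing over j shows that h^2, hence h, lies in I. *)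

From HB Require Import structures.
Require Import Defs.
From mathcomp Require Import all_boot all_order all_algebra.
From mathcomp Require Import complex.
From mathcomp Require Import boolp classical_sets functions reals ereal.
From mathcomp Require Import topology normedtype sequences realfun.
From mathcomp Require Import ring lra zify.

Set Implicit Arguments.
Unset Strict Implicit.
Unset Printing Implicit Defensive.

Import Order.TTheory GRing.Theory Num.Theory.
Import numFieldNormedType.Exports.

Local Open Scope classical_set_scope.
Local Open Scope complex_scope.
Local Open Scope ring_scope.

(** * Unitization *)

(** Everything rests on the norm, the C*-identity and completeness. Positivity is turned into a norm
    inequality in the unitization; square roots, monotonicity of the norm and, as the hardest point,
    positivity of y* y are derived from it by iteration and power estimates. An average over G is a
    fixed point in the closed convex hull of an orbit, reached by repeated midpoints. The order zero
    relation phi(p) phi(q) = phi(1) phi(p q) comes from slicing p into m layers, with an error of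
    order 1/m. The conjugate of tau enters because translation by g multiplies the function conj tau
    by tau(g), so that its image is an eigenvector for tau itself. Elements of the central sequence
    algebra determine their representatives only after multiplication by elements of D. This is why
    a_n and k_n always appear next to factors h, which also bring h a_n h into the hereditary
    subalgebra B. *)

Lemma rnorm_real (R : realType) (t : R) : rnorm (t%:C : R[i]^o) = `|t|.
Proof. by apply: (@complexI R); rewrite rnormE normc_def /= expr0n addr0 sqrtr_sqr. Qed.

Lemma rnorm_eq0 (R : realType) (V : normedModType R[i]) (v : V) : rnorm v = 0 -> v = 0.
Proof. by move=> v0; apply/eqP; rewrite -normr_eq0 -rnormE v0. Qed.

Section Unitization.
Context {R : realType} (A : cstarAlgType R).

(* R[i] + A, seen as an algebra over the real numbers. *)
Definition unitization : Type := (R[i] * A)%type.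

HB.instance Definition _ := GRing.Zmodule.copy unitization (R[i] * A)%type.

Implicit Types x y z : unitization.

Let one : unitization := (1, 0).
Let mul x y : unitization := (x.1 * y.1, x.1 *: y.2 + y.1 *: x.2 + x.2 ** y.2).

Let addE x y : x + y = (x.1 + y.1, x.2 + y.2). Proof. by []. Qed.

Let mulA : associative mul.
Proof.
move=> [a x] [b y] [c z]; rewrite /mul /=; congr pair; first by rewrite mulrA.
rewrite !scalerDr !smulDl !smulDr !scalerA !scale_smull !scale_smulr smulA.
by rewrite !addrA (mulrC c a) (mulrC c b) [LHS](ACl (1*2*4*6*3*5*7)).
Qed.

Let mul1 : left_id one mul.
Proof.
by case=> c x; rewrite /mul /one /= mul1r scale1r scaler0 smul0r !addr0.
Qed.

Let mulr1 : right_id one mul.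
Proof.
by case=> c x; rewrite /mul /one /= mulr1 scale1r scaler0 smulr0 add0r addr0.
Qed.

Let mulDl : left_distributive mul +%R.
Proof.
move=> [a x] [b y] [c z]; rewrite /mul !addE /= mulrDl; congr pair.
by rewrite scalerDl scalerDr smulDl !addrA [LHS](ACl (1*3*5*2*4*6)).
Qed.

Let mulDr : right_distributive mul +%R.
Proof.
move=> [a x] [b y] [c z]; rewrite /mul !addE /= mulrDr; congr pair.
by rewrite scalerDl scalerDr smulDr !addrA [LHS](ACl (1*3*5*2*4*6)).
Qed.

Let one_neq0 : one != 0.
Proof. by apply/eqP => -[/eqP]; rewrite oner_eq0. Qed.

HB.instance Definition _ :=
  GRing.Zmodule_isNzRing.Build unitization mulA mul1 mulr1 mulDl mulDr one_neq0.

Let scale (t : R) x : unitization := (t%:C * x.1, t%:C *: x.2).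

Let scaleA a b x : scale a (scale b x) = scale (a * b) x.
Proof. by rewrite /scale /= rmorphM mulrA scalerA. Qed.
Let scale1 : left_id 1 scale.
Proof. by case=> c x; rewrite /scale /= mul1r scale1r. Qed.
Let scaleDr : right_distributive scale +%R.
Proof. by move=> t x y; rewrite /scale !addE mulrDr scalerDr. Qed.
Let scaleDl x : {morph scale^~ x : a b / a + b}.
Proof. by move=> a b; rewrite /scale !addE rmorphD /= mulrDl scalerDl. Qed.

HB.instance Definition _ := GRing.Zmodule_isLmodule.Build R unitization
  scaleA scale1 scaleDr scaleDl.

Let scaleAl (t : R) x y : t *: (x * y) = (t *: x) * y.
Proof.
case: x y => a x [b y]; congr pair; first by rewrite /= mulrA.
by rewrite /= !scalerDr !scalerA scale_smull (mulrC b).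
Qed.

HB.instance Definition _ := GRing.Lmodule_isLalgebra.Build R unitization scaleAl.

Let scaleAr (t : R) x y : t *: (x * y) = x * (t *: y).
Proof.
case: x y => a x [b y]; congr pair; first by rewrite /= mulrCA.
by rewrite /= !scalerDr !scalerA scale_smulr (mulrC a).
Qed.

HB.instance Definition _ := GRing.Lalgebra_isAlgebra.Build R unitization scaleAr.

Definition ustar x : unitization := (Num.conj x.1, star x.2).

Definition uemb (a : A) : unitization := (0, a).

(** Only real scalars act on the unitization; complex ones enter through this central square root of
    -1. *)
Definition uI : unitization := ('i, 0).

Lemma umul1E x y : (x * y).1 = x.1 * y.1. Proof. by []. Qed.
Lemma uscaleE (t : R) x : t *: x = (t%:C * x.1, t%:C *: x.2). Proof. by []. Qed.

Lemma ustarK : involutive ustar.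
Proof. by case=> c x; rewrite /ustar /= conjCK starK. Qed.

Lemma ustarD : {morph ustar : x y / x + y}.
Proof. by move=> [c x] [d y]; rewrite /ustar /= rmorphD starD. Qed.

Lemma ustarM x y : ustar (x * y) = ustar y * ustar x.
Proof.
case: x y => c x [d y]; congr pair; first by rewrite /= rmorphM mulrC.
by rewrite /= !starD !starZ starM (addrC (_ *: star y)).
Qed.

Lemma ustarZ (t : R) x : ustar (t *: x) = t *: ustar x.
Proof.
have tr : Num.conj t%:C = t%:C by exact: conjc_real.
congr pair.
  by rewrite -[LHS]/(Num.conj (t%:C * x.1)) [LHS]rmorphM [X in X * _]tr.
by rewrite -[LHS]/(star (t%:C *: x.2)) starZ tr.
Qed.

Lemma ustar1 : ustar 1 = 1.
Proof. by rewrite /ustar /= rmorph1 star0. Qed.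

Lemma ustar0 : ustar 0 = 0.
Proof. by rewrite /ustar /= rmorph0 star0. Qed.

Lemma ustarN x : ustar (- x) = - ustar x.
Proof. by rewrite -scaleN1r ustarZ scaleN1r. Qed.

Lemma ustarB x y : ustar (x - y) = ustar x - ustar y.
Proof. by rewrite ustarD ustarN. Qed.

Lemma ustarX x n : ustar (x ^+ n) = ustar x ^+ n.
Proof.
by elim: n => [|n IH]; rewrite ?expr0 ?ustar1// exprS exprSr ustarM IH.
Qed.

Lemma ustar_emb (a : A) : ustar (uemb a) = uemb (star a).
Proof. by rewrite /ustar /uemb /= rmorph0. Qed.

Lemma uembD : {morph uemb : a b / a + b}.
Proof. by move=> a b; rewrite /uemb addE addr0. Qed.
Lemma uembN : {morph uemb : a / - a}.
Proof. by move=> a; rewrite /uemb -[RHS]/(_, _) oppr0. Qed.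
Lemma uembB : {morph uemb : a b / a - b}.
Proof. by move=> a b; rewrite uembD uembN. Qed.
Lemma uembM (a b : A) : uemb (a ** b) = uemb a * uemb b.
Proof. by rewrite /uemb; congr pair; rewrite /= ?mul0r// !scale0r !add0r. Qed.
Lemma uembZ (t : R) a : uemb (t%:C *: a) = t *: uemb a.
Proof. by rewrite uscaleE /= mulr0. Qed.
Lemma uemb0 : uemb 0 = 0. Proof. by []. Qed.

Lemma uemb_fst0 x : x.1 = 0 -> x = uemb x.2.
Proof. by case: x => c a /= ->. Qed.

Lemma uI_comm x : uI * x = x * uI.
Proof.
by congr pair; rewrite /= 1?mulrC// !scaler0 smul0r smulr0 !addr0 add0r.
Qed.

Lemma uI_sqr : uI * uI = -1.
Proof.
congr pair; first by rewrite /= -expr2 sqrCi.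
by rewrite /= !scaler0 smul0r !addr0 oppr0.
Qed.

Lemma ustarI : ustar uI = - uI.
Proof. by congr pair; rewrite /= ?conjCi// star0 oppr0. Qed.

(** Left multiplication by x on the ideal A. Through [uactE], identities for it reduce to
    associativity in the unitization. *)
Definition uact x (a : A) : A := x.1 *: a + x.2 ** a.

Lemma uactE x a : uemb (uact x a) = x * uemb a.
Proof. by congr pair; rewrite /= ?mulr0// scale0r addr0. Qed.

(* The operator norm on A alone is only a seminorm when A has a unit. *)
Definition unorm x : R :=
  Num.max (rnorm (x.1 : R[i]^o)) (sup [set rnorm (uact x a) | a in [set a | rnorm a <= 1]]).

Let unorm_set x := [set rnorm (uact x a) | a in [set a | rnorm a <= 1]].

Let unorm_has_sup x : has_sup (unorm_set x).
Proof.
split; first by exists (rnorm (uact x 0)), 0 => //=; rewrite rnorm0 ler01.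
exists (rnorm (x.1 : R[i]^o) + rnorm x.2) => _ [a /= a1 <-].
apply: le_trans (rnormD _ _) _; rewrite rnormZ.
apply: lerD; first by rewrite ler_piMr ?rnorm_ge0.
by apply: le_trans (rnormM _ _) _; rewrite ler_piMr ?rnorm_ge0.
Qed.

Let unorm_act1 x a : rnorm a <= 1 -> rnorm (uact x a) <= unorm x.
Proof.
move=> a1; rewrite /unorm le_max; apply/orP; right.
by apply: sup_upper_bound; [exact: unorm_has_sup|exists a].
Qed.

Lemma unorm_fst x : rnorm (x.1 : R[i]^o) <= unorm x.
Proof. by rewrite /unorm le_max lexx. Qed.

Lemma unorm_ge0 x : 0 <= unorm x.
Proof. exact: le_trans (rnorm_ge0 _) (unorm_fst x). Qed.

Lemma uact_norm x a : rnorm (uact x a) <= unorm x * rnorm a.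
Proof.
have [a0|a0] := eqVneq (rnorm a) 0.
  by rewrite (rnorm_eq0 a0) /uact scaler0 smulr0 addr0 rnorm0 mulr0.
have ap : 0 < rnorm a by rewrite lt_def a0 rnorm_ge0.
pose t := (rnorm a)^-1.
have : rnorm (uact x (t%:C *: a)) <= unorm x.
  apply: unorm_act1; rewrite rnormZ rnorm_real ger0_norm ?mulVf//.
  by rewrite invr_ge0 rnorm_ge0.
have -> : uact x (t%:C *: a) = t%:C *: uact x a.
  by rewrite /uact scale_smulr scalerDr !scalerA mulrC.
rewrite rnormZ rnorm_real ger0_norm ?invr_ge0 ?rnorm_ge0//.
by rewrite /t mulrC ler_pdivrMr.
Qed.

Lemma unorm_le x (M : R) : rnorm (x.1 : R[i]^o) <= M ->
  (forall a, rnorm (uact x a) <= M * rnorm a) -> unorm x <= M.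
Proof.
move=> x1 x2; rewrite /unorm ge_max x1 /=.
have M0 : 0 <= M := le_trans (rnorm_ge0 _) x1.
apply: ge_sup => [|_ [a /= a1 <-]]; first by case: (unorm_has_sup x).
by apply: le_trans (x2 a) _; rewrite ler_piMr.
Qed.

Lemma unormD x y : unorm (x + y) <= unorm x + unorm y.
Proof.
apply: unorm_le => [|a].
  by apply: le_trans (rnormD _ _) _; rewrite lerD ?unorm_fst.
have -> : uact (x + y) a = uact x a + uact y a.
  by rewrite /uact addE /= scalerDl smulDl addrACA.
by apply: le_trans (rnormD _ _) _; rewrite mulrDl lerD ?uact_norm.
Qed.

Lemma unormM x y : unorm (x * y) <= unorm x * unorm y.
Proof.
apply: unorm_le => [|a].
  rewrite umul1E.
  have -> : rnorm (x.1 * y.1 : R[i]^o) = rnorm (x.1 : R[i]^o) * rnorm (y.1 : R[i]^o).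
    exact: (@rnormZ R (R[i]^o) x.1 y.1).
  by rewrite ler_pM ?rnorm_ge0 ?unorm_fst.
have -> : uact (x * y) a = uact x (uact y a).
  have : uemb (uact (x * y) a) = uemb (uact x (uact y a)) by rewrite !uactE mulrA.
  by case.
apply: le_trans (uact_norm _ _) _; rewrite -mulrA ler_wpM2l ?unorm_ge0//.
exact: uact_norm.
Qed.

Lemma unormZ_le (t : R) x : unorm (t *: x) <= `|t| * unorm x.
Proof.
apply: unorm_le => [|a].
  rewrite uscaleE /=.
  have -> : rnorm (t%:C * x.1 : R[i]^o) = `|t| * rnorm (x.1 : R[i]^o).
    by rewrite -rnorm_real; exact: (@rnormZ R (R[i]^o) t%:C x.1).
  by rewrite ler_wpM2l ?unorm_fst.
have -> : uact (t *: x) a = t%:C *: uact x a.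
  by rewrite /uact uscaleE /= scalerDr scalerA scale_smull.
by rewrite rnormZ rnorm_real -mulrA ler_wpM2l ?uact_norm.
Qed.

Lemma unorm0 : unorm 0 = 0.
Proof.
apply/eqP; rewrite eq_le unorm_ge0 andbT.
by have := unormZ_le 0 0; rewrite scale0r normr0 mul0r.
Qed.

Lemma unormZ (t : R) x : unorm (t *: x) = `|t| * unorm x.
Proof.
have [->|t0] := eqVneq t 0; first by rewrite scale0r unorm0 normr0 mul0r.
apply/eqP; rewrite eq_le unormZ_le /=.
have := unormZ_le t^-1 (t *: x).
by rewrite scalerA mulVf// scale1r normfV ler_pdivlMl ?normr_gt0.
Qed.

Lemma unormN x : unorm (- x) = unorm x.
Proof. by rewrite -scaleN1r unormZ normrN1 mul1r. Qed.

Lemma unormB_le x y : unorm (x - y) <= unorm x + unorm y.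
Proof. by rewrite -(unormN y); exact: unormD. Qed.

(** The C*-identity of A passes to the operator norm: (x a)* (x a) = a* (x* x a) gives |x a|^2 <=
    |x* x| |a|^2. The scalar coordinate is treated separately. *)
Lemma unorm_star_mul_ge x : unorm x ^+ 2 <= unorm (ustar x * x).
Proof.
set M := unorm (ustar x * x).
have M0 : 0 <= M := unorm_ge0 _.
suff : unorm x <= Num.sqrt M.
  by rewrite -(@ler_pXn2r _ 2%N) ?nnegrE ?unorm_ge0 ?sqrtr_ge0// sqr_sqrtr.
apply: unorm_le => [|a].
  rewrite -(@ler_pXn2r _ 2%N) ?nnegrE ?rnorm_ge0 ?sqrtr_ge0// sqr_sqrtr//.
  apply: (@le_trans _ _ (rnorm ((ustar x * x).1 : R[i]^o))); last exact: unorm_fst.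
  rewrite -lecR rmorphXn /= !rnormE.
  by rewrite normrM norm_conjC expr2.
rewrite -(@ler_pXn2r _ 2%N) ?nnegrE ?rnorm_ge0 ?mulr_ge0 ?sqrtr_ge0 ?rnorm_ge0//.
rewrite exprMn sqr_sqrtr// -rnorm_star_smul.
have -> : star (uact x a) ** uact x a = star a ** uact (ustar x * x) a.
  have : uemb (star (uact x a) ** uact x a) = uemb (star a ** uact (ustar x * x) a).
    by rewrite !uembM -!ustar_emb !uactE ustarM !mulrA.
  by case.
apply: le_trans (rnormM _ _) _; rewrite rnorm_star expr2 mulrCA ler_wpM2l ?rnorm_ge0//.
exact: uact_norm.
Qed.

Lemma unorm_star x : unorm (ustar x) = unorm x.
Proof.
have H y : unorm y <= unorm (ustar y).
  have [->|y0] := eqVneq (unorm y) 0; first exact: unorm_ge0.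
  have : unorm y * unorm y <= unorm (ustar y) * unorm y.
    by rewrite -expr2 (le_trans (unorm_star_mul_ge _))// unormM.
  by rewrite ler_pM2r // lt_def y0 unorm_ge0.
by apply/eqP; rewrite eq_le H -{2}(ustarK x) H.
Qed.

Lemma unorm_star_mul x : unorm (ustar x * x) = unorm x ^+ 2.
Proof.
apply/eqP; rewrite eq_le unorm_star_mul_ge andbT.
by apply: le_trans (unormM _ _) _; rewrite unorm_star expr2.
Qed.

Lemma unorm1 : unorm 1 = 1.
Proof.
apply/eqP; rewrite eq_le; apply/andP; split.
  apply: unorm_le => [|a]; first by rewrite rnorm_real normr1.
  by rewrite mul1r /uact /= scale1r smul0r addr0.
by apply: le_trans (unorm_fst 1); rewrite rnorm_real normr1.
Qed.

Lemma unormX x n : unorm (x ^+ n) <= unorm x ^+ n.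
Proof.
elim: n => [|n IH]; first by rewrite !expr0 unorm1.
by rewrite !exprS (le_trans (unormM _ _))// ler_wpM2l ?unorm_ge0.
Qed.

Lemma unorm_emb a : unorm (uemb a) = rnorm a.
Proof.
have uE b : uact (uemb a) b = a ** b by rewrite /uact /= scale0r add0r.
apply/eqP; rewrite eq_le; apply/andP; split.
  apply: unorm_le => [|b]; first by rewrite rnorm0 rnorm_ge0.
  by rewrite uE rnormM.
have [->|a0] := eqVneq (rnorm a) 0; first exact: unorm_ge0.
(* The lower bound comes from testing the operator on a*. *)
have := uact_norm (uemb a) (star a).
rewrite uE -{1}(starK a) rnorm_star_smul rnorm_star expr2 ler_pM2r//.
by rewrite lt_def a0 rnorm_ge0.
Qed.

(** Together with [unorm_fst] this makes [unorm] control both coordinates, so that completeness of A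
    can be used in the unitization. *)
Lemma unorm_snd x : rnorm x.2 <= unorm x *+ 2.
Proof.
have -> : rnorm x.2 = unorm (x - (x.1, 0)).
  by rewrite -unorm_emb; congr unorm; rewrite addE /= subrr oppr0 addr0.
apply: le_trans (unormB_le _ _) _; rewrite mulr2n lerD2l.
apply: unorm_le => [|a]; first exact: (unorm_fst x).
by rewrite /uact /= smul0r addr0 rnormZ ler_wpM2r ?rnorm_ge0 ?unorm_fst.
Qed.

Lemma unorm_eq0 x : unorm x = 0 -> x = 0.
Proof.
move=> x0; have := unorm_fst x; have := unorm_snd x; rewrite x0 mul0rn.
case: x {x0} => c a /= a0 c0; congr pair.
  apply: (@rnorm_eq0 R R[i]^o).
  by apply/eqP; rewrite eq_le c0 rnorm_ge0.
apply: rnorm_eq0.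
by apply/eqP; rewrite eq_le a0 rnorm_ge0.
Qed.

End Unitization.

(** * Limits along real-valued norms *)

Section RealNormLimits.
Context {R : realType}.

Lemma gt0_real (e : R[i]) : 0 < e -> 0 < complex.Re e /\ e = (complex.Re e)%:C.
Proof.
move=> e0; have eE : (complex.Re e)%:C = e by rewrite RRe_real// gtr0_real.
by split => //; rewrite -ltcR eE.
Qed.

Lemma cvg_rnormP {V : normedModType R[i]} {T : Type} {F : set_system T}
    {FF : Filter F} (f : T -> V) (l : V) :
  f @ F --> l <-> forall e : R, 0 < e -> \forall t \near F, rnorm (f t - l) < e.
Proof.
split=> [/cvgrPdist_lt fl e e0|fl].
  have e0' : 0 < e%:C by rewrite ltcR.
  by apply: filterS (fl _ e0') => t; rewrite -rnormE ltcR -rnormN opprB.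
apply/cvgrPdist_lt => e /gt0_real[e0 ->].
by apply: filterS (fl _ e0) => t; rewrite -rnormE ltcR -rnormN opprB.
Qed.

(** The sequence a + s is nondecreasing and bounded, and a = (a + s) - s. *)
Lemma real_dominated_cvg (a s : nat -> R) : cvgn s ->
  (forall n, `|a n.+1 - a n| <= s n.+1 - s n) -> cvgn a.
Proof.
move=> cs as_.
have sle n : s n <= limn s.
  apply: nondecreasing_cvgn_le cs n; apply/nondecreasing_seqP => n.
  by rewrite -subr_ge0 (le_trans _ (as_ n)).
have asn n : `|a n - a 0%N| <= s n - s 0%N.
  elim: n => [|n IH]; first by rewrite !subrr normr0.
  have -> : a n.+1 - a 0%N = (a n.+1 - a n) + (a n - a 0%N) by ring.
  by apply: le_trans (ler_normD _ _) _; have := as_ n; lra.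
have -> : a = (a \+ s) \- s by apply/funext => n /=; ring.
apply: is_cvgB => //; apply: nondecreasing_is_cvgn.
  apply/nondecreasing_seqP => n /=; have := as_ n.
  by rewrite ler_norml => /andP[]; lra.
exists (a 0%N + limn s *+ 2 - s 0%N) => _ [n _ <-] /=; have := asn n.
by rewrite ler_norml => /andP[]; have := sle n; lra.
Qed.

Lemma dominated_cvg (V : completeNormedModType R[i]) (w : nat -> V) (s : nat -> R) :
  cvgn s -> (forall n, rnorm (w n.+1 - w n) <= s n.+1 - s n) -> cvgn w.
Proof.
move=> cs ws; apply/cauchy_cvgP/cauchy_ballP => e /gt0_real[e0 ->].
have wmn n k : rnorm (w (n + k)%N - w n) <= s (n + k)%N - s n.
  elim: k => [|k IH]; first by rewrite addn0 !subrr rnorm0.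
  have -> : w (n + k.+1)%N - w n = (w (n + k).+1 - w (n + k)%N) + (w (n + k)%N - w n).
    by rewrite addnS addrA subrK.
  by apply: le_trans (rnormD _ _) _; rewrite addnS; have := ws (n + k)%N; lra.
have sle n : s n <= limn s.
  apply: nondecreasing_cvgn_le cs n; apply/nondecreasing_seqP => n.
  by rewrite -subr_ge0 (le_trans (rnorm_ge0 _) (ws n)).
have /cvgrPdist_lt/(_ (complex.Re e / 2)) : s @ \oo --> limn s by [].
rewrite divr_gt0// => /(_ isT)[N _ sN].
have H n : (N <= n)%N -> rnorm (w n - w N) < complex.Re e / 2.
  move=> Nn; rewrite -(subnKC Nn); apply: le_lt_trans (wmn _ _) _.
  have := sN N (leqnn N); rewrite /= ger0_norm ?subr_ge0//.
  by have := sle (N + (n - N))%N; lra.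
exists (w @` [set n | (N <= n)%N], w @` [set n | (N <= n)%N]).
  by split; exists N => // n /= Nn; exists n.
move=> [_ _] /= [[n Nn <-] [m Nm <-]].
rewrite -ball_normE /ball_/= -rnormE ltcR.
have -> : w n - w m = (w n - w N) - (w m - w N) by rewrite opprB addrA subrK.
apply: le_lt_trans (rnormD _ _) _; rewrite rnormN.
by have := H _ Nn; have := H _ Nm; lra.
Qed.

(* If x > t then (x/t)^n outgrows 1 + c n / t along n = 2^k. *)
Lemma le_of_pow_le (x t c : R) : 0 < t -> 0 <= c ->
  (forall k, x ^+ (2 ^ k) * t <= t ^+ (2 ^ k) * (t + c * (2 ^ k)%:R)) -> x <= t.
Proof.
move=> t0 c0 H; rewrite leNgt; apply/negP => tx.
pose e := x / t - 1.
have e0 : 0 < e by rewrite subr_gt0 ltr_pdivlMr// mul1r.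
have bern n : 1 + n%:R * e <= (1 + e) ^+ n.
  elim: n => [|n IH]; first by rewrite expr0 mul0r addr0.
  rewrite exprS; apply: (@le_trans _ _ ((1 + e) * (1 + n%:R * e))).
    by rewrite -natr1; have := ler0n R n; nra.
  by rewrite ler_wpM2l// addr_ge0// ltW.
(* The exponent 2^(k+1) is split into two halves; Bernoulli's inequality on each makes the left side
   quadratic in 2^k, while the right side stays linear. *)
have {}H k : 1 + (2 ^ k)%:R * e * ((2 ^ k)%:R * e) <= 1 + (c / t * 2) * (2 ^ k)%:R.
  have := H k.+1; rewrite expnS mul2n -addnn.
  have -> : x = t * (1 + e) by rewrite /e addrC subrK mulrCA divff ?mulr1// gt_eqF.
  rewrite exprMn -[X in X <= _]mulrA ler_pM2l ?exprn_gt0// exprD natrD.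
  have -> : t + c * ((2 ^ k)%:R + (2 ^ k)%:R) = (1 + (c / t * 2) * (2 ^ k)%:R) * t.
    by field; rewrite gt_eqF.
  rewrite ler_pM2r// => h; apply: le_trans h.
  have b := bern (2 ^ k)%N.
  have n0 : 0 <= (2 ^ k)%:R * e by rewrite mulr_ge0// ltW.
  by nra.
have H2 k : (2 ^ k)%:R <= c / t * 2 / e ^+ 2.
  rewrite ler_pdivlMr ?exprn_gt0//.
  have k0 : 0 < (2 ^ k)%:R :> R by rewrite ltr0n expn_gt0.
  by rewrite -(ler_pM2r k0); have := H k; nra.
have [k] : exists k : nat, c / t * 2 / e ^+ 2 < k%:R.
  have := archi_boundP (ltW (_ : 0 < 1 + `|c / t * 2 / e ^+ 2|)).
  rewrite ltr_wpDr// => /(_ isT) h; eexists; apply: le_lt_trans h.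
  by rewrite (le_trans (ler_norm _))// lerDr.
apply/negP; rewrite -leNgt; apply: le_trans (H2 k).
by rewrite ler_nat ltnW// ltn_expl.
Qed.

Lemma limn_invS : (fun n => n.+1%:R^-1 : R) @ \oo --> (0 : R).
Proof. exact: cvg_harmonic. Qed.

End RealNormLimits.

(** * The positive cone *)

Section Cone.
Context {R : realType} {A : cstarAlgType R}.
Local Notation U := (unitization A).
Implicit Types x y z a b : U.

Definition selfadj x : Prop := ustar x = x.

(* The positive cone of the unitization: the self-adjoint elements with
   nonnegative spectrum, described by the norm alone. *)
Definition cone x : Prop := selfadj x /\ exists t : R, unorm (t%:A - x) <= t.

Lemma ustar_alg (t : R) : ustar (t%:A : U) = t%:A.
Proof. by rewrite ustarZ ustar1. Qed.

Lemma unorm_alg (t : R) : unorm (t%:A : U) = `|t|.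
Proof. by rewrite unormZ unorm1 mulr1. Qed.

Lemma selfadjD x y : selfadj x -> selfadj y -> selfadj (x + y).
Proof. by rewrite /selfadj ustarD => -> ->. Qed.
Lemma selfadjB x y : selfadj x -> selfadj y -> selfadj (x - y).
Proof. by rewrite /selfadj ustarB => -> ->. Qed.
Lemma selfadjZ (t : R) x : selfadj x -> selfadj (t *: x).
Proof. by rewrite /selfadj ustarZ => ->. Qed.
Lemma selfadjX x n : selfadj x -> selfadj (x ^+ n).
Proof. by rewrite /selfadj ustarX => ->. Qed.
Lemma selfadjM x y : selfadj x -> selfadj y -> GRing.comm x y -> selfadj (x * y).
Proof. by rewrite /selfadj ustarM => -> -> ->. Qed.
Lemma selfadj_star_mul z : selfadj (ustar z * z).
Proof. by rewrite /selfadj ustarM ustarK. Qed.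

Lemma cone_bound_mono (t t' : R) x :
  unorm (t%:A - x) <= t -> t <= t' -> unorm (t'%:A - x) <= t'.
Proof.
move=> tx tt'.
have -> : t'%:A - x = (t' - t)%:A + (t%:A - x) by rewrite scalerBl addrA subrK.
apply: le_trans (unormD _ _) _.
by rewrite unorm_alg ger0_norm ?subr_ge0//; lra.
Qed.

Lemma cone_bound_ge0 (t : R) x : unorm (t%:A - x) <= t -> 0 <= t.
Proof. exact/le_trans/unorm_ge0. Qed.

Lemma coneD x y : cone x -> cone y -> cone (x + y).
Proof.
move=> [sx [t tx]] [sy [t' ty]]; split; first exact: selfadjD.
exists (t + t'); rewrite scalerDl opprD addrACA.
by apply: le_trans (unormD _ _) _; exact: lerD.
Qed.

Lemma coneZ (c : R) x : 0 <= c -> cone x -> cone (c *: x).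
Proof.
move=> c0 [sx [t tx]]; split; first exact: selfadjZ.
exists (c * t); rewrite -scalerA -scalerBr unormZ ger0_norm//.
by rewrite ler_wpM2l.
Qed.

Lemma selfadj_cone (M : R) x : selfadj x -> unorm x <= M -> cone (M%:A - x).
Proof.
move=> sx xM; split; first by apply: selfadjB => //; exact: ustar_alg.
by exists M; rewrite opprB addrC subrK.
Qed.

Lemma cone_alg (t : R) : 0 <= t -> cone (t%:A).
Proof.
move=> t0; split; first exact: ustar_alg.
by exists t; rewrite subrr unorm0.
Qed.

Lemma usqrt_bound_cvg (s : nat -> R) : s 0%N = 0 ->
  (forall n, s n.+1 = (1 + s n ^+ 2) / 2) -> (forall n, 0 <= s n <= 1) /\ cvgn s.
Proof.
move=> s0 sS.
have s01 n : 0 <= s n <= 1.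
  elim: n => [|n /andP[n0 n1]]; first by rewrite s0 lexx ler01.
  by rewrite sS; apply/andP; split; nra.
split => //; apply: nondecreasing_is_cvgn.
  by apply/nondecreasing_seqP => n; rewrite sS; have := s01 n; nra.
by exists 1 => _ [n _ <-]; case/andP: (s01 n).
Qed.

(** Self-adjointness makes the scalar coordinates real, so each coordinate converges by domination.
    Two consecutive terms are kept near the limit so that a recursion can be passed to the limit. *)
Lemma unorm_dominated_cvg (w : nat -> U) (s : nat -> R) : cvgn s ->
  (forall n, selfadj (w n)) ->
  (forall n, unorm (w n.+1 - w n) <= s n.+1 - s n) ->
  exists l : U, forall e : R, 0 < e ->
    exists n, unorm (w n - l) < e /\ unorm (w n.+1 - l) < e.
Proof.
move=> cs sw ws.
have c2 : cvgn (fun n => (w n).2).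
  apply: (@dominated_cvg _ _ _ (fun n => 2 * s n)).
    by apply: is_cvgM => //; exact: is_cvg_cst.
  move=> n; have := unorm_snd (w n.+1 - w n); have := ws n.
  by rewrite -[(_ - _).2]/((w n.+1).2 - (w n).2); lra.
have w1 n : (w n).1 = (complex.Re (w n).1)%:C.
  by rewrite RRe_real//; apply/CrealP; exact: (congr1 fst (sw n)).
have c1 : cvgn (fun n => complex.Re (w n).1).
  apply: (real_dominated_cvg cs) => n; rewrite -rnorm_real rmorphB /= -!w1.
  exact: le_trans (unorm_fst _) (ws n).
pose r := limn (fun n => complex.Re (w n).1).
pose l := limn (fun n => (w n).2).
exists (r%:C, l) => e e0; have e2 : 0 < e / 2 by rewrite divr_gt0.
have /cvgrPdist_lt/(_ _ e2) h1 : (fun n => complex.Re (w n).1) @ \oo --> r by [].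
have /cvg_rnormP/(_ _ e2) h2 : (fun n => (w n).2) @ \oo --> l by [].
have : \forall n \near \oo, unorm (w n - (r%:C, l)) < e.
  apply: filterS2 h1 h2 => n; rewrite distrC => h1 h2.
  rewrite [ltRHS](splitr e).
  have -> : w n - (r%:C, l) = (complex.Re (w n).1 - r)%:A + uemb ((w n).2 - l).
    rewrite [w n in LHS]surjective_pairing w1 /uemb; congr pair.
      by rewrite /= mulr1 addr0 rmorphB.
    by rewrite /= scaler0 add0r.
  by apply: le_lt_trans (unormD _ _) _; rewrite unorm_alg unorm_emb ltrD.
by case=> n _ H; exists n; split; apply: H => /=.
Qed.

(* 1 - w is the square root of 1 - x, where w is the limit of the iteration
   w' = (x + w^2)/2; the iteration for x = 1 in R dominates it. *)
Lemma usqrt_aux x : selfadj x -> unorm x <= 1 ->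
  exists w, [/\ selfadj w, (1 - w) * (1 - w) = 1 - x
    & forall y, GRing.comm y x -> GRing.comm y w].
Proof.
move=> sx x1.
pose s := fix s (n : nat) : R := if n is m.+1 then (1 + s m ^+ 2) / 2 else 0.
pose w := fix w (n : nat) : U := if n is m.+1 then 2^-1 *: (x + w m * w m) else 0.
have [s01 cs] := @usqrt_bound_cvg s erefl (fun=> erefl).
have wS n : w n.+1 = 2^-1 *: (x + w n * w n) by [].
have sw n : selfadj (w n).
  elim: n => [|n IH]; first exact: ustar0.
  by rewrite wS; apply: selfadjZ; apply: selfadjD => //; apply: selfadjM.
have ws n : unorm (w n) <= s n.
  elim: n => [|n IH]; first by rewrite unorm0.
  rewrite wS unormZ ger0_norm ?invr_ge0//= mulrC ler_pM2r ?invr_gt0//.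
  apply: le_trans (unormD _ _) _; apply: lerD => //.
  by apply: le_trans (unormM _ _) _; rewrite expr2 ler_pM ?unorm_ge0.
have dw n : unorm (w n.+1 - w n) <= s n.+1 - s n.
  elim: n => [|n IH].
    rewrite /= subr0 mulr0 addr0 unormZ ger0_norm ?invr_ge0//.
    by rewrite expr0n addr0 subr0 mulrC ler_pM2r ?invr_gt0.
  rewrite [w n.+2]wS {2}[w n.+1]wS -scalerBr unormZ ger0_norm ?invr_ge0//.
  rewrite opprD addrACA subrr add0r.
  (* This splitting needs no commutation, and its terms are bounded by those of the same splitting
     for s. *)
  have -> : w n.+1 * w n.+1 - w n * w n =
      w n.+1 * (w n.+1 - w n) + (w n.+1 - w n) * w n.
    by rewrite mulrBr mulrBl addrA subrK.
  apply: (@le_trans _ _ (2^-1 * (s n.+1 * (s n.+1 - s n) + (s n.+1 - s n) * s n))).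
    rewrite ler_pM2l ?invr_gt0//; apply: le_trans (unormD _ _) _.
    by apply: lerD; apply: le_trans (unormM _ _) _; rewrite ler_pM ?unorm_ge0.
  have -> : s n.+2 = (1 + s n.+1 ^+ 2) / 2 by [].
  by rewrite {5}[s n.+1]/=; lra.
have [l lw] := unorm_dominated_cvg cs sw dw.
(* Identities for the limit are proved by bounding their defect v by a multiple of d for every small
   d; d <= 1 absorbs quadratic terms. *)
have lim0 (K : R) (v : U) : 0 <= K ->
    (forall n d, d <= 1 -> unorm (w n - l) <= d -> unorm (w n.+1 - l) <= d ->
      unorm v <= K * d) -> v = 0.
  move=> K0 H; apply: unorm_eq0; apply/eqP; rewrite eq_le unorm_ge0 andbT.
  apply/ler_addgt0Pr => e e0; rewrite add0r.
  pose d := Num.min 1 (e / (K + 1)).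
  have K1 : 0 < K + 1 by rewrite ltr_wpDl.
  have d0 : 0 < d by rewrite lt_min ltr01 divr_gt0.
  have [n [/ltW n1 /ltW n2]] := lw d d0.
  have dl : d <= 1 by rewrite ge_min lexx.
  apply: le_trans (H n d dl n1 n2) _.
  have : d <= e / (K + 1) by rewrite ge_min lexx orbT.
  by rewrite ler_pdivlMr//; nra.
have sl : selfadj l.
  apply/eqP; rewrite -subr_eq0; apply/eqP; apply: (lim0 2) => // n d _ h _.
  have -> : ustar l - l = (w n - l) - ustar (w n - l).
    by rewrite ustarB (sw n) opprB [RHS]addrC addrA subrK.
  by apply: le_trans (unormB_le _ _) _; rewrite unorm_star; lra.
have lcomm y : GRing.comm y x -> GRing.comm y l.
  move=> yx; have yw n : GRing.comm y (w n).
    elim: n => [|n IH]; first exact: commr0.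
    have h : GRing.comm y (x + w n * w n) by apply: commrD => //; exact: commrM.
    by rewrite /GRing.comm wS -scalerAr h scalerAl.
  apply/eqP; rewrite -subr_eq0; apply/eqP; apply: (lim0 (unorm y *+ 2)).
    by rewrite mulrn_wge0// unorm_ge0.
  move=> n d _ h _; have -> : y * l - l * y = (w n - l) * y - y * (w n - l).
    by rewrite mulrBl mulrBr yw opprB [RHS]addrC addrA subrK.
  apply: le_trans (unormB_le _ _) _; rewrite mulr2n [leRHS]mulrDl.
  have y0 := unorm_ge0 y.
  have h1 := unormM (w n - l) y; have h2 := unormM y (w n - l).
  by have := ler_wpM2l y0 h; lra.
have lE : 2 *: l = x + l * l.
  apply/eqP; rewrite -subr_eq0; apply/eqP; apply: (lim0 (4 + 2 * unorm l)).
    by have := unorm_ge0 l; lra.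
  move=> n d d1 h1 h2.
  have -> : 2 *: l - (x + l * l) =
      2 *: (l - w n.+1) + ((w n - l) * (w n - l) + l * (w n - l) + (w n - l) * l).
    set D := w n - l.
    have wE : w n = l + D by rewrite addrC subrK.
    clearbody D.
    have -> : 2 *: (l - w n.+1) = 2 *: l - (x + w n * w n).
      by rewrite scalerBr wS scalerA mulfV// scale1r.
    have -> : w n * w n = l * l + (D * D + l * D + D * l).
      by rewrite wE mulrDl !mulrDr addrA [LHS](ACl (1*(4*2*3))).
    by move: (_ + _ + D * l) => E; rewrite addrA (opprD (x + l * l) E) addrA subrK.
  apply: le_trans (unormD _ _) _; rewrite unormZ ger0_norm// -[l - w n.+1]opprB unormN.
  have := unormD ((w n - l) * (w n - l) + l * (w n - l)) ((w n - l) * l).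
  have := unormD ((w n - l) * (w n - l)) (l * (w n - l)).
  have := unormM (w n - l) (w n - l); have := unormM l (w n - l).
  have := unormM (w n - l) l; have := unorm_ge0 (w n - l); have := unorm_ge0 l.
  by nra.
exists l; split => //.
have -> : x = l + l - l * l by rewrite -[l + l]mulr2n -scaler_nat lE addrK.
by rewrite mulrBr mulr1 mulrBl mul1r opprB opprB opprD !addrA [LHS](ACl (1*3*2*4)).
Qed.

End Cone.

(** * Order *)

Section ConeOrder.
Context {R : realType} {A : cstarAlgType R}.
Local Notation U := (unitization A).
Implicit Types x y z a b c k : U.

Lemma unorm_gt0_eq0 x : unorm x <= 0 -> x = 0.
Proof. by move=> x0; apply: unorm_eq0; apply/eqP; rewrite eq_le x0 unorm_ge0. Qed.

Lemma comm_alg (t : R) x : GRing.comm x (t%:A).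
Proof. by rewrite /GRing.comm mulr_algl mulr_algr. Qed.

(** For a witness t > 0 the element 1 - x/t has norm at most 1, so [usqrt_aux] gives a root of x/t.
    The commutation clause replaces membership in the algebra generated by x. *)
Lemma cone_sqrt x : cone x -> exists s, [/\ selfadj s, s * s = x
  & forall y, GRing.comm y x -> GRing.comm y s].
Proof.
move=> [sx [t tx]]; have := cone_bound_ge0 tx.
rewrite le_eqVlt => /predU1P[t0|t0].
  have {tx} : unorm x <= 0 by move: tx; rewrite -t0 scale0r sub0r unormN.
  move=> /unorm_gt0_eq0 ->; exists 0; split; [exact: ustar0|exact: mulr0|by []].
have sx' : selfadj (1 - t^-1 *: x).
  by apply: selfadjB; [exact: ustar1|exact: selfadjZ].
have [|w [sw wE wc]] := usqrt_aux sx'.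
  have -> : 1 - t^-1 *: x = t^-1 *: (t%:A - x).
    by rewrite scalerBr scalerA mulVf ?scale1r// gt_eqF.
  by rewrite unormZ gtr0_norm ?invr_gt0// ler_pdivrMl// mulr1.
exists (Num.sqrt t *: (1 - w)); split.
- by apply: selfadjZ; apply: selfadjB => //; exact: ustar1.
- rewrite -scalerAl -scalerAr scalerA -expr2 sqr_sqrtr ?ltW// wE opprB addrCA subrr addr0.
  by rewrite scalerA divff ?scale1r// gt_eqF.
- move=> y yx; have yw : GRing.comm y w.
    apply: wc; apply: commrB; first exact: commr1.
    by rewrite /GRing.comm -scalerAr yx scalerAl.
  have h : GRing.comm y (1 - w) by apply: commrB => //; exact: commr1.
  by rewrite /GRing.comm -scalerAr h scalerAl.
Qed.

(* k + i sqrt(1 - k^2) is unitary, and 2 k^2 - 1 is the real part of its square. *)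
Lemma unorm_sqr_sub1 k : selfadj k -> unorm k <= 1 -> unorm (1 - 2 *: (k * k)) <= 1.
Proof.
move=> sk k1.
have skk : selfadj (k * k) by apply: selfadjM.
have [|w [sw wE wc]] := usqrt_aux skk.
  by apply: le_trans (unormM _ _) _; rewrite mulr_ile1 ?unorm_ge0.
set r := 1 - w in wE.
have sr : selfadj r by apply: selfadjB => //; exact: ustar1.
have kr : k * r = r * k.
  apply: commrB; first exact: commr1.
  by apply: wc; apply: commrM.
clearbody r.
pose I := uI A; pose Z := I * r * k.
have Ik : k * (I * r) = Z by rewrite mulrA -uI_comm -mulrA kr mulrA.
have IrIr : I * r * (I * r) = - (r * r).
  by rewrite mulrA -(mulrA I) -uI_comm mulrA uI_sqr mulN1r mulNr.
pose u := k + I * r; pose v := k - I * r.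
have uv : ustar u = v by rewrite ustarD ustarM sk sr ustarI mulrN -uI_comm.
have vu : v * u = 1.
  rewrite mulrBl !mulrDr Ik IrIr opprD opprK addrA addrK wE.
  by rewrite addrC subrK.
have uE : u * u + v * v = 2 *: (2 *: (k * k) - 1).
  have uu : u * u = k * k - r * r + (Z + Z).
    by rewrite mulrDl !mulrDr Ik IrIr -/Z !addrA [LHS](ACl (1*4*2*3)).
  have vv : v * v = k * k - r * r - (Z + Z).
    by rewrite mulrBl !mulrBr Ik IrIr -/Z opprK !opprD !addrA [LHS](ACl (1*4*2*3)).
  rewrite uu vv addrACA subrr addr0 wE !opprB.
  have -> : k * k + (k * k - 1) = 2 *: (k * k) - 1 by rewrite addrA scaler_nat.
  by rewrite [RHS]scaler_nat mulr2n.
have u1 : unorm u <= 1.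
  by rewrite -(@ler_pXn2r _ 2%N) ?nnegrE ?unorm_ge0// -unorm_star_mul uv vu unorm1 expr1n.
have v1 : unorm v <= 1 by rewrite -uv unorm_star.
have e : unorm (u * u + v * v) = 2 * unorm (2 *: (k * k) - 1).
  by rewrite uE unormZ ger0_norm.
have uu1 : unorm (u * u) <= 1 by apply: le_trans (unormM _ _) _; rewrite mulr_ile1 ?unorm_ge0.
have vv1 : unorm (v * v) <= 1 by apply: le_trans (unormM _ _) _; rewrite mulr_ile1 ?unorm_ge0.
have := unormD (u * u) (v * v); rewrite e -[unorm (1 - _)]unormN opprB => h.
by rewrite -(ler_pM2l (ltr0Sn R 1)); lra.
Qed.

(** [unorm_sqr_sub1] for k rescaled by (2t)^(-1/2), which has norm at most 1. *)
Lemma unorm_sqr_sub k (t : R) : selfadj k -> unorm (k * k) <= 2 * t ->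
  unorm (t%:A - k * k) <= t.
Proof.
move=> sk kt; have : 0 <= t by have := unorm_ge0 (k * k); lra.
rewrite le_eqVlt => /predU1P[t0|t0].
  by move: kt; rewrite -t0 mulr0 => /unorm_gt0_eq0 ->; rewrite scale0r subr0 unorm0.
have t20 : 0 < 2 * t by rewrite mulr_gt0.
pose c := Num.sqrt (2 * t)^-1.
have cc : c * c = (2 * t)^-1 by rewrite -expr2 sqr_sqrtr// invr_ge0 ltW.
have := @unorm_sqr_sub1 (c *: k) (selfadjZ _ sk).
rewrite -scalerAl -scalerAr (scalerA c c) cc.
have -> : 1 - 2 *: ((2 * t)^-1 *: (k * k)) = t^-1 *: (t%:A - k * k).
  rewrite scalerBr !scalerA mulVf ?gt_eqF// scale1r invfM mulrA mulfV// mul1r.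
  by [].
rewrite [unorm (t^-1 *: _)]unormZ gtr0_norm ?invr_gt0// ler_pdivrMl// mulr1; apply.
rewrite -(@ler_pXn2r _ 2%N) ?nnegrE ?unorm_ge0// expr1n -unorm_star_mul.
rewrite ustarZ sk -scalerAl -scalerAr (scalerA c c) cc unormZ gtr0_norm ?invr_gt0//.
by rewrite ler_pdivrMl// mulr1.
Qed.

Lemma cone_sqr k : selfadj k -> cone (k * k).
Proof.
move=> sk; split; first exact: selfadjM.
exists (unorm (k * k)); apply: unorm_sqr_sub => //.
by have := unorm_ge0 (k * k); lra.
Qed.

(** Every t that is at least half the norm is a witness for [cone]. This uniformity is what makes
    the cone closed. *)
Lemma cone_unorm_sub a (t : R) : cone a -> unorm a <= 2 * t -> unorm (t%:A - a) <= t.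
Proof. by move=> /cone_sqrt[s [ss <- _]]; exact: unorm_sqr_sub. Qed.

(** The square roots commute as well, so a b is the square of their product. *)
Lemma coneM a b : cone a -> cone b -> GRing.comm a b -> cone (a * b).
Proof.
move=> /cone_sqrt[s [ss sE sc]] /cone_sqrt[r [sr rE rc]] ab.
have bs : GRing.comm s b by apply/commr_sym; apply: sc; exact/commr_sym.
have sr' : GRing.comm s r by exact: rc.
have -> : a * b = (s * r) * (s * r).
  by rewrite -sE -rE -!mulrA; congr (_ * _); rewrite !mulrA sr'.
by apply: cone_sqr; apply: selfadjM.
Qed.

Lemma coneX a n : cone a -> cone (a ^+ n).
Proof.
move=> ca; elim: n => [|n IH]; first by rewrite expr0 -[1]scale1r; exact: cone_alg.
by rewrite exprS; apply: coneM => //; exact: commrX.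
Qed.

(** Write b = s^2 and M - b = r^2. Then u = s + i r satisfies u* u = M, and s is its real part, so
    |b| = |s|^2 <= |u|^2 = M. *)
Lemma unorm_le_cone b (M : R) : 0 <= M -> cone b -> cone (M%:A - b) -> unorm b <= M.
Proof.
move=> M0 /cone_sqrt[s [ss sE sc]] /cone_sqrt[r [sr rE rc]].
have sr' : s * r = r * s.
  apply: rc; apply: commrB; first exact: comm_alg.
  by rewrite -sE; apply: commrM.
pose I := uI A; pose u := s + I * r; pose v := s - I * r.
have Ik : s * (I * r) = I * r * s by rewrite mulrA -uI_comm -mulrA sr' mulrA.
have IrIr : I * r * (I * r) = - (r * r).
  by rewrite mulrA -(mulrA I) -uI_comm mulrA uI_sqr mulN1r mulNr.
have uv : ustar u = v by rewrite ustarD ustarM ss sr ustarI mulrN -uI_comm.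
have vu : v * u = M%:A.
  rewrite mulrBl !mulrDr Ik IrIr opprD opprK addrA addrK rE sE.
  by rewrite addrC subrK.
have uM : unorm u ^+ 2 = M by rewrite -unorm_star_mul uv vu unorm_alg ger0_norm.
have suv : 2 *: s = u + v by rewrite addrACA subrr addr0 scaler_nat.
have su : unorm s <= unorm u.
  have : 2 * unorm s = unorm (u + v) by rewrite -suv unormZ ger0_norm.
  by have vn : unorm v = unorm u by [rewrite -uv unorm_star]; have := unormD u v; rewrite vn; lra.
rewrite -sE -{1}ss unorm_star_mul -uM.
by rewrite ler_pXn2r ?nnegrE ?unorm_ge0.
Qed.

Lemma cone_unorm_le a b : cone a -> cone (b - a) -> unorm a <= unorm b.
Proof.
move=> ca cba; apply: unorm_le_cone => //; first exact: unorm_ge0.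
have sb : selfadj b by rewrite -(subrK a b); apply: selfadjD; [case: cba|case: ca].
by rewrite -(subrK b (_%:A)) -addrA; apply: coneD => //; exact: selfadj_cone.
Qed.

(** The element d + x is positive of norm at most 2d, so d is a witness for it: |d - (d + x)| <=
    d. *)
Lemma cone_unorm_pm x (d : R) : cone (d%:A - x) -> cone (d%:A + x) -> unorm x <= d.
Proof.
move=> c1 c2.
have d0 : 0 <= d.
  have := coneD c1 c2; rewrite addrACA addNr addr0 => -[_ [t]].
  rewrite -scalerDl -scalerBl unorm_alg => h.
  by have := ler_norm (t - (d + d)); have := le_trans (ler_norm (t - (d+d))) h; lra.
have h : unorm (d%:A + x) <= 2 * d.
  apply: unorm_le_cone => //; first by rewrite mulr_ge0.
  rewrite (_ : (2 * d)%:A - _ = d%:A - x)//.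
  by rewrite mulr_natl mulr2n scalerDl opprD addrACA subrr add0r.
have := cone_unorm_sub c2 h.
by rewrite opprD addrA subrr sub0r unormN.
Qed.

(* As g decreases, (n+1) g^n c <= c + g c + ... + g^n c = 1 - g^(n+1). *)
Lemma unorm_powM_le c n : cone c -> cone (1 - c) ->
  unorm ((1 - c) ^+ n * c) <= n.+1%:R^-1.
Proof.
move=> cc cg; set g := 1 - c in cg *.
have gc : GRing.comm g c by apply/commr_sym; apply: commrB => //; exact: commr1.
have g1 : unorm g <= 1.
  apply: unorm_le_cone => //.
  by rewrite scale1r /g opprB addrC subrK.
have gX (k : nat) : selfadj (g ^+ k) by apply: selfadjX; case: cg.
have gXc (k : nat) : cone (1 - g ^+ k).
  rewrite -[X in cone (X - _)]scale1r; apply: selfadj_cone => //.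
  by apply: le_trans (unormX _ _) _; rewrite exprn_ile1 ?unorm_ge0.
have gXm (k : nat) : cone (g ^+ k * c).
  by apply: coneM => //; [exact: coneX|exact/commr_sym/commrX/commr_sym].
(* The gap in the inequality to be shown. It stays positive because D(k+1) = g D(k) + c (1 -
   g^(k+1)). *)
pose D (k : nat) := 1 - g ^+ k.+1 - k.+1%:R *: (g ^+ k * c).
have gD (k : nat) : GRing.comm g (D k).
  apply: commrB; first by apply: commrB; [exact: commr1|exact: commrX].
  have h : GRing.comm g (g ^+ k * c) by apply: commrM => //; exact: commrX.
  by rewrite /GRing.comm -scalerAr h scalerAl.
have cD (k : nat) : cone (D k).
  elim: k => [|k IH].
    rewrite /D expr1 expr0 mul1r scale1r -addrA -opprD /g subrK subrr.
    by rewrite -(scale0r 1); exact: cone_alg.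
  have -> : D k.+1 = g * D k + c * (1 - g ^+ k.+1).
    have cgk : c * g ^+ k.+1 = g ^+ k.+1 * c.
      by apply: commrX; exact/commr_sym.
    rewrite /D !mulrBr !mulr1 -exprS -scalerAr mulrA -exprS cgk.
    rewrite -(natr1 k.+1) scalerDl scale1r {1 2}/g.
    set X := _ *: _; set Y := _ * c; set Z := g ^+ _.
    by rewrite opprD !addrA [RHS](ACl (1*3*4*6*2*5)) /= subrK.
  apply: coneD; first exact: coneM.
  apply: coneM => //; apply: commrB; first exact: commr1.
  by apply: commrX; exact/commr_sym.
have : unorm (n.+1%:R *: (g ^+ n * c)) <= 1.
  apply: unorm_le_cone => //; first by apply: coneZ.
  have -> : 1%:A - n.+1%:R *: (g ^+ n * c) = D n + g ^+ n.+1.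
    by rewrite /D addrAC subrK scale1r.
  by apply: coneD => //; exact: coneX.
by rewrite unormZ ger0_norm// -ler_pdivlMl ?mulr1.
Qed.

Lemma unorm_pow2 x (k : nat) : selfadj x -> unorm (x ^+ (2 ^ k)) = unorm x ^+ (2 ^ k).
Proof.
move=> sx; elim: k => [|k IH]; first by rewrite !expr1.
rewrite expnS mul2n -addnn !exprD -{1}(selfadjX _ sx) unorm_star_mul IH.
by rewrite expr2.
Qed.

(* (u + z z* )^n = u^n + z Q z* with Q a polynomial in u + z* z, and the
   2^k-th roots of the norms do not see the factor n. *)
Lemma unorm_swap z (u t : R) : 0 <= u -> u <= t -> 0 < t ->
  unorm (u%:A + ustar z * z) <= t -> unorm (u%:A + z * ustar z) <= t.
Proof.
move=> u0 ut t0; set T := u%:A + _; set T' := u%:A + _ => Tt.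
have zT : T' * z = z * T by rewrite mulrDl mulrDr mulr_algl mulr_algr mulrA.
have H n : exists Q, T' ^+ n = (u ^+ n)%:A + z * Q * ustar z /\
    unorm Q * t <= n%:R * t ^+ n.
  elim: n => [|n [Q [QE Qn]]].
    by exists 0; rewrite !expr0 scale1r mulr0 mul0r addr0 unorm0 !mul0r.
  exists ((u ^+ n)%:A + T * Q); split.
    rewrite exprS QE mulrDr mulr_algr mulrDr !mulrA zT mulrDl addrA.
    rewrite -[in RHS](mulrA z); congr (_ + _).
    rewrite /T' scalerDr scalerA -exprSr; congr (_ + _).
    by rewrite mulr_algl -scalerAr.
  apply: (@le_trans _ _ ((u ^+ n + t * unorm Q) * t)).
    apply: ler_wpM2r; [exact: ltW|]; apply: le_trans (unormD _ _) _.
    rewrite unorm_alg ger0_norm ?exprn_ge0// lerD2l.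
    by apply: le_trans (unormM _ _) _; rewrite ler_wpM2r ?unorm_ge0.
  have un : u ^+ n <= t ^+ n by rewrite lerXn2r// nnegrE ltW.
  have h1 := ler_wpM2l (ltW t0) Qn; have h2 := ler_wpM2l (ltW t0) un.
  by rewrite exprS -natr1; lra.
have sT : selfadj T'.
  apply: selfadjD; first exact: ustar_alg.
  by rewrite /selfadj ustarM ustarK.
apply: (@le_of_pow_le _ _ _ (unorm z ^+ 2)) => //; first by rewrite exprn_ge0 ?unorm_ge0.
move=> k; rewrite -unorm_pow2//; move: (2 ^ k)%N => n.
have [Q [-> Qn]] := H n.
apply: (@le_trans _ _ ((u ^+ n + unorm z ^+ 2 * unorm Q) * t)).
  apply: ler_wpM2r; [exact: ltW|]; apply: le_trans (unormD _ _) _.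
  rewrite unorm_alg ger0_norm ?exprn_ge0// lerD2l.
  apply: le_trans (unormM _ _) _; rewrite unorm_star expr2 mulrAC.
  by rewrite ler_wpM2r ?unorm_ge0// unormM.
rewrite mulrDl mulrDr; apply: lerD; first by rewrite ler_pM2r// lerXn2r// nnegrE// ltW.
by have := ler_wpM2l (exprn_ge0 2 (unorm_ge0 z)) Qn; lra.
Qed.

(** Since t - (d - z* z) = (t - d) + z* z, this is [unorm_swap] with u = t - d. *)
Lemma cone_swap z (d : R) : 0 <= d ->
  cone (d%:A - ustar z * z) -> cone (d%:A - z * ustar z).
Proof.
move=> d0 [_ [t0 t0x]]; split.
  by apply: selfadjB; [exact: ustar_alg|rewrite /selfadj ustarM ustarK].
(* At least d + 1, to have 0 <= t - d <= t and 0 < t. *)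
pose t := Num.max t0 (d + 1).
have tt : t0 <= t by rewrite le_max lexx.
have dt : d + 1 <= t by rewrite le_max lexx orbT.
have := cone_bound_mono t0x tt; rewrite opprB addrCA addrC -scalerBl => h.
exists t; rewrite opprB addrCA addrC -scalerBl; apply: unorm_swap => //; lra.
Qed.

End ConeOrder.

(** * Positivity of y* y *)

Section KelleyVaught.
Context {R : realType} {A : cstarAlgType R}.
Local Notation U := (unitization A).
Implicit Types x y z c : U.

Lemma cone_anticomm z : cone (ustar z * z + z * ustar z).
Proof.
pose I := uI A; pose p := z + ustar z; pose q := I * (z - ustar z).
have sp : selfadj p by rewrite /selfadj ustarD ustarK addrC.
have sq : selfadj q.
  by rewrite /selfadj ustarM ustarB ustarK ustarI mulrN -mulNr opprB -uI_comm.
have -> : ustar z * z + z * ustar z = 2^-1 *: (p * p + q * q).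
  have -> : q * q = - ((z - ustar z) * (z - ustar z)).
    by rewrite mulrA -(mulrA I) -uI_comm mulrA uI_sqr mulN1r mulNr.
  have -> : p * p - (z - ustar z) * (z - ustar z) = 2 *: (ustar z * z + z * ustar z).
    rewrite /p; move: (ustar z) => w.
    have -> : (z + w) * (z + w) = z * z + w * w + (w * z + z * w).
      by rewrite mulrDl !mulrDr !addrA [LHS](ACl (1*4*3*2)).
    have -> : (z - w) * (z - w) = z * z + w * w - (w * z + z * w).
      by rewrite mulrBl !mulrBr opprB opprD !addrA [LHS](ACl (1*3*4*2)).
    by rewrite opprB [LHS]addrC addrA subrK scaler_nat.
  by rewrite scalerA mulVf// scale1r.
by apply: coneZ; [rewrite invr_ge0|apply: coneD; exact: cone_sqr].
Qed.

(* If T = y* y had a negative spectral value -t, then, for g = (L - T)/m the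
   element z = y g^n would satisfy z* z = - t g^2n up to a small error, so that
   z* z and z z* would both be almost negative, although their sum is positive. *)
Theorem cone_star_mul y : cone (ustar y * y).
Proof.
set T := ustar y * y; have sT : selfadj T by exact: selfadj_star_mul.
(* The least spectral value of T is L - m; if m <= L, then L itself is a witness for [cone]. *)
pose L := unorm T + 1; pose m := unorm (L%:A - T).
have m0 : 0 <= m := unorm_ge0 _.
have [mL|Lm] := leP m L; first by split => //; exists L.
have mp : 0 < m by have := unorm_ge0 T; rewrite /L in Lm; lra.
pose g := m^-1 *: (L%:A - T); pose c := 1 - g.
have gc : 1 - c = g by rewrite opprB addrC subrK.
have cLT : cone (L%:A - T) by apply: selfadj_cone => //; rewrite /L lerDl.
have cg : cone g by apply: coneZ => //; rewrite invr_ge0.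
have sg : selfadj g by case: cg.
have g1 : unorm g = 1 by rewrite unormZ gtr0_norm ?invr_gt0// mulVf// gt_eqF.
have cc : cone c by rewrite /c -[1]scale1r; apply: selfadj_cone => //; rewrite g1.
have TE : T = m *: c - (m - L)%:A.
  rewrite scalerBr /g scalerA mulfV ?gt_eqF// scale1r scalerBl !opprB !addrA.
  by rewrite [RHS](ACl (2*1*5*3*4)) /= addrK subrK.
have Tg : GRing.comm g T.
  rewrite /GRing.comm /g -scalerAl -scalerAr; congr (_ *: _).
  by apply/commr_sym; apply: commrB => //; exact: comm_alg.
(* The right side tends to 0, which contradicts L < m. *)
suff H k : m - L <= 2 * m / (2 ^ k.+1).+1%:R.
  have [k] : exists k : nat, 2 * m / (m - L) < k%:R.
    have := archi_boundP (ltW (_ : 0 < 2 * m / (m - L))).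
    by rewrite divr_gt0 ?subr_gt0 ?mulr_gt0// => /(_ isT) h; eexists; exact: h.
  rewrite ltr_pdivrMr ?subr_gt0// => h.
  have := H k; rewrite ler_pdivlMr ?ltr0Sn// => h2.
  have : k%:R * (m - L) <= (m - L) * (2 ^ k.+1).+1%:R.
    rewrite mulrC ler_pM2l ?subr_gt0// ler_nat ltnW// ltnS ltnW//.
    by rewrite (ltn_trans (ltnSn k))// ltn_expl.
  by lra.
pose n := (2 ^ k)%N; pose z := y * g ^+ n; pose d := m / (2 ^ k.+1).+1%:R.
have nn : (n + n)%N = (2 ^ k.+1)%N by rewrite expnS mul2n addnn.
have d0 : 0 <= d by rewrite divr_ge0.
(* The error term m X has norm at most d by [unorm_powM_le], while G has norm exactly 1: the norm of
   a self-adjoint element is multiplicative along powers of exponent 2^j. *)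
pose G := g ^+ (2 ^ k.+1); pose X := G * c.
have zE : ustar z * z = m *: X - (m - L) *: G.
  have -> : ustar z * z = G * T.
    have -> : ustar z * z = g ^+ n * (T * g ^+ n).
      by rewrite /z ustarM (selfadjX _ sg) /T !mulrA.
    have -> : T * g ^+ n = g ^+ n * T by apply: commrX; exact/commr_sym.
    by rewrite mulrA -exprD nn.
  by rewrite TE mulrBr mulr_algr -scalerAr.
have sG : selfadj G by exact: selfadjX.
have GX : GRing.comm G c.
  apply/commr_sym/commrX; apply/commr_sym; apply: commrB => //; exact: commr1.
have sX : selfadj X by apply: selfadjM => //; case: cc.
have Xd : unorm (m *: X) <= d.
  rewrite unormZ gtr0_norm// ler_pM2l//.
  by have := unorm_powM_le (2 ^ k.+1) cc; rewrite gc; apply.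
have cz : cone (d%:A - ustar z * z).
  rewrite zE opprB addrCA addrC; apply: coneD.
    by apply: selfadj_cone => //; exact: selfadjZ.
  by apply: coneZ; [rewrite subr_ge0 ltW|exact: coneX].
(* Now z z* <= d as well, so positivity of z* z + z z* gives z* z >= -d; hence (m - L) G has norm at
   most 2d. *)
have cz' := cone_swap d0 cz.
have zd : unorm (ustar z * z) <= d.
  apply: cone_unorm_pm => //.
  have := coneD (cone_anticomm z) cz'.
  by rewrite addrACA subrr addr0 addrC.
have : unorm ((m - L) *: G) <= d + d.
  have -> : (m - L) *: G = m *: X - ustar z * z by rewrite zE opprB [RHS]addrC subrK.
  by apply: le_trans (unormB_le _ _) _; exact: lerD.
rewrite unormZ gtr0_norm ?subr_gt0// unorm_pow2// g1 expr1n mulr1.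
by move=> h; apply: le_trans h _; rewrite /d -mulrA mulr_natl mulr2n.
Qed.

Lemma cone_conj c z : cone c -> cone (ustar z * c * z).
Proof.
move=> /cone_sqrt[s [ss <- _]].
by rewrite -{1}ss mulrA -mulrA -ustarM; exact: cone_star_mul.
Qed.

End KelleyVaught.

(** * Isometric actions and their fixed points *)

Section ActionIsometry.
Context {R : realType} {G : topologicalZmodType} {A : cstarAlgType R}.
Variable alpha : cstar_action G A.

Let uact_ext g (x : unitization A) : unitization A := (x.1, alpha g x.2).

(** In the unitization |y|^2 - y* y is a square s^2, and the extended automorphism maps it to a
    square. Hence alpha(y)* alpha(y) <= |y|^2; the inverse automorphism gives equality. *)
Lemma act_rnorm g x : rnorm (alpha g x) = rnorm x.
Proof.
suff H h y : rnorm (alpha h y) <= rnorm y.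
  apply/eqP; rewrite eq_le H /=; have := H (- g) (alpha g x).
  by rewrite -actD addNr act0.
pose t := rnorm y ^+ 2; have t0 : 0 <= t by rewrite exprn_ge0 ?rnorm_ge0.
have [] := @cone_sqrt _ _ (t%:A - uemb (star y ** y)).
  apply: selfadj_cone; last by rewrite unorm_emb rnorm_star_smul.
  by rewrite /selfadj ustar_emb starM starK.
move=> s [ss sE _].
have extM a b : uact_ext h (a * b) = uact_ext h a * uact_ext h b.
  by congr pair; rewrite /= !actDr !actZ actM.
have se : selfadj (uact_ext h s).
  rewrite /selfadj /uact_ext /ustar /= -act_star.
  by have := congr1 fst ss; have := congr1 snd ss => /= -> ->.
have : cone (t%:A - uemb (star (alpha h y) ** alpha h y)).
  have := cone_sqr se; rewrite -extM sE; congr cone.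
  have N u : alpha h (- u) = - alpha h u by rewrite -scaleN1r actZ scaleN1r.
  by congr pair; rewrite /= !scaler0 !sub0r N actM act_star.
have cy : cone (uemb (star (alpha h y) ** alpha h y)).
  by rewrite uembM -ustar_emb; exact: cone_star_mul.
move=> /(unorm_le_cone t0 cy); rewrite unorm_emb rnorm_star_smul.
by rewrite ler_pXn2r ?nnegrE ?rnorm_ge0.
Qed.

End ActionIsometry.

(** * Invariant vectors in closed convex hulls of orbits *)

Section FixedPoints.
Context {R : realType} {G : topologicalZmodType} {V : completeNormedModType R[i]}.
Variable beta : G -> V -> V.
Hypothesis G_compact : compact [set: G].
Hypothesis betaD : forall g, {morph beta g : x y / x + y}.
Hypothesis betaZ : forall g (c : R[i]) x, beta g (c *: x) = c *: beta g x.
Hypothesis beta0 : forall x, beta 0 x = x.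
Hypothesis beta_add : forall g h x, beta (g + h) x = beta g (beta h x).
Hypothesis beta_rnorm : forall g x, rnorm (beta g x) = rnorm x.
Hypothesis beta_cont : forall x, continuous (fun g => beta g x).
Implicit Types (g h : G) (x y v w : V) (C : set V).

Let betaB g : {morph beta g : x y / x - y}.
Proof. by move=> x y; rewrite betaD -scaleN1r betaZ scaleN1r. Qed.

Lemma orbit_net x (e : R) : 0 < e ->
  exists s : seq G, forall g, exists2 h, h \in s & rnorm (beta g x - beta h x) < e.
Proof.
move=> e0.
(* The filter of all sufficiently large finite lists; compactness is used in its near-covering form
   along this filter. *)
pose F : set_system (seq G) :=
  fun S => exists s0 : seq G, forall s : seq G, {subset s0 <= s} -> S s.
have FF : Filter F.
  split => [|P Q [s hs] [t ht]|P Q PQ [s hs]]; first by exists [::].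
    by exists (s ++ t) => u ut; split; [apply: hs|apply: ht] => g gs;
      apply: ut; rewrite mem_cat gs ?orbT.
  by exists s => t st; apply/PQ/hs.
pose P (s : seq G) g := exists2 h, h \in s & rnorm (beta g x - beta h x) < e.
have /compact_near_coveringP/(_ _ F P FF) := G_compact.
case=> [h _|s hs]; last by exists s => g; apply: (hs s).
have /cvg_rnormP/(_ e e0) hx := @beta_cont x h.
exists ([set g | rnorm (beta g x - beta h x) < e], [set s : seq G | h \in s]).
  split => //=; exists [:: h] => s; apply; exact: mem_head.
by move=> [g s] [/= gh hs]; exists h.
Qed.

(** Midpoints suffice because all averages are taken over 2^k points. *)
Definition midconvex C := forall x y, C x -> C y -> C ((2^-1 : R[i]) *: (x + y)).

(** Quantifying over the whole orbit on both sides makes the relation transitive, so that averaging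
    can be iterated. *)
Definition in_hull x y := forall C, midconvex C ->
  (forall g, C (beta g x)) -> forall g, C (beta g y).

Let midpointB x y z :
  (2^-1 : R[i]) *: (y + z) - x = (2^-1 : R[i]) *: ((y - x) + (z - x)).
Proof.
rewrite addrACA [RHS]scalerDr; congr (_ + _); rewrite -opprD -mulr2n -[x *+ 2]scaler_nat.
by rewrite scalerN scalerA mulVf ?scale1r// pnatr_eq0.
Qed.

(** What is retained of a convex combination of the operators [beta g]. It commutes with the action
    because G is abelian, and such operators compose. *)
Let averaging (T : V -> V) : Prop :=
  [/\ {morph T : x y / x - y}, forall g x, beta g (T x) = T (beta g x),
      forall x, rnorm (T x) <= rnorm x
    & forall C x, midconvex C -> (forall g, C (beta g x)) -> C (T x)].

Let averaging_comp (S T : V -> V) :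
  averaging S -> averaging T -> averaging (S \o T).
Proof.
move=> [SB Sb Sn Sc] [TB Tb Tn Tc]; split => [x y|g x|x|C x cC Cx] /=.
- by rewrite TB SB.
- by rewrite Sb Tb.
- exact: le_trans (Sn _) (Tn _).
- by apply: Sc => // g; rewrite Tb; apply: Tc => // k; rewrite -beta_add.
Qed.

Let rnorm_half : rnorm (2^-1 : R[i]^o) = 2^-1.
Proof.
have -> : (2^-1 : R[i]) = (2^-1 : R)%:C by rewrite fmorphV rmorph_nat.
by rewrite rnorm_real ger0_norm// invr_ge0.
Qed.

(* The average over {0, h, ..., (2^k - 1) h}, obtained by k midpoints. *)
Let mean h k : exists2 T, averaging T &
  forall x, beta h (T x) - T x =
    (2^-1 : R[i]) ^+ k *: (beta (h *+ (2 ^ k)) x - x).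
Proof.
elim: k => [|k [T aT TE]].
  exists id; last by move=> x; rewrite expr0 scale1r.
  by split => // C x _ Cx; rewrite -(beta0 x).
pose M x := (2^-1 : R[i]) *: (x + beta (h *+ (2 ^ k)) x).
have aM : averaging M.
  split => [x y|g x|x|C x cC Cx]; rewrite /M.
  - by rewrite betaB -scalerBr opprD addrACA.
  - by rewrite betaZ betaD -!beta_add addrC [in RHS]addrC addrC [in RHS]addrC (addrC g).
  - rewrite rnormZ rnorm_half mulrC ler_pdivrMr//.
    by apply: le_trans (rnormD _ _) _; rewrite beta_rnorm; lra.
  - by apply: cC => //; rewrite -[X in C X]beta0.
exists (M \o T); first exact: averaging_comp.
move=> x; have [_ Tb _ _] := aT; have [MB Mb _ _] := aM.
rewrite /= Mb -MB TE /M betaZ -scalerDr scalerA -exprS betaB -beta_add.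
by congr (_ *: _); rewrite addrC addrA subrK -mulrnDr expnS mul2n addnn.
Qed.

(** One mean is composed for each h in the list. A later mean commutes with the action and is
    contractive, so it preserves the bounds already reached. *)
Let net_mean (s : seq G) x (e : R) : 0 < e -> exists2 T, averaging T &
  forall h, h \in s -> rnorm (beta h (T x) - T x) <= e.
Proof.
move=> e0; elim: s => [|h s [T aT TE]].
  by exists id => //; split => // C y _ Cy; rewrite -(beta0 y).
have [k hk] : exists k : nat, 2 * rnorm x / e <= 2 ^+ k.
  have := archi_boundP (_ : 0 <= 2 * rnorm x / e).
  rewrite divr_ge0 ?mulr_ge0 ?rnorm_ge0 ?ltW// => /(_ isT) hk; eexists.
  apply: le_trans (ltW hk) _; rewrite -natrX ler_nat ltnW//; exact: ltn_expl.
have [M aM ME] := mean h k; exists (M \o T); first exact: averaging_comp.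
have [MB Mb Mn _] := aM; have [_ _ Tn _] := aT.
move=> h'; rewrite inE => /predU1P[->|h's] /=; last first.
  by rewrite Mb -MB; apply: le_trans (Mn _) _; exact: TE.
rewrite ME rnormZ.
have -> : rnorm ((2^-1 : R[i]) ^+ k : R[i]^o) = 2^-1 ^+ k.
  have -> : (2^-1 : R[i]) ^+ k = (2^-1 ^+ k : R)%:C.
    by rewrite rmorphXn /= fmorphV rmorph_nat.
  by rewrite rnorm_real ger0_norm// exprn_ge0// invr_ge0.
rewrite exprVn ler_pdivrMl ?exprn_gt0//; move: hk; rewrite ler_pdivrMr//.
apply: le_trans; apply: le_trans (rnormD _ _) _.
by rewrite rnormN beta_rnorm; have := Tn x; lra.
Qed.

Let average x (e : R) : 0 < e -> exists y, in_hull x y /\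
  forall g, rnorm (beta g y - y) <= e.
Proof.
move=> e0; have e2 : 0 < e / 2 by rewrite divr_gt0.
have [s hs] := orbit_net x e2; have [T [TB Tb Tn Tc] Ts] := net_mean s x e2.
exists (T x); split => [C cC Cx g|g].
  by rewrite Tb; apply: Tc => // h; rewrite -beta_add.
have [h /Ts hh hg] := hs g.
have -> : beta g (T x) - T x = T (beta g x - beta h x) + (beta h (T x) - T x).
  by rewrite TB !Tb addrA subrK.
apply: le_trans (rnormD _ _) _; rewrite [leRHS](splitr e); apply: lerD => //.
exact: le_trans (Tn _) (ltW hg).
Qed.

(** Average repeatedly, reducing the oscillation along the orbit to 2^-n at stage n. The orbit of
    v_n lies in the ball of radius 2^-n about v_n, which is midconvex, so the next average stays in
    it and the sequence is Cauchy. *)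
Theorem fixed_point x : exists w, (forall g, beta g w = w) /\
  forall C, midconvex C -> (forall g, C (beta g x)) ->
    forall e : R, 0 < e -> exists2 y, C y & rnorm (y - w) < e.
Proof.
have e0 n : 0 < (2^-1 : R) ^+ n by rewrite exprn_gt0.
have [F FP] := @choice _ _ (fun (nx : nat * V) y => in_hull nx.2 y /\
  forall g, rnorm (beta g y - y) <= 2^-1 ^+ nx.1) (fun nx => average nx.2 (e0 nx.1)).
pose v := fix v n := if n is m.+1 then F (n, v m) else F (0%N, x).
have v_osc n g : rnorm (beta g (v n) - v n) <= 2^-1 ^+ n.
  by case: n => [|n] /=; [case: (FP (0%N, x))|case: (FP (n.+1, v n))].
have v_hull n : in_hull x (v n).
  elim: n => [|n IH] C cC Cx; first by case: (FP (0%N, x)) => /(_ C cC Cx).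
  by case: (FP (n.+1, v n)) => /(_ C cC) + _; apply; exact: IH.
(* The bound 2^-n, written as an increment of the convergent sequence -2 * 2^-n. *)
have dv n : rnorm (v n.+1 - v n) <= (- 2 * 2^-1 ^+ n.+1) - (- 2 * 2^-1 ^+ n).
  have -> : (- 2 * 2^-1 ^+ n.+1) - (- 2 * 2^-1 ^+ n) = 2^-1 ^+ n :> R.
    by rewrite exprS; field.
  have [H _] := FP (n.+1, v n).
  have := H [set z | rnorm (z - v n) <= 2^-1 ^+ n] _ _ 0.
  rewrite /= beta0; apply => [y z /= hy hz|g]; last exact: v_osc.
  have -> : (2^-1 : R[i]) *: (y + z) - v n = (2^-1 : R[i]) *: ((y - v n) + (z - v n)) by exact: midpointB.
  rewrite rnormZ rnorm_half mulrC ler_pdivrMr//.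
  by apply: le_trans (rnormD _ _) _; lra.
have cv : cvgn v.
  apply: dominated_cvg dv; apply: is_cvgM; first exact: is_cvg_cst.
  by apply: cvgP; apply: cvg_expr; rewrite ger0_norm ?invr_ge0// invf_lt1// ltr1n.
pose w := limn v; exists w; split.
  move=> g; apply/eqP; rewrite -subr_eq0; apply/eqP; apply: rnorm_eq0.
  apply/eqP; rewrite eq_le rnorm_ge0 andbT; apply/ler_addgt0Pr => e e1.
  rewrite add0r; have e3 : 0 < e / 3 by rewrite divr_gt0.
  have /cvg_rnormP/(_ _ e3) h1 : v @ \oo --> w by [].
  have h2 : \forall n \near \oo, (2^-1 : R) ^+ n < e / 3.
    have /cvgr0_norm_lt/(_ _ e3) : (fun n => (2^-1 : R) ^+ n) @ \oo --> (0 : R).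
      by apply: cvg_expr; rewrite ger0_norm ?invr_ge0// invf_lt1// ltr1n.
    by apply: filterS => n; rewrite ger0_norm// ltW.
  have [N _ /(_ N (leqnn N)) [/= a b]] : \forall n \near \oo,
      rnorm (v n - w) < e / 3 /\ (2^-1 : R) ^+ n < e / 3 by apply: filterS2 h1 h2.
  have -> : beta g w - w = (beta g (v N) - v N) + (v N - w) - beta g (v N - w).
    by rewrite betaB addrA subrK opprB [RHS]addrC addrA subrK.
  apply: le_trans (rnormD _ _) _; rewrite rnormN beta_rnorm.
  by have := rnormD (beta g (v N) - v N) (v N - w); have := v_osc N g; lra.
move=> C cC Cx e e1; have /cvg_rnormP/(_ _ e1) [N _ hN] : v @ \oo --> w by [].
exists (v N); last exact: (hN N (leqnn N)).
by rewrite -(beta0 (v N)); exact: v_hull.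
Qed.

Lemma fixed_point_near x : exists w, (forall g, beta g w = w) /\
  (forall (d : R), (forall g, rnorm (beta g x - x) <= d) -> rnorm (w - x) <= d) /\
  forall C, midconvex C -> closed C -> (forall g, C (beta g x)) -> C w.
Proof.
have [w [wf wC]] := fixed_point x; exists w; split => //; split.
  move=> d xd; apply/ler_addgt0Pr => e e0.
  have [||y /= yd yw] := wC [set z | rnorm (z - x) <= d] _ _ e e0.
  - move=> y z /= hy hz.
    have -> : (2^-1 : R[i]) *: (y + z) - x = (2^-1 : R[i]) *: ((y - x) + (z - x)) by exact: midpointB.
    rewrite rnormZ rnorm_half mulrC ler_pdivrMr//.
    by apply: le_trans (rnormD _ _) _; lra.
  - exact: xd.
  have -> : w - x = (y - x) - (y - w) by rewrite opprB [RHS]addrC addrA subrK.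
  by apply: le_trans (rnormD _ _) _; rewrite rnormN; lra.
move=> C cC clC Cx; apply: clC => U; rewrite -nbhs_ballE => -[e /= /gt0_real[e0 eE] eU].
have [y Cy yw] := wC C cC Cx _ e0; exists y; split => //; apply: eU.
by rewrite eE -ball_normE /ball_ /= -rnormE ltcR -rnormN opprB.
Qed.

End FixedPoints.

(** * Hereditary subalgebras and approximate units *)

Section ClosedSpan.
Context {R : realType} {V : normedModType R[i]}.
Implicit Types (C S : set V) (x y : V).

Lemma closed_rnormP C : closed C <->
  forall x, (forall e : R, 0 < e -> exists2 y, C y & rnorm (y - x) < e) -> C x.
Proof.
split=> [clC x H|H x clx].
  apply: clC => U; rewrite -nbhs_ballE => -[e /= /gt0_real[e0 eE] eU].
  have [y Cy yx] := H _ e0; exists y; split => //; apply: eU.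
  by rewrite eE -ball_normE /ball_ /= -rnormE ltcR -rnormN opprB.
apply: H => e e0; have e0' : 0 < e%:C by rewrite ltcR.
have [y [Cy]] := clx _ (nbhsx_ballx x _ e0').
rewrite -ball_normE /ball_ /= -rnormE ltcR => yx.
by exists y => //; rewrite -rnormN opprB.
Qed.

Lemma closure_rnormP S x : closure S x <->
  forall e : R, 0 < e -> exists2 y, S y & rnorm (y - x) < e.
Proof.
split=> [clx e e0|H U].
  have e0' : 0 < e%:C by rewrite ltcR.
  have [y [Sy]] := clx _ (nbhsx_ballx x _ e0').
  rewrite -ball_normE /ball_ /= -rnormE ltcR => yx.
  by exists y => //; rewrite -rnormN opprB.
rewrite -nbhs_ballE => -[e /= /gt0_real[e0 eE] eU].
have [y Sy yx] := H _ e0; exists y; split => //; apply: eU.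
by rewrite eE -ball_normE /ball_ /= -rnormE ltcR -rnormN opprB.
Qed.

Definition closed_subspace C : Prop :=
  [/\ C 0, forall x y, C x -> C y -> C (x + y),
      forall (c : R[i]) x, C x -> C (c *: x) & closed C].

Lemma closed_subspaceB C x y : closed_subspace C -> C x -> C y -> C (x - y).
Proof. by case=> _ CD CZ _ Cx Cy; apply: CD => //; rewrite -scaleN1r; exact: CZ. Qed.

Lemma closed_subspace_sum C n (x : 'I_n -> V) :
  closed_subspace C -> (forall i, C (x i)) -> C (\sum_i x i).
Proof. by case=> C0 CD _ _ Cx; apply: (big_ind C). Qed.

Definition cspan S := closure (lin_span S).

Lemma cspan_sub S C : closed_subspace C -> S `<=` C -> cspan S `<=` C.
Proof.
move=> cC SC x /closure_rnormP H; have [_ _ CZ /closed_rnormP clC] := cC.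
apply: clC => e /H[y [n [c [z [Sz ->]]]] yx]; exists (\sum_i c i *: z i) => //.
by apply: closed_subspace_sum => // i; apply: CZ; exact: SC.
Qed.

Lemma sub_cspan S : S `<=` cspan S.
Proof.
move=> x Sx; apply/closure_rnormP => e e0; exists x; last by rewrite subrr rnorm0.
exists 1%N, (fun=> 1), (fun=> x); split=> //.
by rewrite big_ord1 scale1r.
Qed.

Lemma cspan_closed_subspace S : closed_subspace (cspan S).
Proof.
have LD x y : lin_span S x -> lin_span S y -> lin_span S (x + y).
  move=> [n [c [u [Su ->]]]] [m [d [v [Sv ->]]]].
  exists (n + m)%N, (fun k : 'I_(n + m) => match fintype.split k with inl i => c i | inr i => d i end),
    (fun k : 'I_(n + m) => match fintype.split k with inl i => u i | inr i => v i end); split.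
    by move=> k; case: fintype.split.
  rewrite big_split_ord /=; congr (_ + _); apply: eq_bigr => i _.
    by rewrite (unsplitK (inl i)).
  by rewrite (unsplitK (inr i)).
split.
- apply/closure_rnormP => e e0; exists 0; last by rewrite subrr rnorm0.
  by exists 0%N, (fun=> 0), (fun=> 0); split => [[]|]; rewrite ?big_ord0.
- move=> x y /closure_rnormP cx /closure_rnormP cy; apply/closure_rnormP => e e0.
  have e2 : 0 < e / 2 by rewrite divr_gt0.
  have [u Lu ux] := cx _ e2; have [v Lv vy] := cy _ e2.
  exists (u + v); first exact: LD.
  rewrite opprD addrACA (le_lt_trans (rnormD _ _))// [ltRHS](splitr e).
  exact: ltrD.
- move=> c x /closure_rnormP cx; apply/closure_rnormP => e e0.
  set M := rnorm (c : R[i]^o); have M1 : 0 < M + 1 by rewrite ltr_wpDl ?rnorm_ge0.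
  have [u [n [d [v [Sv uE]]]] ux] := cx _ (divr_gt0 e0 M1).
  exists (c *: u).
    exists n, (fun i => c * d i), v; split => //.
    by rewrite uE scaler_sumr; apply: eq_bigr => i _; rewrite scalerA.
  rewrite -scalerBr rnormZ -/M; move: ux; rewrite ltr_pdivlMr// mulrDr mulr1 => ux.
  by apply: le_lt_trans ux; rewrite mulrC lerDl rnorm_ge0.
- exact: closed_closure.
Qed.

End ClosedSpan.

Section CStarClosedSpan.
Context {R : realType} {A : cstarAlgType R}.
Implicit Types (C S : set A).

Lemma closed_subspace_mull C (c : A) :
  closed_subspace C -> closed_subspace [set x | C (c ** x)].
Proof.
move=> [C0 CD CZ /closed_rnormP clC]; split => /=.
- by rewrite smulr0.
- by move=> x y Cx Cy; rewrite smulDr; exact: CD.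
- by move=> t x Cx; rewrite scale_smulr; exact: CZ.
- apply/closed_rnormP => x H /=; apply: clC => e e0.
  have M1 : 0 < rnorm c + 1 by rewrite ltr_wpDl ?rnorm_ge0.
  have [y Cy yx] := H _ (divr_gt0 e0 M1); exists (c ** y) => //.
  rewrite -smulBr (le_lt_trans (rnormM _ _))//.
  move: yx; rewrite ltr_pdivlMr// mulrDr mulr1 => yx.
  by apply: le_lt_trans yx; rewrite mulrC lerDl rnorm_ge0.
Qed.

Lemma closed_subspace_mulr C (c : A) :
  closed_subspace C -> closed_subspace [set x | C (x ** c)].
Proof.
move=> [C0 CD CZ /closed_rnormP clC]; split => /=.
- by rewrite smul0r.
- by move=> x y Cx Cy; rewrite smulDl; exact: CD.
- by move=> t x Cx; rewrite scale_smull; exact: CZ.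
- apply/closed_rnormP => x H /=; apply: clC => e e0.
  have M1 : 0 < rnorm c + 1 by rewrite ltr_wpDl ?rnorm_ge0.
  have [y Cy yx] := H _ (divr_gt0 e0 M1); exists (y ** c) => //.
  rewrite -smulBl (le_lt_trans (rnormM _ _))//.
  move: yx; rewrite ltr_pdivlMr// mulrDr mulr1 => yx.
  by apply: le_lt_trans yx; rewrite lerDl rnorm_ge0.
Qed.

Lemma cstar_subalg_closed_subspace (B : set A) :
  is_cstar_subalg B -> closed_subspace B.
Proof. by case=> -[B0 BD BZ _ _] clB; split. Qed.

(** The scalar coordinate of the root squares to 0, so the root lies in A. *)
Lemma cone_sqrt_emb (x : A) : cone (uemb x) ->
  exists y, [/\ star y = y, x = y ** y & forall z, z ** x = x ** z -> z ** y = y ** z].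
Proof.
move=> /cone_sqrt[s [ss sE sc]].
have s0 : s.1 = 0.
  by apply/eqP; have /eqP := congr1 fst sE; rewrite /= mulf_eq0 orbb.
move: ss sE sc; rewrite (uemb_fst0 s0) => ss sE sc; exists s.2.
have embI (u v : A) : uemb u = uemb v -> u = v by case.
split; first by apply: embI; rewrite -ustar_emb.
  by apply: embI; rewrite uembM.
move=> z zx; apply: embI; rewrite !uembM; apply: sc.
by rewrite /GRing.comm -!uembM zx.
Qed.

Lemma cone_positive (x : A) : cone (uemb x) -> positive x.
Proof. by move=> /cone_sqrt_emb[y [sy -> _]]; exists y; rewrite sy. Qed.

Lemma selfadj_emb (a : A) : star a = a -> selfadj (uemb a).
Proof. by rewrite /selfadj ustar_emb => ->. Qed.

Lemma star_decomp (B : set A) (a : A) : is_star_subalg B -> B a -> exists a1 a2,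
  [/\ B a1 /\ B a2, star a1 = a1, star a2 = a2 & a = a1 + 'i *: a2].
Proof.
move=> [_ BD BZ _ BS] Ba.
have ci : Num.conj (2^-1 : R[i]) = 2^-1 by rewrite fmorphV rmorph_nat.
have c2 : Num.conj (- (2^-1 * 'i) : R[i]) = 2^-1 * 'i.
  by rewrite rmorphN rmorphM [X in - (X * _)]ci [X in - (_ * X)]conjCi mulrN opprK.
exists (2^-1 *: (a + star a)), (- (2^-1 * 'i) *: (a - star a)); split.
- split; apply: (BZ); apply: BD => //; first exact: BS.
  by rewrite -scaleN1r; apply: (BZ); exact: BS.
- by rewrite starZ ci starD starK addrC.
- by rewrite starZ c2 starB starK scaleNr -scalerN opprB.
- rewrite scalerA mulrN mulrCA -expr2 sqrCi mulrN1 opprK -scalerDr addrACA subrr addr0.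
  by rewrite -mulr2n -[a *+ 2]scaler_nat scalerA mulVf ?scale1r// pnatr_eq0.
Qed.

(** Heredity speaks of positive elements only. For self-adjoint c of norm t one has 0 <= t b* b + b*
    c b <= 2t b* b, and b* c b is recovered by subtracting t b* b. *)
Lemma hereditary_conj (B : set A) (b a : A) :
  hereditary B -> B b -> B (star b ** a ** b).
Proof.
move=> [[sB clB] hB] Bb; have [B0 BD BZ BM BS] := sB.
have Bbb : B (star b ** b) by apply: BM => //; exact: BS.
suff H c : star c = c -> B (star b ** c ** b).
  have [|//|a1 [a2 [_ s1 s2 ->]]] := @star_decomp setT a; first by [].
  by rewrite smulDr smulDl scale_smulr scale_smull; apply: BD; [|apply: BZ]; exact: H.
move=> sc; set t := rnorm c.
have ec : selfadj (uemb c) by exact: selfadj_emb.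
have P (v : A) : star v = v -> rnorm v <= t ->
    positive (t%:C *: (star b ** b) - star b ** v ** b).
  move=> sv vt; apply: cone_positive.
  have -> : uemb (t%:C *: (star b ** b) - star b ** v ** b) =
      ustar (uemb b) * (t%:A - uemb v) * uemb b.
    rewrite uembB uembZ !uembM -ustar_emb mulrBr mulrBl; congr (_ - _).
    by rewrite mulr_algr -scalerAl.
  by apply: cone_conj; apply: selfadj_cone; [exact: selfadj_emb|rewrite unorm_emb].
have -> : star b ** c ** b =
    (t%:C *: (star b ** b) - star b ** (- c) ** b) - t%:C *: (star b ** b).
  by rewrite smulrN smulNr opprK addrC addrA addNr add0r.
apply: (closed_subspaceB (cstar_subalg_closed_subspace (conj sB clB))); last exact: BZ.
apply: (hB _ ((2 * t)%:C *: (star b ** b))).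
- by apply: P; rewrite ?starN ?sc// rnormN.
- exact: BZ.
- have -> : (2 * t)%:C *: (star b ** b) - (t%:C *: (star b ** b) - star b ** (- c) ** b) =
      t%:C *: (star b ** b) - star b ** c ** b.
    rewrite smulrN smulNr opprK opprD addrA -scalerBl -rmorphB.
    by congr (_%:C *: _ - _); ring.
  exact: P.
Qed.

(** Near x the number |x| + 1 is a common witness for [cone], so its inequality passes to the
    limit. *)
Lemma cone_limit (x : unitization A) :
  (forall e : R, 0 < e -> exists2 y, cone y & unorm (y - x) < e) -> cone x.
Proof.
move=> H; have sx : selfadj x.
  apply/eqP; rewrite -subr_eq0; apply/eqP; apply: unorm_eq0; apply/eqP.
  rewrite eq_le unorm_ge0 andbT; apply/ler_addgt0Pr => e e0.
  have e2 : 0 < e / 2 by rewrite divr_gt0.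
  have [y [sy _] yx] := H _ e2; rewrite add0r.
  have -> : ustar x - x = (y - x) - ustar (y - x).
    by rewrite ustarB sy opprB [RHS]addrC addrA subrK.
  by apply: le_trans (unormB_le _ _) _; rewrite unorm_star; lra.
split => //; exists (unorm x + 1); apply/ler_addgt0Pr => e e0.
have e1 : 0 < Num.min 1 e by rewrite lt_min ltr01.
have [y cy] := H _ e1; rewrite lt_min => /andP[y1 ye].
have yt : unorm y <= 2 * (unorm x + 1).
  rewrite -(subrK x y); apply: le_trans (unormD _ _) _.
  by have := unorm_ge0 x; lra.
have := cone_unorm_sub cy yt => h.
have -> : (unorm x + 1)%:A - x = ((unorm x + 1)%:A - y) + (y - x) by rewrite addrA subrK.
by apply: le_trans (unormD _ _) _; lra.
Qed.

(** * The approximate unit generated by a positive contraction *)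

Section ApproximateUnit.
Variable h : A.
Hypothesis cone_h : cone (uemb h).
Hypothesis h_le1 : rnorm h <= 1.

(** This is 1 - (1 - h)^n, a polynomial in h without constant term: it stays in every algebra or
    ideal that contains h and is fixed whenever h is. *)
Fixpoint aunit (n : nat) : A :=
  if n is m.+1 then aunit m + h - aunit m ** h else 0.

Let Q n := (1 - uemb h) ^+ n.

Lemma aunitE n : uemb (aunit n) = 1 - (1 - uemb h) ^+ n.
Proof.
elim: n => [|n IH]; first by rewrite expr0 subrr.
rewrite /= uembB uembD uembM exprSr {}IH; set X := _ ^+ n.
rewrite mulrBr mulr1 mulrBl mul1r !opprB !addrA.
by rewrite [LHS](ACl (1*4*2*3*5)) /= addrK.
Qed.

Lemma aunit_Q n : (1 - uemb h) ^+ n = 1 - uemb (aunit n).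
Proof. by rewrite aunitE opprB [RHS]addrC subrK. Qed.

Let cone1h : cone (1 - uemb h).
Proof.
rewrite -[1]scale1r; apply: selfadj_cone; [by case: cone_h|by rewrite unorm_emb].
Qed.

Let QC n : cone (Q n). Proof. exact: coneX. Qed.

Lemma aunit_pow_le1 n : unorm ((1 - uemb h) ^+ n) <= 1.
Proof.
apply: le_trans (unormX _ _) _; apply: exprn_ile1; first exact: unorm_ge0.
apply: unorm_le_cone => //.
by rewrite scale1r opprB addrC subrK.
Qed.

Lemma aunit_cone n : cone (uemb (aunit n)).
Proof.
by rewrite aunitE -[1 in X in X - _]scale1r; apply: selfadj_cone;
  [case: (QC n)|exact: aunit_pow_le1].
Qed.

Lemma aunit_le1 n : rnorm (aunit n) <= 1.
Proof.
rewrite -unorm_emb; apply: unorm_le_cone => //; first exact: aunit_cone.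
by rewrite scale1r -aunit_Q.
Qed.

Lemma aunit_star n : star (aunit n) = aunit n.
Proof. by have [/(congr1 snd)] := aunit_cone n. Qed.

Lemma aunit_pow_mul n : unorm ((1 - uemb h) ^+ n * uemb h) <= n.+1%:R^-1.
Proof. exact: unorm_powM_le. Qed.

Lemma aunit_pow_comm n : GRing.comm (uemb h) ((1 - uemb h) ^+ n).
Proof. by apply: commrX; apply: commrB => //; exact: commr1. Qed.

(** With q = (1 - h)^n the left side is the norm of q b* b q. This is dominated by q (M h + e) q,
    and q h has norm at most 1/(n+1). *)
Lemma aunit_sub_le b (e M : R) : 0 <= M -> 0 <= e ->
  cone (M *: uemb h + e%:A - uemb (star b ** b)) -> forall n,
  rnorm (b - b ** aunit n) ^+ 2 <= M / n.+1%:R + e.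
Proof.
move=> M0 e0 cb n; set q := (1 - uemb h) ^+ n.
have sq : ustar q = q by case: (QC n).
have -> : rnorm (b - b ** aunit n) = unorm (uemb b * q).
  by rewrite -unorm_emb uembB uembM /q aunit_Q mulrBr mulr1.
have q1 : unorm q <= 1 by exact: aunit_pow_le1.
rewrite -unorm_star_mul.
apply: (@le_trans _ _ (unorm (q * (M *: uemb h + e%:A) * q))).
  apply: cone_unorm_le; first exact: cone_star_mul.
  have -> : ustar (uemb b * q) * (uemb b * q) = q * uemb (star b ** b) * q.
    by rewrite ustarM sq ustar_emb uembM !mulrA.
  by rewrite -mulrBl -mulrBr -{1}sq; exact: cone_conj.
rewrite mulrDr mulrDl -scalerAr -scalerAl mulr_algr -scalerAl.
apply: le_trans (unormD _ _) _; rewrite !unormZ !ger0_norm//; apply: lerD.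
  rewrite ler_wpM2l//; apply: le_trans (unormM _ _) _.
  rewrite -[leRHS]mulr1; apply: ler_pM; rewrite ?unorm_ge0//.
  exact: aunit_pow_mul.
rewrite -[leRHS]mulr1 ler_wpM2l//; apply: le_trans (unormM _ _) _.
by rewrite mulr_ile1 ?unorm_ge0.
Qed.

End ApproximateUnit.
End CStarClosedSpan.

(** * Central sequences *)

Section Vanishing.
Context {R : realType} {A : cstarAlgType R}.
Implicit Types (x y : nat -> A).

Definition vanish x : Prop := forall e : R, 0 < e -> \forall n \near \oo, rnorm (x n) < e.

Definition bounded_seq x : Prop := exists M : R, forall n, rnorm (x n) <= M.

Lemma vanishD x y : vanish x -> vanish y -> vanish (fun n => x n + y n).
Proof.
move=> hx hy e e0; have e2 : 0 < e / 2 by rewrite divr_gt0.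
apply: filterS2 (hx _ e2) (hy _ e2) => n h1 h2.
by rewrite (le_lt_trans (rnormD _ _))// [ltRHS](splitr e) ltrD.
Qed.

Lemma vanish_le x y : (forall n, rnorm (x n) <= rnorm (y n)) -> vanish y -> vanish x.
Proof. by move=> xy hy e /hy; apply: filterS => n; exact: le_lt_trans. Qed.

Lemma vanish_eq x y : x =1 y -> vanish y -> vanish x.
Proof. by move=> xy; apply: vanish_le => n; rewrite xy. Qed.

Lemma vanishN x : vanish x -> vanish (fun n => - x n).
Proof. by apply: vanish_le => n; rewrite rnormN. Qed.

Lemma vanishB x y : vanish x -> vanish y -> vanish (fun n => x n - y n).
Proof. by move=> hx /vanishN; exact: vanishD. Qed.

Lemma vanish_star x : vanish x -> vanish (fun n => star (x n)).
Proof. by apply: vanish_le => n; rewrite rnorm_star. Qed.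

Lemma vanish0 : vanish (fun=> 0).
Proof. by move=> e e0; apply: nearW => n; rewrite rnorm0. Qed.

Lemma vanish_scaled (K : R) x (u : nat -> A) :
  (forall n, rnorm (u n) <= K * rnorm (x n)) -> vanish x -> vanish u.
Proof.
move=> ux hx e e0.
have K1 : 0 < `|K| + 1 by rewrite ltr_wpDl.
apply: filterS (hx _ (divr_gt0 e0 K1)) => n; rewrite ltr_pdivlMr// => xe.
apply: le_lt_trans (ux n) _; apply: le_lt_trans xe.
rewrite mulrC ler_wpM2l ?rnorm_ge0//.
by rewrite (le_trans (ler_norm K))// lerDl.
Qed.

Lemma vanish_mul x y : vanish x -> vanish y -> vanish (fun n => x n ** y n).
Proof.
move=> hx hy e e0; apply: filterS2 (hx 1 ltr01) (hy e e0) => n x1 ye.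
apply: le_lt_trans (rnormM _ _) _; apply: le_lt_trans ye.
by rewrite ler_piMl ?rnorm_ge0// ltW.
Qed.

Lemma vanishZ (c : R[i]) x : vanish x -> vanish (fun n => c *: x n).
Proof. by apply: (@vanish_scaled (rnorm (c : R[i]^o))) => n; rewrite rnormZ. Qed.

Lemma vanish_mull x y : bounded_seq x -> vanish y -> vanish (fun n => x n ** y n).
Proof.
move=> [M xM]; apply: (@vanish_scaled M) => n.
by apply: le_trans (rnormM _ _) _; rewrite ler_wpM2r ?rnorm_ge0.
Qed.

Lemma vanish_mulr x y : bounded_seq y -> vanish x -> vanish (fun n => x n ** y n).
Proof.
move=> [M yM]; apply: (@vanish_scaled M) => n.
by apply: le_trans (rnormM _ _) _; rewrite mulrC ler_wpM2r ?rnorm_ge0.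
Qed.

Lemma bounded_cst (a : A) : bounded_seq (fun=> a).
Proof. by exists (rnorm a). Qed.

Lemma bounded_linf (a : linf A) : bounded_seq (linf_seq a).
Proof. exact: linf_bounded. Qed.

Lemma boundedM x y : bounded_seq x -> bounded_seq y -> bounded_seq (fun n => x n ** y n).
Proof.
move=> [M xM] [N yN]; exists (M * N) => n.
by apply: le_trans (rnormM _ _) _; rewrite ler_pM ?rnorm_ge0.
Qed.

Lemma bounded_star x : bounded_seq x -> bounded_seq (fun n => star (x n)).
Proof. by move=> [M xM]; exists M => n; rewrite rnorm_star. Qed.

Lemma c0_vanish (a : linf A) : c0_set a <-> vanish (linf_seq a).
Proof.
split=> [/cvgr0Pnorm_lt H e /H|H].
  by apply: filterS => n; rewrite ger0_norm ?rnorm_ge0.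
apply/cvgr0Pnorm_lt => e /H.
by apply: filterS => n; rewrite ger0_norm ?rnorm_ge0.
Qed.

Lemma vanish_limit (C : set A) x (l : A) :
  closed C -> (forall n, C (x n)) -> vanish (fun n => x n - l) -> C l.
Proof.
move=> /closed_rnormP clC Cx xl; apply: clC => e /xl[N _ /(_ N (leqnn N)) h].
by exists (x N).
Qed.

End Vanishing.

(** * The hereditary subalgebra generated by a positive contraction *)

Section UnitSubalgebra.
Context {R : realType} {A : cstarAlgType R}.
Variable h : A.
Hypothesis cone_h : cone (uemb h).
Hypothesis h_le1 : rnorm h <= 1.
Let a_ := aunit h.

(** This is the closure of h A h. Describing it by its approximate unit makes sigma-unitality and
    invariance direct. *)
Definition unit_set : set A :=
  [set x | vanish (fun n => x - x ** a_ n) /\ vanish (fun n => x - a_ n ** x)].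

Let star_h : star h = h.
Proof. by have [/(congr1 snd)] := cone_h. Qed.

Let star_a n : star (a_ n) = a_ n.
Proof. exact: aunit_star. Qed.

Lemma unit_cstar_subalg : is_cstar_subalg unit_set.
Proof.
split; [split|].
- by split; apply: vanish_eq vanish0 => n; rewrite ?smul0r ?smulr0 subrr.
- move=> x y [x1 x2] [y1 y2]; split.
    by apply: vanish_eq (vanishD x1 y1) => n; rewrite smulDl opprD addrACA.
  by apply: vanish_eq (vanishD x2 y2) => n; rewrite smulDr opprD addrACA.
- move=> c x [x1 x2]; split.
    by apply: vanish_eq (vanishZ c x1) => n; rewrite scale_smull scalerBr.
  by apply: vanish_eq (vanishZ c x2) => n; rewrite scale_smulr scalerBr.
- move=> x y [x1 x2] [y1 y2]; split.
    apply: vanish_eq (vanish_mull (bounded_cst x) y1) => n.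
    by rewrite smulBr smulA.
  apply: vanish_eq (vanish_mulr (bounded_cst y) x2) => n.
  by rewrite smulBl smulA.
- move=> x [x1 x2]; split.
    by apply: vanish_eq (vanish_star x2) => n; rewrite starB starM star_a.
  by apply: vanish_eq (vanish_star x1) => n; rewrite starB starM star_a.
apply/closed_rnormP => x H.
have small (y : A) n (e : R) : rnorm (y - x) < e ->
    rnorm ((y - x) ** a_ n) < e /\ rnorm (a_ n ** (y - x)) < e.
  move=> yx; split; apply: le_lt_trans yx; apply: le_trans (rnormM _ _) _.
    by rewrite ler_piMr ?rnorm_ge0// aunit_le1.
  by rewrite ler_piMl ?rnorm_ge0// aunit_le1.
split=> e e0; have e3 : 0 < e / 3 by rewrite divr_gt0.
  have [y [yD _] yx] := H _ e3; apply: filterS (yD _ e3) => n ye.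
  have -> : x - x ** a_ n = (y - y ** a_ n) - (y - x) + (y - x) ** a_ n.
    by rewrite smulBl opprB !addrA [RHS](ACl (3*6*1*4*5*2)) /= !addrK.
  apply: le_lt_trans (rnormD _ _) _; have [h1 _] := small y n _ yx.
  by have := rnormD (y - y ** a_ n) (- (y - x)); rewrite rnormN; lra.
have [y [_ yD] yx] := H _ e3; apply: filterS (yD _ e3) => n ye.
have -> : x - a_ n ** x = (y - a_ n ** y) - (y - x) + a_ n ** (y - x).
  by rewrite smulBr opprB !addrA [RHS](ACl (3*6*1*4*5*2)) /= !addrK.
apply: le_lt_trans (rnormD _ _) _; have [_ h1] := small y n _ yx.
by have := rnormD (y - a_ n ** y) (- (y - x)); rewrite rnormN; lra.
Qed.

Definition unit_subalg : cstarSubalg A := CStarSubalg unit_cstar_subalg.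

Lemma unit_set_h : unit_set h.
Proof.
have v : vanish (fun n => h - a_ n ** h).
  move=> e e0.
  have /cvgr0Pnorm_lt/(_ _ e0) := @limn_invS R; apply: filterS => n.
  rewrite ger0_norm// ?invr_ge0// => /(le_lt_trans _); apply.
  have -> : rnorm (h - a_ n ** h) = unorm ((1 - uemb h) ^+ n * uemb h).
    by rewrite -unorm_emb aunit_Q uembB uembM mulrBl mul1r.
  exact: aunit_pow_mul.
split=> //; apply: vanish_eq (vanish_star v) => n.
by rewrite starB starM star_a star_h.
Qed.

Lemma unit_set_aunit n : unit_set (a_ n).
Proof.
have [[D0 DD DZ DM _] _] := unit_cstar_subalg; have Dh := unit_set_h.
elim: n => [|n IH] //=; apply: (DD _ _ (DD _ _ IH Dh)).
by rewrite -scaleN1r; apply: DZ; exact: DM.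
Qed.

Lemma unit_set_sigma_unital : sigma_unital unit_set.
Proof.
pose Q n := (1 - uemb h) ^+ n.
have QC n : cone (Q n).
  apply: coneX; rewrite -[1]scale1r; apply: selfadj_cone; first by case: cone_h.
  by rewrite unorm_emb.
exists (fun n => a_ (2 * n)%N); split.
- by move=> n; split; [exact: unit_set_aunit|exact: aunit_le1].
- by move=> n; apply: cone_positive; exact: aunit_cone.
- move=> n; apply: cone_positive.
  (* The increment is a product of commuting positive elements. *)
  have -> : uemb (a_ (2 * n.+1)%N - a_ (2 * n)%N) = Q (2 * n)%N * uemb (a_ 2).
    rewrite uembB !aunitE mulnS addnC exprD opprB [LHS]addrC addrA subrK.
    by rewrite mulrBr mulr1.
  apply: coneM => //; first exact: aunit_cone.
  apply/commr_sym; apply: commrX; apply: commrB; first exact: commr1.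
  rewrite aunitE; apply/commr_sym; apply: commrB; first exact: commr1.
  exact: aunit_pow_comm.
- move=> b [b1 b2]; split; apply/cvg_rnormP => e e0.
    have [N _ H] := b2 _ e0; exists N => // n /= Nn.
    rewrite -rnormN opprB; apply: H => /=.
    by rewrite (leq_trans Nn)// leq_pmull.
  have [N _ H] := b1 _ e0; exists N => // n /= Nn.
  rewrite -rnormN opprB; apply: H => /=.
  by rewrite (leq_trans Nn)// leq_pmull.
Qed.

Section Invariance.
Context {G : topologicalZmodType} (alpha : cstar_action G A).
Hypothesis h_fixed : forall g, alpha g h = h.

Lemma actN g x : alpha g (- x) = - alpha g x.
Proof. by rewrite -scaleN1r actZ scaleN1r. Qed.

Lemma actB g x y : alpha g (x - y) = alpha g x - alpha g y.
Proof. by rewrite actDr actN. Qed.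

Lemma act_aunit g n : alpha g (a_ n) = a_ n.
Proof.
elim: n => [|n IH] /=; first by have := actB g 0 0; rewrite !subrr.
by rewrite actB actDr actM -/(a_ n) IH h_fixed.
Qed.

Lemma unit_set_invariant : invariant_set alpha unit_set.
Proof.
move=> g x [x1 x2]; split.
  by apply: vanish_le x1 => n; rewrite -{1}(act_aunit g) -actM -actB act_rnorm.
by apply: vanish_le x2 => n; rewrite -{1}(act_aunit g) -actM -actB act_rnorm.
Qed.

End Invariance.
End UnitSubalgebra.

(** * Bounded sequences representing central sequences *)

Section Representatives.
Context {R : realType} {G : topologicalZmodType} {A : cstarAlgType R}.
Variables (alpha : cstar_action G A) (D : cstarSubalg A).
Local Notation F := (Falpha alpha D).
Local Notation inD := (csubalg_set D).
Implicit Types (u v : F) (a b : linf A).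

Lemma eta_vanish (x y : linf A) : eta x = eta y <-> vanish (fun n => linf_seq x n - linf_seq y n).
Proof.
rewrite /eta; split=> [/quot_projP/c0_vanish|H]; first exact: vanish_eq.
by apply/quot_projP/c0_vanish; exact: vanish_eq H.
Qed.

Lemma rep_comm a u d : Falpha_rep a u -> inD d ->
  vanish (fun n => linf_seq a n ** d - d ** linf_seq a n).
Proof.
move=> [x ax _] dD; have /(_ d dD) : commutant_set D (val x) := subalg_mem x.
rewrite -ax /Ainf_cst /eta.
by rewrite -!quot_projM => /eta_vanish; exact: vanish_eq.
Qed.

(** Representatives of one class differ by a sequence annihilating D, hence agree asymptotically
    only after multiplication by some d in D. *)
Lemma rep_uniq a b u d : Falpha_rep a u -> Falpha_rep b u -> inD d ->
  vanish (fun n => (linf_seq a n - linf_seq b n) ** d).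
Proof.
move=> [x ax xu] [y ay yu] dD.
have /quot_projP : quot_proj (ann D) x = quot_proj (ann D) y by exact: etrans xu (esym yu).
move=> /(_ d dD)[+ _].
have -> : val (x - y) = eta (a - b).
  have -> : eta (a - b) = eta a - eta b.
    by apply/eqP; rewrite eq_sym subr_eq /eta -quot_projD subrK.
  by rewrite ax ay.
rewrite /Ainf_cst /eta -quot_projM -quot_proj0 => /eta_vanish H.
by apply: vanish_eq H => n; rewrite subr0.
Qed.

Lemma repD a b u v : Falpha_rep a u -> Falpha_rep b v -> Falpha_rep (a + b) (u + v).
Proof.
move=> [x ax xu] [y ay yu]; exists (x + y); first by rewrite /eta quot_projD; congr (_ + _).
by rewrite /kappa quot_projD -/(kappa x) -/(kappa y) xu yu.
Qed.

Lemma repM a b u v : Falpha_rep a u -> Falpha_rep b v -> Falpha_rep (a ** b) (u ** v).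
Proof.
move=> [x ax xu] [y ay yu]; exists (x ** y); first by rewrite /eta quot_projM; congr (_ ** _).
by rewrite /kappa quot_projM -/(kappa x) -/(kappa y) xu yu.
Qed.

Lemma repZ (c : R[i]) a u : Falpha_rep a u -> Falpha_rep (c *: a) (c *: u).
Proof.
move=> [x ax xu]; exists (c *: x); first by rewrite /eta quot_projZ; congr (_ *: _).
by rewrite /kappa quot_projZ -/(kappa x) xu.
Qed.

Lemma repB a b u v : Falpha_rep a u -> Falpha_rep b v -> Falpha_rep (a - b) (u - v).
Proof. by move=> au bv; rewrite -(scaleN1r b) -(scaleN1r v); apply/repD/repZ. Qed.

Lemma rep_star a u : Falpha_rep a u -> Falpha_rep (star a) (star u).
Proof.
move=> [x ax xu]; exists (star x); first by rewrite /eta quot_proj_star; congr star.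
by rewrite /kappa quot_proj_star -/(kappa x) xu.
Qed.

Lemma rep_exists u : exists2 a, linf_alpha alpha a & Falpha_rep a u.
Proof.
have [x [a la ax] xu] := subalg_mem u.
by exists a => //; exists x.
Qed.

Lemma rep_norm u (M : R) : Falpha_norm u < M ->
  exists2 a, Falpha_rep a u & linf_norm a < M.
Proof.
move=> /inf_lt -/(_ _)[|_ [x xu <-] /inf_lt -/(_ _)[|_ [a ax <-] aM]].
- have [a _ [x ax xu]] := rep_exists u.
  by exists (Ainf_norm (val x)), x.
- by exists (linf_norm (quot_repr (val x))), (quot_repr (val x)) => //; exact: quot_reprK.
by exists a => //; exists x.
Qed.

(** [Falpha_act] provides some pair of representatives. Changing the first one is done against
    alpha_(-g) d, which is in D by invariance, and then transported by the isometry alpha_g. *)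
Lemma rep_act g a b u v d : invariant_set alpha inD -> inD d ->
  Falpha_act g u v -> Falpha_rep a u -> Falpha_rep b v ->
  vanish (fun n => (alpha g (linf_seq a n) - linf_seq b n) ** d).
Proof.
move=> iD dD [a' [b' [_ au' bv' bE]]] au bv.
have h1 := rep_uniq au au' (iD (- g) d dD); have h2 := rep_uniq bv' bv dD.
apply: (@vanish_eq _ _ _ (fun n => (alpha g (linf_seq a n) - linf_seq b' n) ** d +
   (linf_seq b' n - linf_seq b n) ** d)).
  by move=> n; rewrite -smulDl addrA subrK.
apply: vanishD => //; apply: vanish_le h1 => n.
have -> : (alpha g (linf_seq a n) - linf_seq b' n) ** d =
    alpha g ((linf_seq a n - linf_seq a' n) ** alpha (- g) d).
  by rewrite actM actB -actD subrr act0 bE.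
by rewrite act_rnorm.
Qed.

Lemma rep0 : Falpha_rep (0 : linf A) (0 : F).
Proof. by have [a _ /(repZ 0)] := rep_exists (0 : F); rewrite !scale0r. Qed.

Lemma rep_sum n (a : 'I_n -> linf A) (u : 'I_n -> F) :
  (forall i, Falpha_rep (a i) (u i)) -> Falpha_rep (\sum_i a i) (\sum_i u i).
Proof. by move=> au; apply: big_ind2 => //; [exact: rep0|move=> *; exact: repD]. Qed.

End Representatives.

Section RepresentativesUnit.
Context {R : realType} {G : topologicalZmodType} {A : cstarAlgType R}.
Variables (alpha : cstar_action G A) (h : A).
Hypothesis cone_h : cone (uemb h).
Hypothesis h_le1 : rnorm h <= 1.
Hypothesis h_fixed : forall g, alpha g h = h.
Let D := unit_subalg cone_h h_le1.

(* The approximate unit of D represents the unit of Falpha alpha D. *)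
Lemma rep_unit (e : linf A) (E : Falpha alpha D) : is_unit_elt E -> Falpha_rep e E ->
  vanish (fun n => linf_seq e n ** h - h).
Proof.
move=> uE eE; have [h1 h2] := unit_set_h cone_h h_le1.
have bu : linf_set (aunit h) by exists 1 => n; exact: aunit_le1.
pose w : linf A := Subalg (S := StarSubalg (@linf_star_subalg R A)) bu.
have wc : commutant_set D (eta w).
  move=> d [d1 d2]; rewrite /Ainf_cst /eta -!quot_projM; apply/eta_vanish.
  apply: vanish_eq (vanishB d1 d2) => n.
  by rewrite opprB [RHS]addrC addrA subrK.
have wl : linf_alpha alpha w.
  exists (fun=> w).
    by move=> g n; rewrite -[linf_seq w n]/(aunit h n) act_aunit.
  move=> g0 e0 e00; apply: nearW => g; rewrite subrr; apply: le_lt_trans e00.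
  by apply: linf_norm_le => n; rewrite rnorm0.
pose x : subalg (commutant D) := Subalg (S := commutant D) wc.
have xF : @Falpha_set _ _ _ alpha D (kappa x) by exists x => //; exists w.
pose W : Falpha alpha D := Subalg (S := StarSubalg (@Falpha_star_subalg _ _ _ alpha D)) xF.
have wW : Falpha_rep w W by exists x.
(* From E W = W one gets e_n u_n h close to u_n h, where u_n is the approximate unit; moreover u_n h
   tends to h and (e_n) is bounded. *)
have [EW _] := uE W; have := repM eE wW; rewrite EW => ewW.
have hD : csubalg_set D h by exact: unit_set_h.
have v := rep_uniq ewW wW hD.
have v2 := vanish_mull (bounded_linf e) h2.
apply: vanish_eq (vanishB (vanishD v2 v) h2) => n.
rewrite -[linf_seq (e ** w) n]/(linf_seq e n ** aunit h n) -[linf_seq w n]/(aunit h n).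
by rewrite smulBr smulBl smulA addrA subrK opprB addrA subrK.
Qed.

End RepresentativesUnit.

(** * Order zero maps *)

Section RealFunctions.
Context {R : realType} {G : topologicalZmodType}.
Implicit Types u v p f : G -> R.

Lemma real_cont u : continuous u -> cont_set (fun g => (u g)%:C : R[i]^o).
Proof.
move=> cu g; apply/cvg_rnormP => e e0; have /cvgrPdist_lt/(_ e e0) := cu g.
by apply: filterS => t; rewrite distrC -rmorphB rnorm_real.
Qed.

(* Junk value 0 for a discontinuous u. *)
Definition cfun u : contG R G :=
  match pselect (continuous u) with
  | left cu => Subalg (S := StarSubalg (@cont_star_subalg R G)) (real_cont cu)
  | right _ => 0
  end.

Lemma cfunE u g : continuous u -> contG_fun (cfun u) g = (u g)%:C.
Proof. by move=> cu; rewrite /cfun; case: pselect. Qed.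

Lemma contG_eq (f1 f2 : contG R G) : (forall g, contG_fun f1 g = contG_fun f2 g) -> f1 = f2.
Proof. by move=> H; apply: val_inj; apply/funext. Qed.

Lemma contG_funD (f1 f2 : contG R G) g :
  contG_fun (f1 + f2) g = contG_fun f1 g + contG_fun f2 g.
Proof. by []. Qed.

Lemma contG_funZ (c : R[i]) (f1 : contG R G) g :
  contG_fun (c *: f1) g = c * contG_fun f1 g.
Proof. by []. Qed.

Lemma contD u v : continuous u -> continuous v -> continuous (fun g => u g + v g).
Proof. by move=> cu cv g; apply: cvgD; [exact: cu|exact: cv]. Qed.
Lemma contB u v : continuous u -> continuous v -> continuous (fun g => u g - v g).
Proof. by move=> cu cv g; apply: cvgB; [exact: cu|exact: cv]. Qed.
Lemma contM u v : continuous u -> continuous v -> continuous (fun g => u g * v g).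
Proof. by move=> cu cv g; apply: cvgM; [exact: cu|exact: cv]. Qed.
Lemma contC (c : R) : continuous (fun _ : G => c).
Proof. by move=> g; exact: cvg_cst. Qed.
Lemma contN u : continuous u -> continuous (fun g => `|u g|).
Proof. by move=> cu g; apply: cvg_norm; exact: cu. Qed.

Lemma cont_sum (I : Type) (r : seq I) (P : pred I) (F : I -> G -> R) :
  (forall i, continuous (F i)) -> continuous (fun g => \sum_(i <- r | P i) F i g).
Proof.
move=> cF; elim: r => [|i r IH].
  by under eq_fun do rewrite big_nil; exact: contC.
under eq_fun do rewrite big_cons; case: (P i) => //.
by apply: contD.
Qed.

Lemma cfunD u v : continuous u -> continuous v ->
  cfun (fun g => u g + v g) = cfun u + cfun v.
Proof.
move=> cu cv; apply: contG_eq => g.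
rewrite cfunE; last exact: contD.
by rewrite -[RHS]/(contG_fun _ g + contG_fun _ g) !cfunE// rmorphD.
Qed.

Lemma cfunZ (c : R) u : continuous u -> cfun (fun g => c * u g) = c%:C *: cfun u.
Proof.
move=> cu; apply: contG_eq => g.
rewrite cfunE; last by apply: contM => //; exact: contC.
by rewrite -[RHS]/(c%:C * contG_fun _ g) cfunE// rmorphM.
Qed.

Lemma cfunM u v : continuous u -> continuous v ->
  cfun u ** cfun v = cfun (fun g => u g * v g).
Proof.
move=> cu cv; apply: contG_eq => g.
rewrite cfunE; last exact: contM.
by rewrite -[LHS]/(contG_fun _ g * contG_fun _ g) !cfunE// rmorphM.
Qed.

Lemma cfun1 : cfun (fun=> 1) = contG_one.
Proof. by apply: contG_eq => g; rewrite cfunE//; exact: contC. Qed.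

Lemma cfun0 : cfun (fun=> 0) = 0.
Proof. by apply: contG_eq => g; rewrite cfunE//; exact: contC. Qed.

Lemma cfun_positive u : continuous u -> (forall g, 0 <= u g) -> positive (cfun u).
Proof.
move=> cu u0; have cs : continuous (fun g => Num.sqrt (u g)).
  by move=> g; apply: (@continuous_comp _ _ _ u Num.sqrt); [exact: cu|exact: sqrt_continuous].
exists (cfun (fun g => Num.sqrt (u g))).
have -> : star (cfun (fun g => Num.sqrt (u g))) = cfun (fun g => Num.sqrt (u g)).
  apply: contG_eq => g; rewrite -[LHS]/(Num.conj (contG_fun _ g)) cfunE//.
  exact: conjc_real.
by rewrite cfunM//; congr cfun; apply/funext => g; rewrite -expr2 sqr_sqrtr.
Qed.

Lemma cfun_norm u (M : R) : continuous u -> (forall g, `|u g| <= M) ->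
  contG_norm (cfun u) <= M.
Proof.
move=> cu uM; apply: ge_sup; first by exists (rnorm (contG_fun (cfun u) 0)), 0.
by move=> _ [g _ <-]; rewrite cfunE// rnorm_real.
Qed.

(** This is min(1, max(0, s)), written so that continuity follows from that of the absolute
    value. *)
Definition clamp (s : R) : R := (1 + `|s| - `|s - 1|) / 2.

Lemma clampP s : [/\ 0 <= clamp s <= 1, s <= 0 -> clamp s = 0, 1 <= s -> clamp s = 1
  & 0 <= s <= 1 -> clamp s = s].
Proof.
rewrite /clamp; have [s0|s0] := ger0P s; have [s1|s1] := ger0P (s - 1);
  by split; [apply/andP; split; lra|move=> ?; lra|move=> ?; lra|move=> /andP[]; lra].
Qed.

Lemma clamp_homo s t : s <= t -> clamp s <= clamp t.
Proof.
rewrite /clamp => st; have [s0|s0] := ger0P s; have [s1|s1] := ger0P (s - 1);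
have [t0|t0] := ger0P t; have [t1|t1] := ger0P (t - 1); lra.
Qed.

Lemma clamp_sum m s : 0 <= s <= m%:R -> \sum_(i < m) clamp (s - i%:R) = s.
Proof.
elim: m => [|m IH] in s *; first by rewrite big_ord0 => ?; lra.
rewrite -natr1 => /andP[s0 sm]; rewrite big_ord_recr /=.
have [sm'|sm'] := leP s m%:R.
  rewrite IH ?s0//; have [_ -> //] := clampP (s - m%:R); rewrite ?addr0//; lra.
have -> : \sum_(i < m) clamp (s - i%:R) = m%:R.
  rewrite (eq_bigr (fun=> 1)) ?sumr_const ?card_ord// => i _.
  have [_ _ -> //] := clampP (s - i%:R).
  have : (i%:R : R) + 1 <= m%:R by rewrite natr1 ler_nat.
  by lra.
by have [_ _ _ -> //] := clampP (s - m%:R); lra.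
Qed.

End RealFunctions.

Section OrderZero.
Context {R : realType} {G : topologicalZmodType} {A : cstarAlgType R}.
Variables (alpha : cstar_action G A) (D : cstarSubalg A).
Local Notation F := (Falpha alpha D).
Implicit Types (x y z : F) (u v p f : G -> R).

(** A norm bound carried by a representative, so that estimates for sums and products come directly
    from bounded sequences. Accordingly [null] means seminorm zero. *)
Definition rep_le x (M : R) : Prop := exists2 a, Falpha_rep a x & linf_norm a <= M.

Definition null x : Prop := forall M : R, 0 < M -> rep_le x M.

Lemma rep_leD x y (M N : R) : rep_le x M -> rep_le y N -> rep_le (x + y) (M + N).
Proof.
move=> [a ax aM] [b by_ bN]; exists (a + b); first exact: repD.
by apply: le_trans (linf_normD _ _) _; exact: lerD.
Qed.

Lemma rep_leM x y (M N : R) : rep_le x M -> rep_le y N -> rep_le (x ** y) (M * N).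
Proof.
move=> [a ax aM] [b by_ bN]; exists (a ** b); first exact: repM.
by apply: le_trans (linf_normM _ _) _; rewrite ler_pM ?linf_norm_ge0.
Qed.

Lemma rep_leZ (c : R[i]) x (M : R) : rep_le x M ->
  rep_le (c *: x) (rnorm (c : R[i]^o) * M).
Proof.
move=> [a ax aM]; exists (c *: a); first exact: repZ.
by apply: le_trans (linf_normZ _ _) _; rewrite ler_wpM2l ?rnorm_ge0.
Qed.

Lemma rep_le_sum n (x : 'I_n -> F) (M : R) : (forall i, rep_le (x i) M) ->
  rep_le (\sum_i x i) (M *+ n).
Proof.
elim: n x => [|n IH] x xM.
  rewrite big_ord0; have [a _ aP] := rep_exists (0 : F).
  exists 0; first by have := repZ 0 aP; rewrite !scale0r.
  by rewrite mulr0n; apply: linf_norm_le => k; rewrite rnorm0.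
by rewrite big_ord_recr /= mulrSr; apply: rep_leD => //; exact: IH.
Qed.

Lemma rep_le_mono x (M N : R) : M <= N -> rep_le x M -> rep_le x N.
Proof. by move=> MN [a ax aM]; exists a => //; exact: le_trans MN. Qed.

Lemma nullD x y : null x -> null y -> null (x + y).
Proof.
move=> nx ny M M0; rewrite [M]splitr.
by apply: rep_leD; [apply: nx|apply: ny]; rewrite divr_gt0.
Qed.

Lemma nullZ (c : R[i]) x : null x -> null (c *: x).
Proof.
move=> nx M M0; set K := rnorm (c : R[i]^o).
have K1 : 0 < K + 1 by rewrite ltr_wpDl ?rnorm_ge0.
apply: (rep_le_mono _ (rep_leZ c (nx _ (divr_gt0 M0 K1)))).
rewrite -/K mulrCA -[leRHS]mulr1 ler_pM2l// ler_pdivrMr// mul1r.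
by rewrite lerDl.
Qed.

Lemma null_vanish a x d : null x -> Falpha_rep a x -> csubalg_set D d ->
  vanish (fun n => linf_seq a n ** d).
Proof.
move=> nx ax dD e e0; have d1 : 0 < rnorm d + 1 by rewrite ltr_wpDl ?rnorm_ge0.
have e2 : 0 < e / 2 by rewrite divr_gt0.
have [b bx bM] := nx _ (divr_gt0 e2 d1).
apply: filterS (rep_uniq ax bx dD e2) => n ab.
have -> : linf_seq a n ** d = (linf_seq a n - linf_seq b n) ** d + linf_seq b n ** d.
  by rewrite -smulDl subrK.
rewrite (le_lt_trans (rnormD _ _))// [ltRHS](splitr e) ltr_leD//.
apply: le_trans (rnormM _ _) _.
have bn : rnorm (linf_seq b n) <= e / 2 / (rnorm d + 1) := le_trans (linf_norm_ub _ _) bM.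
apply: le_trans (ler_wpM2r (rnorm_ge0 d) bn) _.
by rewrite mulrAC ler_pdivrMr// ler_pM2l// lerDl.
Qed.

Variable phi : {linear contG R G -> F}.
Hypothesis phi_cpc : cpc_order_zero (@contG_norm R G) (@Falpha_norm R G A alpha D) phi.

Let psi u : F := phi (cfun u).

Let psiD u v : continuous u -> continuous v -> psi (fun g => u g + v g) = psi u + psi v.
Proof. by move=> cu cv; rewrite /psi cfunD// linearD. Qed.

Let psiZ (c : R) u : continuous u -> psi (fun g => c * u g) = c%:C *: psi u.
Proof. by move=> cu; rewrite /psi cfunZ// linearZ. Qed.

Let psi_sum (I : Type) (r : seq I) (P : pred I) (f : I -> G -> R) :
  (forall i, continuous (f i)) ->
  psi (fun g => \sum_(i <- r | P i) f i g) = \sum_(i <- r | P i) psi (f i).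
Proof.
move=> cf; elim: r => [|i r IH].
  rewrite big_nil /psi (_ : (fun _ => _) = fun=> 0) ?cfun0 ?linear0//.
  by apply/funext => g; rewrite big_nil.
rewrite big_cons -IH; case: ifP => Pi; last first.
  by congr psi; apply/funext => g; rewrite big_cons Pi.
rewrite -psiD//; last exact: cont_sum.
by congr psi; apply/funext => g; rewrite big_cons Pi.
Qed.

Let psi_orth u v : continuous u -> continuous v -> (forall g, 0 <= u g) ->
  (forall g, 0 <= v g) -> (forall g, u g * v g = 0) -> psi u ** psi v = 0.
Proof.
move=> cu cv u0 v0 uv; have [_ _ oz] := phi_cpc; apply: oz; try exact: cfun_positive.
by rewrite cfunM// -cfun0; congr cfun; apply/funext.
Qed.

(** The slack 1 makes the norm inequality strict, which yields a representative of norm at most M +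
    1. *)
Let psi_le u (M : R) : continuous u -> (forall g, `|u g| <= M) -> rep_le (psi u) (M + 1).
Proof.
move=> cu uM; have [_ con _] := phi_cpc.
have [|a ax aM] := @rep_norm _ _ _ alpha D (psi u) (M + 1); last by exists a => //; exact: ltW.
apply: le_lt_trans (con _) _; apply: le_lt_trans (cfun_norm cu uM) _.
by rewrite ltrDl.
Qed.

Let psi_star0 u : continuous u -> (forall g, 0 <= u g) -> star (psi u) = psi u.
Proof.
move=> cu u0; have [cp _ _] := phi_cpc; have [y yE] := cfun_positive cu u0.
have /(cp 1%N)[Y /matrixP/(_ 0 0)] : mx_positive (\matrix_(i < 1, j < 1) cfun u).
  exists (\matrix_(i, j) y); apply/matrixP => i j; rewrite !mxE big_ord1 !mxE.
  exact: yE.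
by rewrite !mxE big_ord1 /psi => ->; rewrite starM starK.
Qed.

(* m p is the sum of the layers C 1, ..., C m of p.  As phi has order zero, only
   neighbouring differences theta of layers interact, so the m commutation
   defects add up to a quantity bounded independently of m. *)
Section Layers.
Variables (p f : G -> R) (K : R) (m : nat).
Hypothesis p_cont : continuous p.
Hypothesis f_cont : continuous f.
Hypothesis p01 : forall g, 0 <= p g <= 1.
Hypothesis fK : forall g, 0 <= f g <= K.

(** The slice of m p between heights k - 1 and k; layer 0 is constantly 1. Wherever one layer is
    nonzero, all earlier ones equal 1. *)
Let C (k : nat) g : R := clamp (m%:R * p g + 1 - k%:R).
Let theta k g : R := C k g - C k.+1 g.

Let C_cont k : continuous (C k).
Proof.
have cs : continuous (fun g => m%:R * p g + 1 - k%:R).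
  by apply: contB; [apply: contD; [apply: contM|]|] => //; exact: contC.
apply: contM; last exact: contC.
apply: contB; first by apply: contD; [exact: contC|exact: contN].
by apply: contN; apply: contB => //; exact: contC.
Qed.

Let theta_cont k : continuous (theta k).
Proof. by apply: contB. Qed.

Let C01 k g : 0 <= C k g <= 1. Proof. by case: (clampP (m%:R * p g + 1 - k%:R)). Qed.

Let C_homo j k g : (j <= k)%N -> C k g <= C j g.
Proof. by move=> jk; apply: clamp_homo; rewrite lerD2l lerN2 ler_nat. Qed.

Let C_orth j k g : (j < k)%N -> C k g = 0 \/ C j g = 1.
Proof.
move=> jk; have [_ z _ _] := clampP (m%:R * p g + 1 - k%:R).
have [_ _ o _] := clampP (m%:R * p g + 1 - j%:R).
have [s|s] := leP (m%:R * p g + 1 - k%:R) 0; first by left; exact: z.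
right; apply: o.
have : (j%:R : R) + 1 <= k%:R by rewrite natr1 ler_nat.
by lra.
Qed.

Let theta_ge0 k g : 0 <= theta k g. Proof. by rewrite subr_ge0 C_homo. Qed.

Let theta_orth j k g : (j.+1 < k)%N -> theta j g * theta k g = 0.
Proof.
move=> jk; have [k0|j1] := C_orth g jk.
  have := theta_ge0 k g; have := C01 k.+1 g; rewrite /theta k0 => h1 h2.
  have -> : C k.+1 g = 0 by lra.
  by rewrite subr0 mulr0.
by have := C01 j g; have := @C_homo j j.+1 g (leqnSn j); rewrite /theta j1 => h1 h2;
  have -> : C j g = 1 by [lra]; rewrite subrr mul0r.
Qed.

Let one_sub_cont k : continuous (fun g => 1 - C k g).
Proof. by apply: contB => //; exact: contC. Qed.

Let mulf_cont u : continuous u -> continuous (fun g => u g * f g).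
Proof. by move=> cu; exact: contM. Qed.

Let f0 g : 0 <= f g. Proof. by case/andP: (fK g). Qed.

Let psi_f_add u v : continuous u -> continuous v ->
  psi (fun g => (u g + v g) * f g) = psi (fun g => u g * f g) + psi (fun g => v g * f g).
Proof.
move=> cu cv; rewrite -psiD; try exact: mulf_cont.
by congr psi; apply/funext => g; rewrite mulrDl.
Qed.

Let split_C k : C k = fun g => theta k g + C k.+1 g.
Proof. by apply/funext => g; rewrite subrK. Qed.

Let split_1C k : (fun g => 1 - C k.+1 g) = fun g => theta k g + (1 - C k g).
Proof. by apply/funext => g; rewrite /theta; ring. Qed.

(** With C = C_(k+1), split f into C f and (1 - C) f, and 1 into C and 1 - C. The common term psi(C)
    psi(C f) cancels. In the two remaining products order zero removes every pair of functions with
    disjoint supports, leaving the neighbours theta_k and theta_(k+1). *)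
Let layer k : psi (C k.+1) ** psi f - psi (fun=> 1) ** psi (fun g => C k.+1 g * f g) =
  psi (theta k.+1) ** psi (fun g => theta k g * f g) -
  psi (theta k) ** psi (fun g => theta k.+1 g * f g).
Proof.
have c1 : forall j, continuous (C j) by exact: C_cont.
have c2 := one_sub_cont.
have o j g : 0 <= 1 - C j g by have := C01 j g; lra.
have Cp j g : 0 <= C j g by case/andP: (C01 j g).
have orth j l (u v : G -> R) : (j < l)%N -> continuous u -> continuous v ->
    (forall g, 0 <= u g <= C l g) -> (forall g, 0 <= v g <= 1 - C j g) ->
    psi u ** psi (fun g => v g * f g) = 0 /\ psi v ** psi (fun g => u g * f g) = 0.
  move=> jl cu cv uC vC.
  have uv g : u g * v g = 0.
    have [l0|j1] := C_orth g jl.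
      by have := uC g; rewrite l0 => h; have -> : u g = 0 by [lra]; rewrite mul0r.
    by have := vC g; rewrite j1 => h; have -> : v g = 0 by [lra]; rewrite mulr0.
  split; apply: psi_orth => //; try exact: mulf_cont.
  - by move=> g; case/andP: (uC g).
  - by move=> g; rewrite mulr_ge0//; case/andP: (vC g).
  - by move=> g; rewrite mulrA uv mul0r.
  - by move=> g; case/andP: (vC g).
  - by move=> g; rewrite mulr_ge0//; case/andP: (uC g).
  - by move=> g; rewrite mulrA (mulrC (v g)) uv mul0r.
have tC j g : 0 <= theta j g <= C j g.
  by rewrite theta_ge0 /theta lerBlDr lerDl Cp.
have t1C j g : 0 <= theta j g <= 1 - C j.+1 g.
  by rewrite theta_ge0 /theta; have := C01 j g; lra.
have -> : psi f = psi (fun g => C k.+1 g * f g) + psi (fun g => (1 - C k.+1 g) * f g).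
  rewrite -psi_f_add//; congr psi; apply/funext => g.
  by rewrite addrC subrK mul1r.
have -> : psi (fun=> 1) = psi (C k.+1) + psi (fun g => 1 - C k.+1 g).
  by rewrite -psiD//; congr psi; apply/funext => g; rewrite addrC subrK.
rewrite smulDr smulDl opprD addrACA subrr add0r; congr (_ - _).
  have -> : psi (fun g => (1 - C k.+1 g) * f g) =
      psi (fun g => theta k g * f g) + psi (fun g => (1 - C k g) * f g).
    by rewrite -psi_f_add//; congr psi; apply/funext => g; rewrite /theta; ring.
  rewrite smulDr (orth k k.+1 (C k.+1) (fun g => 1 - C k g) _ _ _ _ _).1 ?addr0//; first last.
  - by move=> g; rewrite o lexx.
  - by move=> g; rewrite Cp lexx.
  rewrite [in psi (C k.+1)]split_C psiD// smulDl.
  by rewrite (orth k.+1 k.+2 (C k.+2) (theta k) _ _ _ _ _).1 ?addr0// => g; rewrite Cp lexx.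
have -> : psi (fun g => 1 - C k.+1 g) = psi (theta k) + psi (fun g => 1 - C k g).
  by rewrite -psiD//; congr psi; exact: split_1C.
rewrite smulDl (orth k k.+1 (C k.+1) (fun g => 1 - C k g) _ _ _ _ _).2 ?addr0//; first last.
- by move=> g; rewrite o lexx.
- by move=> g; rewrite Cp lexx.
have -> : psi (fun g => C k.+1 g * f g) =
    psi (fun g => theta k.+1 g * f g) + psi (fun g => C k.+2 g * f g).
  by rewrite -psi_f_add//; congr psi; apply/funext => g; rewrite /theta; ring.
rewrite smulDr (orth k.+1 k.+2 (C k.+2) (theta k) _ _ _ _ _).2 ?addr0//.
by move=> g; rewrite Cp lexx.
Qed.

Let cls (r : 'I_3) : pred 'I_m := fun i => (i %% 3 == r)%N.

Let smul_sum (I J : Type) (r : seq I) (t : seq J) (P : pred I) (Q : pred J)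
    (x : I -> F) (y : J -> F) :
  (\sum_(i <- r | P i) x i) ** (\sum_(j <- t | Q j) y j) =
  \sum_(i <- r | P i) \sum_(j <- t | Q j) x i ** y j.
Proof.
rewrite (@big_morph _ _ (fun z : F => z ** (\sum_(j <- t | Q j) y j)) 0 +%R 0 +%R); first last.
- exact: smul0r.
- by move=> ? ?; exact: smulDl.
apply: eq_bigr => i _.
rewrite (@big_morph _ _ (fun z : F => x i ** z) 0 +%R 0 +%R)//.
- by move=> ? ?; exact: smulDr.
- exact: smulr0.
Qed.

(* Indices in one class modulo 3 are too far apart to interact. *)
Let class_sum (r : 'I_3) (a b : nat) : (a <= b.+1)%N -> (b <= a.+1)%N ->
  \sum_(i < m | cls r i) psi (theta (i + a)%N) ** psi (fun g => theta (i + b)%N g * f g) =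
  psi (fun g => \sum_(i < m | cls r i) theta (i + a)%N g) **
  psi (fun g => \sum_(i < m | cls r i) theta (i + b)%N g * f g).
Proof.
move=> ab ba.
rewrite (psi_sum _ _ (f := fun (i : 'I_m) g => theta (i + a)%N g))//.
rewrite (psi_sum _ _ (f := fun (i : 'I_m) g => theta (i + b)%N g * f g)); last first.
  by move=> i; exact: mulf_cont.
rewrite smul_sum; apply: eq_bigr => i ir; rewrite (bigD1 i)//= big1 ?addr0// => j /andP[jr ji].
apply: psi_orth => //; first exact: mulf_cont.
- by move=> g; rewrite mulr_ge0.
move=> g; rewrite mulrA.
(* Distinct indices in a class differ by at least 3 and a, b by at most 1, so the shifted indices
   differ by at least 2. *)
have ij : ((i + a).+1 < j + b)%N \/ ((j + b).+1 < i + a)%N.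
  move: ir jr ji; rewrite /cls => /eqP ir /eqP jr; rewrite -val_eqE /= => /eqP ji.
  by lia.
case: ij => ij; first by rewrite theta_orth// mul0r.
by rewrite (mulrC (theta (i + a)%N g)) theta_orth// mul0r.
Qed.

Let theta_sum_le (r : 'I_3) (a : nat) g :
  0 <= \sum_(i < m | cls r i) theta (i + a)%N g <= 1.
Proof.
apply/andP; split; first by apply: sumr_ge0.
apply: (@le_trans _ _ (\sum_(i < m) theta (i + a)%N g)).
  by rewrite [leRHS](bigID (cls r))/= lerDl sumr_ge0.
have -> : \sum_(i < m) theta (i + a)%N g = C a g - C (m + a)%N g.
  elim: m => [|k IH]; first by rewrite big_ord0 add0n subrr.
  by rewrite big_ord_recr /= IH /theta addSn addrA subrK.
by have := C01 a g; have := C01 (m + a)%N g; lra.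
Qed.

Let K0 : 0 <= K. Proof. by have := fK 0; lra. Qed.

(** The class sum is a single product of images of functions bounded by 1 and K; the telescoping
    bound on the thetas makes this independent of m. *)
Let class_rep (r : 'I_3) (a b : nat) : (a <= b.+1)%N -> (b <= a.+1)%N ->
  rep_le (\sum_(i < m | cls r i)
    psi (theta (i + a)%N) ** psi (fun g => theta (i + b)%N g * f g)) (2 * (K + 1)).
Proof.
move=> ab ba; rewrite class_sum//; apply: rep_leM.
  rewrite -[2]/(1 + 1); apply: psi_le => [|g]; first exact: cont_sum.
  by have := theta_sum_le r a g => /andP[h1 h2]; rewrite ger0_norm.
apply: psi_le => [|g]; first by apply: cont_sum => i; exact: mulf_cont.
have /andP[h1 h2] := theta_sum_le r b g; have /andP[f1 f2] := fK g.
rewrite -mulr_suml ger0_norm ?mulr_ge0//.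
by rewrite -[leRHS]mul1r ler_pM.
Qed.

Let total_rep (a b : nat) : (a <= b.+1)%N -> (b <= a.+1)%N ->
  rep_le (\sum_(i < m)
    psi (theta (i + a)%N) ** psi (fun g => theta (i + b)%N g * f g)) (2 * (K + 1) *+ 3).
Proof.
move=> ab ba.
rewrite (partition_big (fun i : 'I_m => Ordinal (ltn_pmod i (isT : 0 < 3)%N)) predT)//=.
by apply: rep_le_sum => r; exact: class_rep.
Qed.

(** Two sums of three classes, each bounded by 2 (K + 1), give 12 (K + 1) for m p; division by m
    returns to p. *)
Lemma layers_rep : (0 < m)%N ->
  rep_le (psi p ** psi f - psi (fun=> 1) ** psi (fun g => p g * f g))
    (12 * (K + 1) / m%:R).
Proof.
move=> m0; have m0' : 0 < m%:R :> R by rewrite ltr0n.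
have Csum g : \sum_(i < m) C i.+1 g = m%:R * p g.
  rewrite -[RHS](@clamp_sum _ m).
    by apply: eq_bigr => i _; rewrite /C -natr1; congr clamp; ring.
  have /andP[p0 p1] := p01 g.
  by rewrite mulr_ge0// -[leRHS]mulr1 ler_pM2l.
have pE : m%:R%:C *: psi p = \sum_(i < m) psi (C i.+1).
  rewrite -psiZ// -(psi_sum _ _ (f := fun (i : 'I_m) => C i.+1))//.
  by congr psi; apply/funext => g; rewrite Csum.
have pfE : m%:R%:C *: psi (fun g => p g * f g) = \sum_(i < m) psi (fun g => C i.+1 g * f g).
  rewrite -psiZ; last exact: mulf_cont.
  rewrite -(psi_sum _ _ (f := fun (i : 'I_m) g => C i.+1 g * f g)); last first.
    by move=> i; exact: mulf_cont.
  by congr psi; apply/funext => g; rewrite -mulr_suml Csum mulrA.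
have -> : psi p ** psi f - psi (fun=> 1) ** psi (fun g => p g * f g) =
    (m%:R^-1)%:C *: (\sum_(i < m) psi (theta (i + 1)%N) ** psi (fun g => theta (i + 0)%N g * f g) -
     \sum_(i < m) psi (theta (i + 0)%N) ** psi (fun g => theta (i + 1)%N g * f g)).
  rewrite -sumrB (eq_bigr (fun i : 'I_m => psi (C i.+1) ** psi f -
      psi (fun=> 1) ** psi (fun g => C i.+1 g * f g))); last first.
    by move=> i _; rewrite addn1 addn0 layer.
  rewrite sumrB.
  have -> : \sum_(i < m) psi (C i.+1) ** psi f = m%:R%:C *: psi p ** psi f.
    rewrite pE (@big_morph _ _ (fun z : F => z ** psi f) 0 +%R 0 +%R)//.
    - by move=> ? ?; exact: smulDl.
    - exact: smul0r.
  have -> : \sum_(i < m) psi (fun=> 1) ** psi (fun g => C i.+1 g * f g) =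
      psi (fun=> 1) ** (m%:R%:C *: psi (fun g => p g * f g)).
    rewrite pfE (@big_morph _ _ (fun z : F => psi (fun=> 1) ** z) 0 +%R 0 +%R)//.
    - by move=> ? ?; exact: smulDr.
    - exact: smulr0.
  rewrite scale_smull scale_smulr -scalerBr scalerA -rmorphM mulVf ?gt_eqF//.
  by rewrite scale1r.
have h1 := total_rep (leqnn 1) (leq0n 2); have h2 := total_rep (leq0n 2) (leqnn 1).
have := rep_leZ (m%:R^-1)%:C (rep_leD h1 (rep_leZ (-1) h2)).
rewrite scaleN1r; apply: rep_le_mono.
have -> : rnorm (-1 : R[i]^o) = 1 by rewrite rnormN -[1]/((1 : R)%:C) rnorm_real normr1.
rewrite rnorm_real ger0_norm ?invr_ge0//.
by rewrite mulrC ler_pM2r ?invr_gt0//; lra.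
Qed.

End Layers.

Let E u v : F := psi u ** psi v - psi (fun=> 1) ** psi (fun g => u g * v g).

Let E_null0 u v (K : R) : continuous u -> continuous v ->
  (forall g, 0 <= u g <= 1) -> (forall g, 0 <= v g <= K) -> null (E u v).
Proof.
move=> cu cv u01 vK M M0; have K0 : 0 <= K by have := vK 0; lra.
have h0 : 0 <= 12 * (K + 1) / M by apply: divr_ge0; [lra|exact: ltW].
have := archi_boundP h0; set m := Num.bound _ => hm.
have m0 : 0 < m%:R :> R.
  exact: le_lt_trans hm.
have m0' : (0 < m)%N by rewrite -(ltr0n R).
apply: rep_le_mono (layers_rep cu cv u01 vK m0').
by rewrite ler_pdivrMr// [leRHS]mulrC; move: hm; rewrite ltr_pdivrMr// => /ltW.
Qed.

(** Real functions are reduced to nonnegative ones by q = (u + 1)/2 and w = v + 1. The defect [E] is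
    bilinear and vanishes when its first argument is the constant 1. *)
Let E_null u v : continuous u -> continuous v ->
  (forall g, `|u g| <= 1) -> (forall g, `|v g| <= 1) -> null (E u v).
Proof.
move=> cu cv u1 v1.
have c1 : continuous (fun _ : G => 1 : R) by exact: contC.
pose q g := 2^-1 * (u g + 1); pose w g := v g + 1.
have cw : continuous w by exact: contD.
have cq : continuous q by apply: contM; [exact: contC|exact: contD].
have q01 g : 0 <= q g <= 1 by have := u1 g; rewrite /q ler_norml; lra.
have w2 g : 0 <= w g <= 2 by have := v1 g; rewrite /w ler_norml; lra.
have Eqv : E q v = E q w + (-1) *: E q (fun=> 1).
  have -> : E q w = psi q ** psi w - psi (fun=> 1) ** (psi (fun g => q g * v g) + psi q).
    by rewrite -psiD//; [congr (_ - _ ** psi _); apply/funext => g; rewrite /w; ring|exact: contM].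
  have -> : E q (fun=> 1) = psi q ** psi (fun=> 1) - psi (fun=> 1) ** psi q.
    by congr (_ - _ ** psi _); apply/funext => g; rewrite mulr1.
  have -> : E q v = psi q ** psi v - psi (fun=> 1) ** psi (fun g => q g * v g) by [].
  have -> : psi v = psi w - psi (fun=> 1) by rewrite /w psiD// addrK.
  rewrite scaleN1r smulBr smulDr opprB opprD !addrA.
  by rewrite [RHS](ACl (1*5*2*4*3)) /= addrK [RHS]addrC [LHS]addrC.
have Euv : E u v = (2 : R)%:C *: E q v.
  have uE : psi u = (2 : R)%:C *: psi q - psi (fun=> 1).
    rewrite -psiZ//; apply/eqP; rewrite eq_sym subr_eq -psiD//; apply/eqP.
    by congr psi; apply/funext => g; rewrite /q; field.
  have uvE : psi (fun g => u g * v g) = (2 : R)%:C *: psi (fun g => q g * v g) - psi v.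
    rewrite -psiZ; last exact: contM.
    apply/eqP; rewrite eq_sym subr_eq -psiD//; last exact: contM.
    by apply/eqP; congr psi; apply/funext => g; rewrite /q; field.
  rewrite /E uE uvE smulBl smulBr scale_smull scale_smulr scalerBr.
  by rewrite opprB addrA subrK.
rewrite Euv; apply: nullZ; rewrite Eqv; apply: nullD.
  exact: E_null0 cq cw q01 w2.
apply: nullZ; apply: (E_null0 (K := 1)) => // g.
by rewrite ler01 lexx.
Qed.

Let psi_star u : continuous u -> (forall g, `|u g| <= 1) -> star (psi u) = psi u.
Proof.
move=> cu u1; have c1 : continuous (fun _ : G => 1 : R) by exact: contC.
have -> : psi u = psi (fun g => u g + 1) - psi (fun=> 1) by rewrite psiD// addrK.
rewrite starB (psi_star0 c1)// (psi_star0 (contD cu c1))// => g.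
by have := u1 g; rewrite ler_norml; lra.
Qed.

(* phi(t)* phi(t) = phi(1)* phi(1) for unitary t, as phi(p) phi(q) = phi(1) phi(p q). *)
Lemma order_zero_unitary (t : contG R G) : (forall g, `|contG_fun t g| = 1) ->
  null (star (phi t) ** phi t - star (phi contG_one) ** phi contG_one).
Proof.
move=> t1; pose a g := complex.Re (contG_fun t g); pose b g := complex.Im (contG_fun t g).
have tE g : contG_fun t g = (a g)%:C + 'i * (b g)%:C.
  by rewrite [LHS]complexE complexiE.
have rle (z : R[i]) : `|complex.Re z| <= rnorm (z : R[i]^o) /\ `|complex.Im z| <= rnorm (z : R[i]^o).
  by rewrite /rnorm normc_def /=; split; rewrite -sqrtr_sqr ler_wsqrtr// ?lerDl ?lerDr sqr_ge0.
have ct : continuous (contG_fun t) := subalg_mem t.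
have ca : continuous a.
  move=> g; apply/cvgrPdist_lt => e e0; have /cvg_rnormP/(_ e e0) := ct g.
  apply: filterS => s; apply: le_lt_trans; rewrite distrC /a -raddfB.
  exact: (rle _).1.
have cb : continuous b.
  move=> g; apply/cvgrPdist_lt => e e0; have /cvg_rnormP/(_ e e0) := ct g.
  apply: filterS => s; apply: le_lt_trans; rewrite distrC /b -raddfB.
  exact: (rle _).2.
have rt g : rnorm (contG_fun t g) = 1 by rewrite /rnorm t1.
have a1 g : `|a g| <= 1 by rewrite -(rt g); exact: (rle _).1.
have b1 g : `|b g| <= 1 by rewrite -(rt g); exact: (rle _).2.
have ab g : a g * a g + b g * b g = 1.
  have h : Num.sqrt (a g ^+ 2 + b g ^+ 2) = 1 by have := rt g; rewrite /rnorm normc_def.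
  have s0 : 0 <= a g ^+ 2 + b g ^+ 2 by rewrite addr_ge0 ?sqr_ge0.
  by have := sqr_sqrtr s0; rewrite h expr1n !expr2 => <-.
have tE' : t = cfun a + ('i : R[i]) *: cfun b.
  apply: contG_eq => g; rewrite contG_funD contG_funZ !cfunE//.
have phit : phi t = psi a + ('i : R[i]) *: psi b.
  rewrite {1}tE' linearD; congr (_ + _); exact: linearZ.
have phi1 : phi contG_one = psi (fun=> 1) by rewrite /psi cfun1.
have c1 : continuous (fun _ : G => 1 : R) by exact: contC.
have ca2 := contM ca ca; have cb2 := contM cb cb.
(* Expand (a - i b)(a + i b). The terms with phi(1) in the mixed defects cancel since a b = b a, and
   a^2 + b^2 = 1 accounts for phi(1) phi(1). *)
have -> : star (phi t) ** phi t - star (phi contG_one) ** phi contG_one =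
    E a a + E b b + 'i *: (E a b + (-1) *: E b a).
  rewrite phit phi1 starD starZ !psi_star//; last by move=> g; rewrite normr1.
  have conji : Num.conj ('i : R[i]) = - 'i := conjCi _.
  rewrite conji scaleN1r /E; set I := psi (fun=> 1).
  have -> : psi (fun g => b g * a g) = psi (fun g => a g * b g).
    by congr psi; apply/funext => g; rewrite mulrC.
  have <- : I ** psi (fun g => a g * a g) + I ** psi (fun g => b g * b g) = I ** I.
    rewrite -smulDr -psiD//; congr (_ ** psi _).
    by apply/funext => g; rewrite ab.
  rewrite smulDl !smulDr !scale_smull !scale_smulr !scalerA mulNr -expr2 sqrCi opprK.
  have e (y z w : F) : y - w - (z - w) = y - z by rewrite opprB addrA subrK.
  rewrite scale1r !scaleNr e scalerBr opprD !addrA.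
  by rewrite [LHS](ACl (1*5*4*6*2*3)).
apply: nullD; first by apply: nullD; exact: E_null.
by apply: nullZ; apply: nullD; [|apply: nullZ]; exact: E_null.
Qed.

End OrderZero.

(** * Spectral subspaces *)

Section Averages.
Context {R : realType} {G : topologicalZmodType} {A : cstarAlgType R}.
Hypothesis G_compact : compact [set: G].
Variable alpha : cstar_action G A.

Lemma dual_groupK (tau : G -> R[i]^o) g : dual_group R G tau -> Num.conj (tau g) * tau g = 1.
Proof. by case=> _ _ t1; rewrite mulrC -normCK t1 expr1n. Qed.

Lemma dual_group_conj (tau : G -> R[i]^o) : dual_group R G tau ->
  dual_group R G (fun g => Num.conj (tau g)).
Proof.
move=> [ct tM t1]; split=> [|g h|g].
- exact: (subalg_mem (star (Subalg (S := StarSubalg (@cont_star_subalg R G)) ct))).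
- by rewrite tM rmorphM.
- by rewrite norm_conjC.
Qed.

Lemma dual_group1 : dual_group R G (fun=> 1).
Proof. by split=> [g|g h|g]; [exact: cvg_cst|rewrite mulr1|rewrite normr1]. Qed.

Lemma dual_group0 (tau : G -> R[i]^o) : dual_group R G tau -> tau 0 = 1.
Proof.
move=> dt; have := dual_groupK 0 dt; case: dt => _ tM _ h.
have t0 : tau 0 != 0 by apply/eqP => z; move: h; rewrite z mulr0 => /eqP; rewrite eq_sym oner_eq0.
by apply: (mulfI t0); rewrite -tM addr0 mulr1.
Qed.

Lemma dual_group_rnorm (tau : G -> R[i]^o) g : dual_group R G tau -> rnorm (tau g) = 1.
Proof. by case=> _ _ t1; rewrite /rnorm t1. Qed.

(* Fixed points of the twisted action g x = conj (tau g) alpha_g x. *)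
Lemma spectral_average (B : set A) (tau : G -> R[i]^o) (x : A) :
  is_cstar_subalg B -> invariant_set alpha B -> dual_group R G tau -> B x ->
  exists w, [/\ spectral_subspace alpha B tau w, rnorm (w - x) <= 2 * rnorm x
    & forall d : R, (forall g, rnorm (alpha g x - (tau g : R[i]) *: x) <= d) ->
        rnorm (w - x) <= d].
Proof.
move=> sB iB dt Bx; have [ct tM t1] := dt; have [ct' tM' t1'] := dual_group_conj dt.
have r1 g := dual_group_rnorm g (dual_group_conj dt).
pose beta g (y : A) := (Num.conj (tau g) : R[i]) *: alpha g y.
have [| | | | | |w [wf [wd wC]]] := @fixed_point_near R G A beta G_compact _ _ _ _ _ _ x.
- by move=> g y z; rewrite /beta actDr scalerDr.
- by move=> g c y; rewrite /beta actZ !scalerA mulrC.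
- by move=> y; rewrite /beta act0 (dual_group0 (dual_group_conj dt)) scale1r.
- by move=> g h y; rewrite /beta actD actZ scalerA [Num.conj (tau (g + h))]tM'.
- by move=> g y; rewrite /beta rnormZ r1 mul1r act_rnorm.
- by move=> y g; apply: cvgZ; [exact: ct'|exact: act_continuous].
have dE g (y : A) : rnorm (beta g y - y) = rnorm (alpha g y - (tau g : R[i]) *: y).
  have -> : beta g y - y = (Num.conj (tau g) : R[i]) *: (alpha g y - (tau g : R[i]) *: y).
    by rewrite scalerBr scalerA dual_groupK// scale1r.
  by rewrite rnormZ r1 mul1r.
exists w; split.
- split.
    have [[B0 BD BZ _ _] clB] := sB; apply: wC => // [y z By Bz|g].
      by apply: BZ; exact: BD.
    by apply: BZ; exact: iB.
  move=> g; rewrite -{2}(wf g) /beta scalerA.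
  by rewrite [X in X *: _]mulrC dual_groupK// scale1r.
- apply: wd => g; apply: le_trans (rnormD _ _) _.
  by rewrite rnormN /beta rnormZ r1 mul1r act_rnorm; lra.
- by move=> d H; apply: wd => g; rewrite dE.
Qed.

(** Norm continuity of the orbit of a is equicontinuity in n, so compactness of G upgrades
    convergence at each g to uniform convergence. *)
Lemma uniform_equivariance (a : linf A) (h : A) (tau : G -> R[i]^o) :
  linf_alpha alpha a -> dual_group R G tau ->
  (forall g, vanish (fun n => (alpha g (linf_seq a n) - (tau g : R[i]) *: linf_seq a n) ** h)) ->
  forall e : R, 0 < e -> \forall n \near \oo, forall g,
    rnorm ((alpha g (linf_seq a n) - (tau g : R[i]) *: linf_seq a n) ** h) <= e.
Proof.
move=> [F aF cF] [ct _ _] ev e e0.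
pose P (n : nat) g := rnorm ((alpha g (linf_seq a n) - (tau g : R[i]) *: linf_seq a n) ** h) <= e.
have /compact_near_coveringP/(_ nat (\oo : set_system nat) P _) := G_compact.
case=> [g _|N _ H]; last first.
  by exists N => // n Nn g; exact: H.
pose M := linf_norm a; pose H := rnorm h.
have M0 : 0 <= M by exact: linf_norm_ge0.
have H0 : 0 <= H by exact: rnorm_ge0.
(* Moving from g to a nearby point costs at most (d + d M) H <= e / 3. *)
pose d := e / 3 / ((M + 1) * (H + 1)).
have MH : 0 < (M + 1) * (H + 1) by rewrite mulr_gt0// ltr_wpDl.
have d0 : 0 < d by rewrite !divr_gt0.
have dE : d * ((M + 1) * (H + 1)) = e / 3 by rewrite divfK// gt_eqF.
have e3 : 0 < e / 3 by rewrite divr_gt0.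
have /cvg_rnormP/(_ d d0) ht := ct g.
exists ([set s | linf_norm (F s - F g) < d /\ rnorm (tau s - tau g) < d],
  [set n | rnorm ((alpha g (linf_seq a n) - (tau g : R[i]) *: linf_seq a n) ** h) < e / 3]).
  split => /=; last exact: ev.
  by apply: filterS2 (cF g d d0) ht.
move=> [s n] /= [[Fs ts] en]; rewrite /P.
have -> : (alpha s (linf_seq a n) - (tau s : R[i]) *: linf_seq a n) ** h =
    (alpha g (linf_seq a n) - (tau g : R[i]) *: linf_seq a n) ** h +
    ((alpha s (linf_seq a n) - alpha g (linf_seq a n)) -
     ((tau s - tau g : R[i]) *: linf_seq a n)) ** h.
  rewrite -smulDl; congr (_ ** _); rewrite scalerBl opprB !addrA.
  by rewrite [RHS](ACl (3*6*1*4*5*2)) /= !addrK.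
have an : rnorm (linf_seq a n) <= M by exact: linf_norm_ub.
have h1 : rnorm (alpha s (linf_seq a n) - alpha g (linf_seq a n)) <= d.
  rewrite -!aF; apply: le_trans (ltW Fs).
  exact: (linf_norm_ub (F s - F g) n).
have h2 : rnorm ((tau s - tau g : R[i]) *: linf_seq a n) <= d * M.
  by rewrite rnormZ; apply: ler_pM; rewrite ?rnorm_ge0// ltW.
apply: le_trans (rnormD _ _) _.
set x := _ - alpha g _ in h1 *; set y := _ *: _ in h2 *.
have h3 : rnorm ((x - y) ** h) <= (d + d * M) * H.
  apply: le_trans (rnormM _ _) _; rewrite ler_wpM2r//.
  by apply: le_trans (rnormD _ _) _; rewrite rnormN lerD.
have := ltW en; move: h3; nra.
Qed.

(* The eigenvectors replacing h a_n h, for an asymptotically tau-equivariant (a_n). *)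
Lemma spectral_sequence (B : set A) (a : linf A) (h : A) (tau : G -> R[i]^o) :
  hereditary B -> invariant_set alpha B -> dual_group R G tau ->
  B h -> star h = h -> rnorm h <= 1 -> (forall g, alpha g h = h) ->
  linf_alpha alpha a ->
  (forall g, vanish (fun n => (alpha g (linf_seq a n) - (tau g : R[i]) *: linf_seq a n) ** h)) ->
  exists X : nat -> A, [/\ forall n, spectral_subspace alpha B tau (X n), bounded_seq X
    & vanish (fun n => X n - h ** linf_seq a n ** h)].
Proof.
move=> hB iB dt Bh sh h1 hf la ev; have [sB _] := hB.
have Bx n : B (h ** linf_seq a n ** h) by rewrite -{1}sh; exact: hereditary_conj.
have [X XP] := choice (fun n => spectral_average sB iB dt (Bx n)).
exists X; split.
- by move=> n; case: (XP n).
- have [M aM] := bounded_linf a; exists (3 * M) => n; have [_ Xn _] := XP n.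
  have xM : rnorm (h ** linf_seq a n ** h) <= M.
    apply: le_trans (rnormM _ _) _; rewrite -[leRHS]mulr1.
    apply: ler_pM; rewrite ?rnorm_ge0//; apply: le_trans (rnormM _ _) _.
    rewrite -[leRHS]mul1r; apply: ler_pM; rewrite ?rnorm_ge0//; exact: aM.
  rewrite -(subrK (h ** linf_seq a n ** h) (X n)).
  by apply: le_trans (rnormD _ _) _; lra.
- move=> e e0; have e2 : 0 < e / 2 by rewrite divr_gt0.
  apply: filterS (uniform_equivariance la dt ev e2) => n H.
  have [_ _ /(_ (e / 2)) Xn] := XP n; apply: (@le_lt_trans _ _ (e / 2)); last by lra.
  apply: Xn => g; rewrite !actM hf.
  have -> : h ** alpha g (linf_seq a n) ** h - (tau g : R[i]) *: (h ** linf_seq a n ** h) =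
      h ** ((alpha g (linf_seq a n) - (tau g : R[i]) *: linf_seq a n) ** h).
    by rewrite smulBl smulBr smulA scale_smull scale_smulr smulA.
  apply: le_trans (rnormM _ _) _; rewrite -[leRHS]mul1r.
  by apply: ler_pM; rewrite ?rnorm_ge0//; exact: H.
Qed.

(* h is the average of finitely many translates of star b b; one of them is
   always e-close to star b b. *)
Lemma dominating_fixed (B : set A) (b : A) (e : R) :
  is_cstar_subalg B -> invariant_set alpha B -> B b -> 0 < e ->
  exists h (M : R), [/\ B h, forall g, alpha g h = h, cone (uemb h), rnorm h <= 1
    & 0 <= M /\ cone (M *: uemb h + e%:A - uemb (star b ** b))].
Proof.
move=> sB iB Bb e0; have [[B0 BD BZ BM BS] clB] := sB.
pose x := star b ** b; have Bx : B x by apply: BM => //; exact: BS.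
have [s hs] : exists s : seq G, forall g,
    exists2 h, h \in s & rnorm (alpha g x - alpha h x) < e.
  apply: (@orbit_net R G A (fun g y => alpha g y)) => // y.
  exact: act_continuous.
have cx g : cone (uemb (alpha g x)).
  by rewrite /x actM act_star uembM -ustar_emb; exact: cone_star_mul.
pose h0 := \sum_(k <- s) alpha k x.
have act_h0 g : alpha g h0 = \sum_(k <- s) alpha (g + k) x.
  rewrite /h0 (big_morph (alpha g) (id1 := 0) (op1 := +%R)); last first.
  - by have := actB alpha g 0 0; rewrite !subrr.
  - by move=> y z; exact: actDr.
  by apply: eq_bigr => k _; rewrite actD.
(* A closed midconvex set containing the orbit of [h0], hence also an invariant element. *)
pose C := [set z : A | [/\ B z, cone (uemb z) & cone (uemb z + e%:A - uemb x)]].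
have cC : midconvex C.
  move=> y z [By cy cye] [Bz cz cze]; split.
  - by apply: BZ; exact: BD.
  - have -> : (2^-1 : R[i]) = (2^-1 : R)%:C by rewrite fmorphV rmorph_nat.
    rewrite uembZ uembD; apply: coneZ; first by rewrite invr_ge0.
    exact: coneD.
  - have -> : (2^-1 : R[i]) = (2^-1 : R)%:C by rewrite fmorphV rmorph_nat.
    have -> : uemb ((2^-1 : R)%:C *: (y + z)) + e%:A - uemb x =
        2^-1 *: ((uemb y + e%:A - uemb x) + (uemb z + e%:A - uemb x)).
      have two (v : unitization A) : (2^-1 : R) *: (v + v) = v.
        by rewrite -mulr2n -[v *+ 2]scaler_nat scalerA mulVf ?scale1r.
      rewrite uembZ uembD addrACA -opprD scalerBr two addrACA.
      by rewrite [in RHS]scalerDr two.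
    by apply: coneZ; [rewrite invr_ge0|exact: coneD].
have clC : closed C.
  apply/closed_rnormP => z H; split.
  - by move/closed_rnormP: clB; apply => r /H[y [By _ _] yz]; exists y.
  - apply: cone_limit => r /H[y [_ cy _] yz]; exists (uemb y) => //.
    by rewrite -uembB unorm_emb.
  - apply: cone_limit => r /H[y [_ _ cy] yz]; exists (uemb y + e%:A - uemb x) => //.
    by rewrite opprB addrA subrK opprD addrACA subrr addr0 -uembB unorm_emb.
have csum g (r : seq G) : cone (uemb (\sum_(k <- r) alpha (g + k) x)).
  elim: r => [|k r IH]; last by rewrite big_cons uembD; exact: coneD.
  by rewrite big_nil uemb0 -(scale0r 1); exact: cone_alg.
have Ch0 g : C (alpha g h0).
  rewrite act_h0; split.
  - by apply: (big_ind B) => // k _; exact: iB.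
  - exact: csum.
  (* Choosing k with alpha_k x close to alpha_(-g) x makes the summand alpha_(g+k) x e-close to x;
     the other summands are positive. *)
  - have [k ks hk] := hs (- g).
    rewrite (big_rem k)//=; set S := \sum_(y <- _) _.
    have -> : uemb (alpha (g + k) x + S) + e%:A - uemb x =
        (e%:A - uemb (x - alpha (g + k) x)) + uemb S.
      by rewrite uembD uembB opprB !addrA [LHS](ACl (3*1*4*2)).
    apply: coneD; last exact: csum.
    apply: selfadj_cone.
      apply: selfadj_emb; rewrite starB -act_star.
      by rewrite /x starM starK.
    rewrite unorm_emb -(act_rnorm alpha (- g)) actB -actD addrA addNr add0r.
    exact: ltW.
have [| | | | | |w [wf [_ wC]]] := @fixed_point_near R G A (fun g y => alpha g y) G_compact _ _ _ _ _ _ h0.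
- by move=> g y z; exact: actDr.
- by move=> g c y; exact: actZ.
- by move=> y; exact: act0.
- by move=> g h y; exact: actD.
- by move=> g y; exact: act_rnorm.
- by move=> y; exact: act_continuous.
have [Bw cw cwe] := wC C cC clC Ch0.
pose M := rnorm w + 1; have M0 : 0 < M by rewrite ltr_wpDl ?rnorm_ge0.
exists (M^-1%:C *: w), M; split.
- exact: BZ.
- by move=> g; rewrite actZ wf.
- by rewrite uembZ; apply: coneZ => //; rewrite invr_ge0 ltW.
- rewrite rnormZ rnorm_real gtr0_norm ?invr_gt0// ler_pdivrMl// mulr1.
  by rewrite lerDl.
- split; first exact: ltW.
  by rewrite uembZ scalerA mulfV ?gt_eqF// scale1r.
Qed.

End Averages.

(** * Saturation *)

Section FixedIdeal.
Context {R : realType} {G : topologicalZmodType} {A : cstarAlgType R}.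
Variables (alpha : cstar_action G A) (B : set A) (tau : G -> R[i]^o).
Hypothesis B_her : hereditary B.
Hypothesis B_inv : invariant_set alpha B.
Hypothesis tau_dual : dual_group R G tau.

Definition fixed_set : set A := [set b | B b /\ forall g, alpha g b = b].

Definition fixed_ideal : set A := cspan [set z | exists x y,
  [/\ spectral_subspace alpha B tau x, spectral_subspace alpha B tau y
    & z = star x ** y]].

Let sB : is_cstar_subalg B := B_her.1.

Let I_sub : closed_subspace fixed_ideal. Proof. exact: cspan_closed_subspace. Qed.

Lemma fixed_cstar_subalg : is_cstar_subalg fixed_set.
Proof.
have [[B0 BD BZ BM BS] clB] := sB; split; [split|].
- by split=> // g; have := actB alpha g 0 0; rewrite !subrr.
- by move=> x y [Bx fx] [By fy]; split=> [|g]; [exact: BD|rewrite actDr fx fy].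
- by move=> c x [Bx fx]; split=> [|g]; [exact: BZ|rewrite actZ fx].
- by move=> x y [Bx fx] [By fy]; split=> [|g]; [exact: BM|rewrite actM fx fy].
- by move=> x [Bx fx]; split=> [|g]; [exact: BS|rewrite act_star fx].
apply/closed_rnormP => x H; split.
  by move/closed_rnormP: clB; apply => e /H[y [By _] yx]; exists y.
move=> g; apply/eqP; rewrite -subr_eq0; apply/eqP; apply: rnorm_eq0.
apply/eqP; rewrite eq_le rnorm_ge0 andbT; apply/ler_addgt0Pr => e e0.
have e2 : 0 < e / 2 by rewrite divr_gt0.
have [y [_ fy] yx] := H _ e2; rewrite add0r.
have -> : alpha g x - x = (y - x) - alpha g (y - x).
  by rewrite actB fy opprB [RHS]addrC addrA subrK.
by apply: le_trans (rnormD _ _) _; rewrite rnormN act_rnorm; lra.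
Qed.

Lemma fixed_ideal_sub : fixed_ideal `<=` fixed_set.
Proof.
have [[_ _ _ BM BS] _] := sB.
apply: cspan_sub; first exact: cstar_subalg_closed_subspace fixed_cstar_subalg.
move=> _ [x [y [[Bx fx] [By fy] ->]]]; split; first by apply: BM => //; exact: BS.
move=> g; rewrite actM act_star fx fy starZ scale_smull scale_smulr scalerA.
by rewrite dual_groupK// scale1r.
Qed.

Lemma spectral_mulr x c : spectral_subspace alpha B tau x -> fixed_set c ->
  spectral_subspace alpha B tau (x ** c).
Proof.
have [[_ _ _ BM _] _] := sB; move=> [Bx fx] [Bc fc]; split; first exact: BM.
by move=> g; rewrite actM fx fc scale_smull.
Qed.

Lemma fixed_ideal_mulr i c : fixed_ideal i -> fixed_set c -> fixed_ideal (i ** c).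
Proof.
move=> Ii fc; move: i Ii; apply: (@cspan_sub _ _ _ [set i | fixed_ideal (i ** c)]).
  exact: closed_subspace_mulr.
move=> _ [x [y [Sx Sy ->]]]; apply: sub_cspan.
by exists x, (y ** c); split=> //; [exact: spectral_mulr|rewrite smulA].
Qed.

Lemma fixed_ideal_mull i c : fixed_ideal i -> fixed_set c -> fixed_ideal (c ** i).
Proof.
move=> Ii fc; have [[_ _ _ _ FS] _] := fixed_cstar_subalg.
move: i Ii; apply: (@cspan_sub _ _ _ [set i | fixed_ideal (c ** i)]).
  exact: closed_subspace_mull.
move=> _ [x [y [Sx Sy ->]]]; apply: sub_cspan; exists (x ** star c), y; split=> //.
  by apply: spectral_mulr => //; exact: FS.
by rewrite starM starK smulA.
Qed.

Lemma fixed_ideal_aunit i n : fixed_ideal i -> fixed_ideal (aunit i n).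
Proof.
have [I0 ID _ _] := I_sub; move=> Ii; elim: n => [|n IH] //=.
apply: (closed_subspaceB I_sub); first exact: ID.
by apply: fixed_ideal_mulr => //; exact: fixed_ideal_sub.
Qed.

(** Only the T side is bounded beforehand, so W is rewritten as T - (T - W) and the second unit
    likewise; every product then has a vanishing factor. *)
Lemma aunit_vanish (T W : nat -> A) m : (forall n, cone (uemb (T n))) ->
  (forall n, rnorm (T n) <= 1) -> vanish (fun n => T n - W n) ->
  vanish (fun n => aunit (T n) m - aunit (W n) m).
Proof.
move=> cT T1 TW; elim: m => [|m IH]; first by apply: vanish_eq (@vanish0 R A) => n; rewrite subrr.
have bE : bounded_seq (fun n => aunit (T n) m) by exists 1 => n; exact: aunit_le1.
have bT : bounded_seq T by exists 1.
have v1 := vanish_mull bE TW; have v2 := vanish_mulr bT IH; have v3 := vanish_mul IH TW.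
apply: vanish_eq (vanishB (vanishD IH TW) (vanishD v1 (vanishB v2 v3))) => n /=.
set E := aunit _ _; set E' := aunit _ _; set t := T n; set w := W n.
have -> : E ** (t - w) + ((E - E') ** t - (E - E') ** (t - w)) = E ** t - E' ** w.
  have e : t - (t - w) = w by rewrite opprB addrC subrK.
  by rewrite -smulBr e smulBr smulBl addrA subrK.
by rewrite !opprB !opprD !addrA [LHS](ACl (1*5*2*6*4*3)).
Qed.

(* y (1 - y* y)^m is small for large m, and y - y (1 - y* y)^m is close to the
   ideal as soon as y* y is. *)
Lemma fixed_ideal_root (Y W : nat -> A) : (forall n, fixed_set (Y n)) ->
  bounded_seq Y -> (forall n, fixed_ideal (W n)) ->
  vanish (fun n => star (Y n) ** Y n - W n) ->
  forall e : R, 0 < e -> exists Z : nat -> A, (forall n, fixed_ideal (Z n)) /\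
    \forall n \near \oo, rnorm (Y n - Z n) < e.
Proof.
move=> fY [M0 YM0] IW YW e e0; pose M := `|M0| + 1.
have M1 : 0 < M by rewrite ltr_wpDl.
have YM n : rnorm (Y n) <= M.
  by apply: le_trans (YM0 n) _; apply: le_trans (ler_norm M0) _; rewrite lerDl.
(* Scales Y* Y to a contraction, as the approximate unit requires. *)
pose c : R := (M ^+ 2)^-1; have c0 : 0 < c by rewrite invr_gt0 exprn_gt0.
pose T n := c%:C *: (star (Y n) ** Y n); pose W' n := c%:C *: W n.
have cT n : cone (uemb (T n)).
  by rewrite uembZ uembM -ustar_emb; apply: coneZ; [exact: ltW|exact: cone_star_mul].
have T1 n : rnorm (T n) <= 1.
  rewrite rnormZ rnorm_real gtr0_norm// rnorm_star_smul /c ler_pdivrMl ?exprn_gt0//.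
  by rewrite mulr1 lerXn2r// nnegrE ?rnorm_ge0// ltW.
have TW : vanish (fun n => T n - W' n).
  by apply: vanish_eq (vanishZ c%:C YW) => n; rewrite -scalerBr.
have e2 : 0 < e / 2 by rewrite divr_gt0.
have [m hm] : exists m : nat, M ^+ 2 / m.+1%:R < (e / 2) ^+ 2.
  have h0 : 0 <= M ^+ 2 / (e / 2) ^+ 2 by rewrite divr_ge0 ?exprn_ge0// ltW.
  exists (Num.bound (M ^+ 2 / (e / 2) ^+ 2)); have := archi_boundP h0.
  set m := Num.bound _; rewrite ltr_pdivrMr ?exprn_gt0// => hm.
  rewrite ltr_pdivrMr// mulrC; apply: lt_trans hm _.
  by rewrite ltr_pM2r ?exprn_gt0// ltr_nat.
have [_ _ IZ _] := I_sub.
exists (fun n => Y n ** aunit (W' n) m); split.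
  move=> n; apply: fixed_ideal_mull => //; apply: fixed_ideal_aunit.
  exact: IZ.
have bY : bounded_seq Y by exists M.
apply: filterS (vanish_mull bY (aunit_vanish m cT T1 TW) e2) => n h.
have -> : Y n - Y n ** aunit (W' n) m = (Y n - Y n ** aunit (T n) m) +
    Y n ** (aunit (T n) m - aunit (W' n) m) by rewrite smulBr addrA subrK.
rewrite (le_lt_trans (rnormD _ _))// [ltRHS](splitr e) ltrD//.
rewrite -(@ltr_pXn2r _ 2%N)// ?nnegrE ?rnorm_ge0//; last exact: ltW.
apply: le_lt_trans hm; rewrite -[leRHS]addr0.
(* Here M^2 T = Y* Y exactly, so the domination holds with error 0. *)
apply: (aunit_sub_le (cT n) (T1 n)) => //; first by rewrite exprn_ge0// ltW.
rewrite uembZ scalerA mulfV ?gt_eqF ?exprn_gt0// scale1r scale0r addr0 subrr.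
by rewrite -(scale0r 1); exact: cone_alg.
Qed.

End FixedIdeal.

(** * From the Rokhlin maps to full strong Arveson spectra *)

Section Saturation.
Context {R : realType} {G : topologicalZmodType} {A : cstarAlgType R}.
Hypothesis G_compact : compact [set: G].
Variables (alpha : cstar_action G A) (B : set A) (tau : G -> R[i]^o) (d : nat).
Hypothesis B_her : hereditary B.
Hypothesis B_inv : invariant_set alpha B.
Hypothesis tau_dual : dual_group R G tau.
Hypothesis rok : rokhlin_le alpha d.
Local Notation I := (fixed_ideal alpha B tau).
Local Notation Bfix := (fixed_set alpha B).

Let sB : is_cstar_subalg B := B_her.1.

Lemma vanish_star_mul (X P : nat -> A) : bounded_seq P -> vanish (fun n => X n - P n) ->
  vanish (fun n => star (X n) ** X n - star (P n) ** P n).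
Proof.
move=> bP XP; have XP' := vanish_star XP; have bP' := bounded_star bP.
apply: vanish_eq (vanishD (vanish_mul XP' XP)
  (vanishD (vanish_mulr bP XP') (vanish_mull bP' XP))) => n.
move: (X n) (P n) => x y; rewrite addrA -smulDr subrK starB.
by rewrite smulBr smulBl addrA subrK.
Qed.

Section OneMap.
Variable h : A.
Hypothesis h_fix : Bfix h.
Hypothesis cone_h : cone (uemb h).
Hypothesis h_le1 : rnorm h <= 1.
Let D := unit_subalg cone_h h_le1.
Variable phi : {linear contG R G -> Falpha alpha D}.
Hypothesis phi_cpc : cpc_order_zero (@contG_norm R G) (@Falpha_norm R G A alpha D) phi.
Hypothesis phi_equi : forall g f, Falpha_act g (phi f) (phi (Lt g f)).

Let h_star : star h = h. Proof. by have [/(congr1 snd)] := cone_h. Qed.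
Let hD : csubalg_set D h. Proof. exact: unit_set_h. Qed.

Let tbar : contG R G := Subalg (S := StarSubalg (@cont_star_subalg R G))
  (let: And3 ct _ _ := dual_group_conj tau_dual in ct).

Let equi (sigma : G -> R[i]^o) (f : contG R G) (a : linf A) :
  (forall g, Lt g f = (sigma g : R[i]) *: f) -> Falpha_rep a (phi f) ->
  forall g, vanish (fun n => (alpha g (linf_seq a n) - (sigma g : R[i]) *: linf_seq a n) ** h).
Proof.
move=> fE af g; have := phi_equi g f; rewrite fE => act.
have iD : invariant_set alpha (csubalg_set D).
  by apply: unit_set_invariant; case: h_fix.
have e : phi ((sigma g : R[i]) *: f) = (sigma g : R[i]) *: phi f by exact: linearZ.
rewrite e in act; exact: (rep_act iD hD act af (repZ (sigma g) af)).
Qed.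

Lemma order_zero_ideal : exists k : linf A, Falpha_rep k (phi contG_one) /\
  forall e : R, 0 < e -> exists Z : nat -> A, (forall n, I (Z n)) /\
    \forall n \near \oo, rnorm (h ** linf_seq k n ** h - Z n) < e.
Proof.
have [Bh fh] := h_fix; have [ct tM t1] := tau_dual.
have [a la ar] := rep_exists (phi tbar); have [k lk kr] := rep_exists (phi contG_one).
exists k; split=> // e e0.
have tbarE g : Lt g tbar = (tau g : R[i]) *: tbar.
  apply: contG_eq => s; rewrite contG_funZ.
  rewrite -[LHS]/(Num.conj (tau (s - g))) -[contG_fun tbar s]/(Num.conj (tau s)).
  have [_ tM' _] := dual_group_conj tau_dual.
  rewrite [LHS]tM' mulrC; congr (_ * _).
  have : tau g * tau (- g) = 1 by rewrite -tM subrr (dual_group0 tau_dual).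
  have := dual_groupK (- g) tau_dual => h1 h2.
  by rewrite -[LHS]mulr1 -h2 mulrCA h1 mulr1.
have oneE g : Lt g (contG_one : contG R G) = (1 : R[i]) *: contG_one.
  by apply: contG_eq => s; rewrite contG_funZ mul1r.
have [X [SX bX hX]] := spectral_sequence G_compact B_her B_inv tau_dual Bh h_star h_le1 fh la
  (equi tbarE ar).
have [Y [SY bY hY]] := spectral_sequence G_compact B_her B_inv (@dual_group1 R G) Bh h_star h_le1 fh lk
  (equi (sigma := fun=> 1) oneE kr).
have fY n : Bfix (Y n).
  by have [BY aY] := SY n; split=> // g; rewrite aY scale1r.
have IX n : I (star (X n) ** X n) by apply: sub_cspan; exists (X n), (X n).
(* Asymptotic centrality moves both factors h to the right, leaving a_n* a_n and k_n* k_n adjacent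
   for the order zero relation. *)
have hmove (c : linf A) (u : Falpha alpha D) : Falpha_rep c u ->
    vanish (fun n => h ** linf_seq c n ** h - linf_seq c n ** h ** h).
  move=> /rep_comm/(_ hD) cu.
  apply: vanish_eq (vanishN (vanish_mulr (bounded_cst h) cu)) => n.
  by rewrite smulBl opprB.
have bhh (c : linf A) : bounded_seq (fun n => linf_seq c n ** h ** h).
  apply: (boundedM (x := fun n => linf_seq c n ** h) (y := fun=> h)); last exact: bounded_cst.
  by apply: (boundedM (y := fun=> h)); [exact: bounded_linf|exact: bounded_cst].
have XP : vanish (fun n => X n - linf_seq a n ** h ** h).
  by apply: vanish_eq (vanishD hX (hmove _ _ ar)) => n; rewrite addrA subrK.
have YQ : vanish (fun n => Y n - linf_seq k n ** h ** h).
  by apply: vanish_eq (vanishD hY (hmove _ _ kr)) => n; rewrite addrA subrK.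
have nul : null (star (phi tbar) ** phi tbar - star (phi contG_one) ** phi contG_one).
  apply: order_zero_unitary => // g; rewrite -[contG_fun tbar g]/(Num.conj (tau g)).
  by rewrite norm_conjC.
have nv := null_vanish nul (repB (repM (rep_star ar) ar) (repM (rep_star kr) kr)) hD.
(* [nv] has one factor h on the right; one more is multiplied on the right and h^2 on the left. *)
have PQ : vanish (fun n => star (linf_seq k n ** h ** h) ** (linf_seq k n ** h ** h) -
    star (linf_seq a n ** h ** h) ** (linf_seq a n ** h ** h)).
  apply: vanish_eq (vanishN (vanish_mulr (bounded_cst h)
    (vanish_mull (bounded_cst (h ** h)) nv))) => n.
  rewrite -[linf_seq (_ - _) n]/(star (linf_seq a n) ** linf_seq a n -
    star (linf_seq k n) ** linf_seq k n).
  by rewrite !starM h_star smulBl smulBr smulBl opprB !smulA.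
have YX : vanish (fun n => star (Y n) ** Y n - star (X n) ** X n).
  have vX := vanish_star_mul (bhh a) XP; have vY := vanish_star_mul (bhh k) YQ.
  apply: vanish_eq (vanishB (vanishD vY PQ) vX) => n.
  by rewrite addrA subrK opprB addrA subrK.
have e2 : 0 < e / 2 by rewrite divr_gt0.
have [Z [IZ YZ]] := fixed_ideal_root B_her tau_dual fY bY IX YX e2.
exists Z; split=> //; apply: filterS2 YZ (hY _ e2) => n h1 h2.
have -> : h ** linf_seq k n ** h - Z n = (Y n - Z n) - (Y n - h ** linf_seq k n ** h).
  by rewrite opprB [RHS]addrC addrA subrK.
by rewrite (le_lt_trans (rnormD _ _))// rnormN [ltRHS](splitr e) ltrD.
Qed.

End OneMap.

Lemma fixed_in_ideal h : Bfix h -> cone (uemb h) -> rnorm h <= 1 -> I h.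
Proof.
move=> fh ch h1; have [Bh hf] := fh.
have Isub : closed_subspace I by exact: cspan_closed_subspace.
have [I0 ID IZ clI] := Isub.
have /(_ (unit_subalg ch h1) (unit_set_sigma_unital ch h1)
  (unit_set_invariant hf))[phi [cpc equi unit]] := rok.
have [k kP] := choice (fun j => order_zero_ideal fh (cpc j) (equi j)).
have krep := rep_sum (fun j => (kP j).1).
have ku := rep_unit hf unit krep.
have seq_sum n : linf_seq (\sum_j k j) n = \sum_j linf_seq (k j) n.
  by rewrite (big_morph (fun a : linf A => linf_seq a n) (id1 := 0) (op1 := +%R)).
(* Compare h^2 with h (k_0 + ... + k_d) h: half of e pays for the unit property, the rest is shared
   by the d + 1 maps. *)
have Ihh : I (h ** h).
  move/closed_rnormP: clI; apply => e e0.
  have e2 : 0 < e / 2 by rewrite divr_gt0.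
  have ed : 0 < e / 2 / d.+1%:R by rewrite divr_gt0.
  have [Z ZP] := choice (fun j => (kP j).2 _ ed).
  have near_all : \forall n \near \oo, forall j,
      rnorm (h ** linf_seq (k j) n ** h - Z j n) < e / 2 / d.+1%:R.
    by apply: filter_forall => j; exact: (ZP j).2.
  have [N _ /(_ N (leqnn N)) [/= H1 H2]] : \forall n \near \oo,
      (forall j, rnorm (h ** linf_seq (k j) n ** h - Z j n) < e / 2 / d.+1%:R) /\
      rnorm (linf_seq (\sum_j k j) n ** h - h) < e / 2.
    by apply: filterS2 near_all (ku _ e2).
  exists (\sum_j Z j N); first by apply: closed_subspace_sum => // j; exact: (ZP j).1.
  have -> : \sum_j Z j N - h ** h =
      h ** (linf_seq (\sum_j k j) N ** h - h) -
      \sum_j (h ** linf_seq (k j) N ** h - Z j N).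
    rewrite sumrB smulBr smulA seq_sum.
    rewrite (big_morph (fun z => h ** z) (id1 := 0) (op1 := +%R)); last exact: smulr0; last first.
      by move=> ? ?; exact: smulDr.
    rewrite (big_morph (fun z => z ** h) (id1 := 0) (op1 := +%R)); last exact: smul0r; last first.
      by move=> ? ?; exact: smulDl.
    by rewrite opprB [RHS]addrC addrA subrK.
  rewrite (le_lt_trans (rnormD _ _))// rnormN [ltRHS](splitr e) ltr_leD//.
    apply: le_lt_trans (rnormM _ _) _; apply: le_lt_trans H2.
    by rewrite ler_piMl ?rnorm_ge0.
  have sum_le (r : seq 'I_d.+1) (F : 'I_d.+1 -> A) :
      rnorm (\sum_(j <- r) F j) <= \sum_(j <- r) rnorm (F j).
    elim: r => [|j r IH]; first by rewrite !big_nil rnorm0.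
    by rewrite !big_cons (le_trans (rnormD _ _))// lerD2l.
  apply: le_trans (sum_le _ _) _.
  apply: (@le_trans _ _ (\sum_(j < d.+1) e / 2 / d.+1%:R)).
    by apply: ler_sum => j _; exact: ltW.
  by rewrite sumr_const card_ord -[_ *+ _]mulr_natr divfK ?pnatr_eq0.
(* Each h u_n is a polynomial in h starting at h^2, hence in the ideal, and h u_n tends to h. *)
have Iha n : I (h ** aunit h n).
  elim: n => [|n IH] /=; first by rewrite smulr0.
  rewrite smulBr smulDr; apply: (closed_subspaceB Isub); first exact: ID.
  by rewrite smulA; apply: fixed_ideal_mulr.
have [v _] := unit_set_h ch h1.
apply: (vanish_limit clI Iha); apply: vanish_eq (vanishN v) => n.
by rewrite opprB.
Qed.

Let J := cspan [set z | exists x b y,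
  [/\ spectral_subspace alpha B tau x, B b, spectral_subspace alpha B tau y
    & z = star x ** b ** y]].

Let J_sub : closed_subspace J. Proof. exact: cspan_closed_subspace. Qed.

Lemma ideal_sandwich i b j : I i -> B b -> I j -> J (i ** b ** j).
Proof.
have [[_ _ _ BM BS] _] := sB.
move=> Ii Bb Ij; move: i Ii; apply: (@cspan_sub _ _ _ [set i | J (i ** b ** j)]).
  exact: closed_subspace_mulr (closed_subspace_mulr _ J_sub).
move=> _ [x [y [Sx Sy ->]]] /=; move: j Ij.
apply: (@cspan_sub _ _ _ [set j | J (star x ** y ** b ** j)]).
  exact: closed_subspace_mull.
move=> _ [x' [y' [Sx' Sy' ->]]] /=; apply: sub_cspan.
exists x, (y ** b ** star x'), y'; split=> //; last by rewrite !smulA.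
by apply: (BM); [apply: (BM) => //; case: Sy|apply: BS; case: Sx'].
Qed.

Lemma her_sub_span : B `<=` J.
Proof.
have [[B0 BD BZ BM BS] clB] := sB; have [J0 JD JZ clJ] := J_sub.
suff H b : B b -> star b = b -> J b.
  move=> b Bb; have [b1 [b2 [[B1 B2] s1 s2 ->]]] := star_decomp sB.1 Bb.
  by apply: JD; [|apply: JZ]; exact: H.
move=> Bb sb; move/closed_rnormP: clJ; apply => e e0.
(* Both M/(n+1) and the domination error are at most r, so b - b u has norm at most e/4. *)
pose r := (e / 4) ^+ 2 / 2.
have r0 : 0 < r by rewrite divr_gt0// exprn_gt0// divr_gt0.
have [h [M [Bh fh ch h1 [M0 cM]]]] := dominating_fixed G_compact sB B_inv Bb r0.
have Ih : I h by exact: fixed_in_ideal.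
have [n hn] : exists n : nat, M / n.+1%:R < r.
  have h0 : 0 <= M / r by rewrite divr_ge0// ltW.
  exists (Num.bound (M / r)); have := archi_boundP h0.
  set m := Num.bound _; rewrite ltr_pdivrMr// => hm.
  rewrite ltr_pdivrMr// mulrC; apply: lt_trans hm _.
  by rewrite ltr_pM2r// ltr_nat.
pose u := aunit h n.
have bu : rnorm (b - b ** u) <= e / 4.
  rewrite -(@ler_pXn2r _ 2%N)// ?nnegrE ?rnorm_ge0//; last by rewrite divr_ge0// ltW.
  apply: le_trans (aunit_sub_le ch h1 M0 (ltW r0) cM n) _.
  by rewrite [leRHS]splitr -/r lerD2r ltW.
have su : star u = u by exact: aunit_star.
have ub : rnorm (b - u ** b) <= e / 4.
  by rewrite -rnorm_star starB starM su sb.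
have Iu : I u by exact: fixed_ideal_aunit.
exists (u ** b ** u); first exact: ideal_sandwich.
have -> : u ** b ** u - b = - ((b - b ** u) + (b - u ** b) ** u).
  by rewrite smulBl addrA subrK opprB.
rewrite rnormN (le_lt_trans (rnormD _ _))//.
have : rnorm ((b - u ** b) ** u) <= e / 4.
  apply: le_trans (rnormM _ _) _; rewrite -[leRHS]mulr1.
  by apply: ler_pM; rewrite ?rnorm_ge0//; exact: aunit_le1.
by lra.
Qed.

Lemma strong_arveson_full : strong_arveson_spectrum alpha B tau.
Proof.
split=> //; apply/seteqP; split; last exact: her_sub_span.
have [[B0 BD BZ BM BS] clB] := sB.
apply: cspan_sub; first exact: cstar_subalg_closed_subspace.
move=> _ [x [b [y [[Bx _] Bb [By _] ->]]]].
by apply: (BM) => //; apply: (BM) => //; exact: BS.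
Qed.

End Saturation.

Theorem proposition1p16 (R : realType) (G : topologicalZmodType)
    (G_compact : compact [set: G]) (G_hausdorff : hausdorff_space G)
    (G_second_countable : @second_countable G)
    (A : cstarAlgType R) (alpha : cstar_action G A) :
  (rokhlin_dim alpha < +oo)%E -> hereditarily_saturated alpha.
Proof.
move=> fin; have [d rok] : exists d, rokhlin_le alpha d.
  (* If no d worked, the infimum would be over the empty set, hence infinite. *)
  apply: contrapT => nrok; move: fin; rewrite /rokhlin_dim.
  rewrite (_ : [set _ | _ in _] = set0) ?ereal_inf0 ?ltxx//.
  by apply/seteqP; split=> // x [d rd _]; case: nrok; exists d.
apply/seteqP; split=> [tau sat|tau dt B HB].
  (* A itself is an invariant hereditary subalgebra, and its strong Arveson spectrum consists of
     characters. *)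
  have HT : Her_alpha alpha [set: A] by split=> //; split=> //; split=> //; exact: closedT.
  by have [dt _] := sat _ HT.
have [hB iB] := HB.
exact: (strong_arveson_full G_compact hB iB dt rok).
Qed.
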